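(* Let $\Lambda\subset\mathbb{R}^2$ be a uniformly discrete set and let $I=(a,b)\times(c,d)$ with $0<a<b<\infty$, $0<c<d<\infty$. The following statements are equivalent: (i) For every $\sigma>0$ there is a constant $K=K(\sigma)$ such that $$\|f\|_\infty\le K\sup_{\alpha\in I}\sup_{\lambda\in\Lambda}|(f*G_\alpha)(\lambda)|\quad\text{for every } f\in B_\sigma.$$ (ii) $\Lambda$ satisfies condition (A): every set $\Lambda^*\in W(\Lambda)$ is non-empty and does not lie on (i.e. is not a subset of) any curvilinear lattice $l_{t,\xi,r}$.
   Context: A set $\Lambda\subset\mathbb{R}^2$ is uniformly discrete if $\delta(\Lambda):=\inf\{|\lambda-\lambda'|:\lambda,\lambda'\in\Lambda,\lambda\ne\lambda'\}>0$ (the empty set is allowed as a uniformly discrete set). Gaussian kernel: for $\alpha=(\alpha_1,\alpha_2)\in I$ and $x=(x_1,x_2)\in\mathbb{R}^2$, $G_\alpha(x)=e^{-\alpha_1x_1^2-\alpha_2x_2^2}$. Convolution: $(f*G_\alpha)(x)=\int_{\mathbb{R}^2}f(x-s)G_\alpha(s)\,ds$. $\|f\|_\infty=\sup_{x\in\mathbb{R}^2}|f(x)|$. Bernstein space: $B_\sigma$ is the space of all entire functions $f$ on $\mathbb{C}^2$ satisfying $|f(z)|\le Ce^{\sigma(|y_1|+|y_2|)}$ for all $z=(x_1+iy_1,x_2+iy_2)\in\mathbb{C}^2$, with a constant $C=C(f)$. Weak convergence: let $\Lambda_k$ $(k\in\mathbb{N})$ and $\Lambda'$ be uniformly discrete subsets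 of $\mathbb{R}^2$ with $\delta(\Lambda_k)\ge\delta>0$ for all $k$. $\Lambda_k$ converges weakly to $\Lambda'$ if for every (large) $R>0$ and (small) $\varepsilon>0$ there is $N=N(R,\varepsilon)$ such that for all $k\ge N$: $\Lambda_k\cap(-R,R)^2\subset\Lambda'+(-\varepsilon,\varepsilon)^2$ and $\Lambda'\cap(-R,R)^2\subset\Lambda_k+(-\varepsilon,\varepsilon)^2$. $W(\Lambda)$ is the collection of all weak limits of sequences of translates $\Lambda-x_k$, where $\{x_k\}\subset\mathbb{R}^2$ is an arbitrary (bounded or unbounded) sequence. Curvilinear lattice: for any three vectors $t=(t_1,t_2)\in\mathbb{R}^2$, $\xi=(\xi_1,\xi_2)\in\mathbb{R}^2$ and $r=(r_1,r_2)\in\mathbb{R}^2$ with $r_1^2+r_2^2=1$, $$l_{t,\xi,r}:=\{\lambda=(\lambda_1,\lambda_2)\in\mathbb{R}^2: r_1\cos(\lambda_1\xi_1+\lambda_2\xi_2+t_1)=r_2\cos(-\lambda_1\xi_1+\lambda_2\xi_2+t_2)\}.$$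
   Formalization: In condition (A) only curvilinear lattices different from the whole plane are considered; e.g. ξ=0, t=(π/2,π/2) gives l=R², so as literally stated (A) would fail for every Λ while (i) holds for some Λ. *)

(* Defs.v *)
From HB Require Import structures.
From mathcomp Require Import all_boot all_order all_algebra.
From mathcomp Require Import all_classical all_reals all_analysis.
From mathcomp Require Import complex.

Set Implicit Arguments.
Unset Strict Implicit.
Unset Printing Implicit Defensive.

Import Order.TTheory GRing.Theory Num.Theory.
Import numFieldNormedType.Exports.

Local Open Scope classical_set_scope.
Local Open Scope complex_scope.
Local Open Scope ring_scope.

(* The library norm on [R * R] is the max norm, hence this definition. *)
Definition euclid_norm (R : realType) (x : R * R) : R :=
  Num.sqrt (x.1 ^+ 2 + x.2 ^+ 2).

(* Extended-real valued: it is [+oo] when [L] has at most one point. *)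
Definition separation (R : realType) (L : set (R * R)) : \bar R :=
  ereal_inf [set d | exists u v : R * R,
    [/\ L u, L v, u <> v & d = (euclid_norm (u - v))%:E]].

Definition uniformly_discrete (R : realType) (L : set (R * R)) : Prop :=
  (0 < separation L)%E.

Definition open_square (R : realType) (r : R) : set (R * R) :=
  `]- r, r[%classic `*` `]- r, r[%classic.

Definition set_add (R : realType) (A B : set (R * R)) : set (R * R) :=
  [set u + v | u in A & v in B].

Definition translate (R : realType) (L : set (R * R)) (x : R * R) :
    set (R * R) :=
  [set u - x | u in L].

Definition weakly_converges (R : realType) (L : nat -> set (R * R))
    (L' : set (R * R)) : Prop :=
  [/\ exists2 d : R, 0 < d & forall k, (d%:E <= separation (L k))%E,
      uniformly_discrete L'
    & forall r e : R, 0 < r -> 0 < e ->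
        exists N : nat, forall k : nat, (N <= k)%N ->
          L k `&` open_square r `<=` set_add L' (open_square e) /\
          L' `&` open_square r `<=` set_add (L k) (open_square e)].

Definition weak_limits (R : realType) (L : set (R * R)) :
    set (set (R * R)) :=
  [set L' | exists x : nat -> R * R,
    weakly_converges (fun k => translate L (x k)) L'].

Definition curvilinear_lattice (R : realType) (t xi r : R * R) :
    set (R * R) :=
  [set l | r.1 * cos (l.1 * xi.1 + l.2 * xi.2 + t.1) =
           r.2 * cos (- (l.1 * xi.1) + l.2 * xi.2 + t.2)].

(* When [xi.1 = 0] or [xi.2 = 0] the defining equation can be an identity, and
   the "curve" is then the whole plane (e.g. [xi = 0], [t = (pi/2, pi/2)]).
   Such parameters do not define a curvilinear lattice and are excluded;
   otherwise no set at all would satisfy the condition. *)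
Definition condition_A (R : realType) (L : set (R * R)) : Prop :=
  forall L' : set (R * R), weak_limits L L' ->
    L' !=set0 /\
    forall t xi r : R * R, r.1 ^+ 2 + r.2 ^+ 2 = 1 ->
      curvilinear_lattice t xi r <> setT ->
      ~ (L' `<=` curvilinear_lattice t xi r).

(* [^o] selects the normed [R[i]]-module structure of [R[i]], so that
   [differentiable] means complex (Frechet) differentiable on C^2. *)
Definition entire2 (R : realType) (f : R[i]^o * R[i]^o -> R[i]^o) : Prop :=
  forall z : R[i]^o * R[i]^o, differentiable f z.

Definition bernstein (R : realType) (sigma : R)
    (f : R[i]^o * R[i]^o -> R[i]^o) : Prop :=
  entire2 f /\
  exists C : R, forall z : R[i]^o * R[i]^o,
    Normc.normc (f z) <=
      C * expR (sigma * (`|complex.Im z.1| + `|complex.Im z.2|)).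

Definition real_restriction (R : realType) (f : R[i]^o * R[i]^o -> R[i]^o)
    (x : R * R) : R[i] :=
  f (x.1%:C, x.2%:C).

Definition gaussian (R : realType) (a x : R * R) : R :=
  expR (- a.1 * x.1 ^+ 2 - a.2 * x.2 ^+ 2).

Definition plane_measure (R : realType) :=
  (@lebesgue_measure R \x @lebesgue_measure R)%E.

Definition complex_integral (R : realType) (F : R * R -> R[i]) : R[i] :=
  (\int[@plane_measure R]_s complex.Re (F s)) +i*
  (\int[@plane_measure R]_s complex.Im (F s)).

Definition gauss_conv (R : realType) (g : R * R -> R[i]) (a x : R * R) :
    R[i] :=
  complex_integral (fun s => g (x - s) * (gaussian a s)%:C).

(* The suprema below are real-valued.  For [g] the restriction of an element of
   a Bernstein space and [I] bounded away from 0 in both coordinates, the sets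
   are bounded above, and [sup set0 = 0] is the right convention for a supremum
   of nonnegative quantities. *)
Definition sup_norm (R : realType) (g : R * R -> R[i]) : R :=
  sup [set Normc.normc (g x) | x in [set: R * R]].

Definition sample_norm (R : realType) (I L : set (R * R))
    (g : R * R -> R[i]) : R :=
  sup [set sup [set Normc.normc (gauss_conv g a l) | l in L] | a in I].

Definition sampling_inequality (R : realType) (I L : set (R * R))
    (sigma : R) : Prop :=
  exists K : R, forall f : R[i]^o * R[i]^o -> R[i]^o, bernstein sigma f ->
    sup_norm (real_restriction f) <= K * sample_norm I L (real_restriction f).

(* Main.v *)
(** (ii) => (i).  If (i) fails for some sigma, normalised and translated
    violators converge, along a free ultrafilter, to a bounded function g of
    exponential type with g(0) <> 0 whose convolutions with all G_alpha,
    alpha in I, vanish on a limit M of translates of Lambda.  Uniqueness for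
    Gaussian integrals (all moments vanish, then Laplace's peak method) turns
    this into: the sum of g over the four points l + (+-t1, +-t2) vanishes for
    all l in M and all t.  This relation survives the operators d1^2, d2^2,
    which are bounded by Bernstein's inequality, and translations and limits.
    Passing to approximate eigenvectors of d1^2 and then d2^2, again along an
    ultrafilter, replaces g by a joint eigenfunction, i.e. a combination of
    products of cos/sin in x1 and x2; the relation at t = 0 places M on a
    curvilinear lattice, against (A).

    (i) => (ii).  If a weak limit lies on the curvilinear lattice of a wave u,
    then u has zero convolution with every G_alpha on it, by symmetry.  Damping
    u by a slowly varying factor tending to 0 at infinity gives functions with
    small convolutions on a translate of Lambda and norm bounded below. *)

Require Import Defs.
From HB Require Import structures.
From mathcomp Require Import all_boot all_order all_algebra.
From mathcomp Require Import all_classical all_reals all_analysis.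
From mathcomp Require Import measurable_realfun complex.
From mathcomp Require Import ring lra.
Import Order.TTheory GRing.Theory Num.Theory.
Import numFieldNormedType.Exports.
Local Open Scope classical_set_scope.
Local Open Scope ring_scope.

Set Implicit Arguments.
Unset Strict Implicit.
Unset Printing Implicit Defensive.

(** * Norms of complex numbers and approximate eigenvalues *)

(** A sup norm need not be attained, so a limit of almost extremal functions could vanish. Hence a
    near-maximum is moved to the origin before each such passage to the limit, and the sampling set
    is translated along with the function. Functions, derivatives and sets have to converge for the
    same indices; one ultrafilter achieves this at all points of the plane at once, without diagonal
    extraction.

    The four-point relation is even in each coordinate of t, and one derivative makes it odd. So the
    squares of the partial derivatives are the operators to diagonalise. Their spectrum is reached
    through a seminorm on polynomials p, the sup norm of p(d1^2) g, without constructing a Banach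
    space or an inverse. A joint eigenfunction has four real coefficients after taking a real or
    imaginary part, and the product-to-sum formulas leave two cosines with the phases x xi1 + y xi2
    and - x xi1 + y xi2: this is the shape of a curvilinear lattice.

    In the converse, the damping factors have bounded exponential type while their scale tends to 0,
    so a single constant K has to serve all test functions. *)

Local Notation nm := (@Normc.normc _).
Local Notation Re := (@complex.Re _).
Local Notation Im := (@complex.Im _).

Section ComplexNorm.
Context {R : realType}.
Implicit Types x y z : R[i].

Lemma nm_ge0 z : 0 <= nm z.
Proof. by case: z => a b; rewrite /= sqrtr_ge0. Qed.

Lemma nmD x y : nm (x + y) <= nm x + nm y.
Proof. exact: (@le_normcD R x y). Qed.

Lemma nmN x : nm (- x) = nm x.
Proof. exact: (@normcN R x). Qed.

Lemma nmB x y : nm (x - y) <= nm x + nm y.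
Proof. by rewrite (le_trans (nmD _ _))// nmN. Qed.

Lemma nm_distC x y : nm (x - y) = nm (y - x).
Proof. by rewrite -nmN opprB. Qed.

Lemma nmM x y : nm (x * y) = nm x * nm y.
Proof. exact: Normc.normcM. Qed.

Lemma nmX x n : nm (x ^+ n) = nm x ^+ n.
Proof. by elim: n => [|n IH]; rewrite ?expr0 ?Normc.normc1// !exprS nmM IH. Qed.

Lemma nm0_eq0 x : nm x = 0 -> x = 0.
Proof. exact: Normc.eq0_normc. Qed.

Lemma nm_gt0 x : x != 0 -> 0 < nm x.
Proof.
move=> x0; rewrite lt_neqAle nm_ge0 andbT eq_sym.
by apply: contra x0 => /eqP/nm0_eq0 ->.
Qed.

Lemma nm_real (r : R) : nm (r%:C%C) = `|r|.
Proof. by rewrite /= expr0n addr0 sqrtr_sqr. Qed.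

Lemma nm_sum (I : Type) (s : seq I) (P : pred I) (F : I -> R[i]) :
  nm (\sum_(i <- s | P i) F i) <= \sum_(i <- s | P i) nm (F i).
Proof.
elim/big_rec2: _ => [|i y x _ h]; first by rewrite Normc.normc0.
by rewrite (le_trans (nmD _ _))// lerD2l.
Qed.

End ComplexNorm.

(** * Approximate eigenvalues through a seminorm on polynomials *)

Section ApproximateEigenvalue.

Lemma deriv_prod_seq (K : comNzRingType) (I : eqType) (r : seq I)
    (F : I -> {poly K}) : uniq r ->
  (\prod_(j <- r) F j)^`() =
  \sum_(i <- r) (F i)^`() * \prod_(j <- r | j != i) F j.
Proof.
elim: r => [|x r IH] /=; first by rewrite !big_nil derivC.
case/andP=> xr ur; rewrite !big_cons derivM eqxx /= IH//.
congr (_ + _).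
  congr (_ * _); rewrite big_seq [RHS]big_seq_cond; apply: eq_bigl => j.
  by case: (boolP (j \in r)) => //= jr; rewrite (memPn xr).
rewrite mulr_sumr !big_seq; apply: eq_bigr => i ir; rewrite big_cons.
have -> : x != i by apply: contraNneq xr => ->.
by rewrite [LHS]mulrCA.
Qed.

(** The [w i] are the n-th roots of unity, read off from a factorisation of ['X^n - 1] in which ['X]
    is then replaced by [s^-1 *: 'X]. They are chosen before [s], so that two radii can share the
    same roots. *)
Lemma exprn_sub_factor (K : closedFieldType) (n : nat) : (0 < n)%N ->
  exists w : 'I_n -> K, forall s : K, s != 0 ->
    'X^n - (s ^+ n)%:P = \prod_i ('X - (w i * s)%:P).
Proof.
move=> n0; have [rs def_rs] := closed_field_poly_normal ('X^n - 1%:P : {poly K}).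
have sz : size ('X^n - 1%:P : {poly K}) = n.+1 by rewrite size_XnsubC.
rewrite (monicP (monicXnsubC _ n0)) scale1r in def_rs.
have szrs : size rs = n by apply/eqP; rewrite -eqSS -(size_prod_XsubC rs id) -def_rs sz.
exists (fun i => rs`_i) => s s0.
have -> : \prod_(i < n) ('X - (rs`_i * s)%:P) = \prod_(z <- rs) ('X - (z * s)%:P).
  by rewrite (big_nth 0) szrs big_mkord.
have := congr1 (fun p => (s ^+ n) *: (p \Po (s^-1 *: 'X))) def_rs.
rewrite rmorphB /= rmorphXn /= comp_polyX comp_polyC exprZn exprVn scalerBr scalerA mulfV ?expf_neq0//.
rewrite scale1r -mul_polyC mulr1 => ->.
rewrite rmorph_prod /= -{}szrs {def_rs n0 sz}; elim: rs => [|z rs IH].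
  by rewrite !big_nil expr0 scale1r.
rewrite !big_cons /= exprS -{}IH rmorphB /= comp_polyX comp_polyC.
rewrite -scalerA scalerAr scalerAl; congr (_ * _).
rewrite scalerBr scalerA mulfV// scale1r.
by rewrite -mul_polyC polyCM (mulrC s%:P).
Qed.

Let resolvent_difference (K : comNzRingType) (n : nat) (A X s t u : K) :
  (s - t) * (A * u) *+ n = A *+ n * (X - t) * u - A *+ n * (X - s) * u.
Proof. by rewrite !mulrnAl -mulrnBl; congr (_ *+ n); ring. Qed.

Let cross_difference (K : comNzRingType) (q q' X w s t u : K) :
  q * ((X - w * t) * q') * u - q' * ((X - w * s) * q) * u =
  w * (s - t) * (q * q' * u).
Proof. ring. Qed.

Let distribute_factors (K : comNzRingType) (a b q q' u : K) :
  b * (a * (q * q' * u)) = (a * q) * (b * q') * u.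
Proof. ring. Qed.

Context {R : realType} (N : {poly R[i]} -> R).
Hypothesis N_add : forall p q, N (p + q) <= N p + N q.
Hypothesis N_scale : forall c p, N (c *: p) = nm c * N p.

Let N_opp p : N (- p) = N p.
Proof. by rewrite -scaleN1r N_scale nmN Normc.normc1 mul1r. Qed.

Let N_ge0 p : 0 <= N p.
Proof.
have := N_add p (- p); rewrite subrr N_opp -[X in N X <= _](scale0r 0) N_scale.
by rewrite Normc.normc0 mul0r -mulr2n pmulrn_lge0.
Qed.

Let N_sum (I : finType) (F : I -> {poly R[i]}) :
  N (\sum_i F i) <= \sum_i N (F i).
Proof.
elim/big_rec2: _ => [|i y x _ h].
  by rewrite -[X in N X](scale0r 0) N_scale Normc.normc0 mul0r.
by rewrite (le_trans (N_add _ _))// lerD2l.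
Qed.

(* With w_j the n-th roots of unity, Q_j = ('X^n - s^n) / ('X - w_j s) and Q'_j
   the same for s', one has n 'X^(n-1) (s^n - s'^n) = sum_j w_j (s - s') Q_j Q'_j;
   this controls the averaged resolvent without inverting 'X - z. *)
Lemma resolvent_average_lipschitz (e B s s' : R) (n : nat) (u : {poly R[i]}) :
  0 < e -> 0 < s <= B -> 0 < s' <= B -> (0 < n)%N ->
  (forall z p, nm z <= B -> e * N p <= N (('X - z%:P) * p)) ->
  `|s ^+ n - s' ^+ n| * N ('X^(n.-1) * u) <=
  `|s - s'| / e ^+ 2 * N (('X^n - ((s%:C)%C ^+ n)%:P) * ('X^n - ((s'%:C)%C ^+ n)%:P) * u).
Proof.
move=> e0 /andP[s0 sB] /andP[s'0 s'B] n0 low.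
have [w hw] := @exprn_sub_factor R[i] n n0.
have neC (r : R) : 0 < r -> (r%:C)%C != 0 :> R[i].
  by move=> r0; rewrite (eqr_nat _ _ _) || (apply/eqP => -[/eqP]; rewrite gt_eqF).
pose F (r : R) i : {poly R[i]} := 'X - (w i * (r%:C)%C)%:P.
pose Q r i : {poly R[i]} := \prod_(j | j != i) F r j.
have [P defP] : exists P : R -> {poly R[i]},
  forall r, P r = 'X^n - ((r%:C)%C ^+ n)%:P by eexists.
have -> : N (('X^n - ((s%:C)%C ^+ n)%:P) * ('X^n - ((s'%:C)%C ^+ n)%:P) * u) =
  N (P s * P s' * u) by rewrite !defP.
have FQ r : 0 < r -> forall i, F r i * Q r i = P r.
  by move=> r0 i; rewrite defP hw ?neC// [RHS](bigD1 i).
have dX r : 0 < r -> 'X^(n.-1) *+ n = \sum_i Q r i.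
  move=> r0; have := congr1 deriv (hw _ (neC _ r0)).
  rewrite derivB derivC subr0 derivXn => ->.
  rewrite deriv_prod_seq ?index_enum_uniq//.
  by apply: eq_bigr => i _; rewrite derivXsubC mul1r.
(* At radius 1 the factorisation evaluated at [w i] shows that [w i] is a root of unity. *)
have w1 i : nm (w i) = 1.
  have /(congr1 (horner^~ (w i))) := FQ 1 ltr01 i; rewrite defP.
  rewrite !hornerE ?hornerXn subrr mul0r => /esym/eqP; rewrite subr_eq0.
  move=> /eqP/(congr1 nm); rewrite !nmX nm_real normr1 expr1n => /eqP.
  by rewrite pexpr_eq1 ?nm_ge0// -?lt0n// => /eqP.
have key : ((s%:C)%C ^+ n - (s'%:C)%C ^+ n) *: ('X^(n.-1) * u) *+ n =
    \sum_i (w i * (s - s')%:C%C) *: (Q s i * Q s' i * u).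
  transitivity ('X^(n.-1) *+ n * P s' * u - 'X^(n.-1) *+ n * P s * u).
    by rewrite !defP -mul_polyC polyCB (resolvent_difference _ _ 'X^n).
  (* The derivative of ['X^n] is expanded with the factors of [s] in the first term and with those
     of [s'] in the second. Each pair of summands then differs only by a linear factor, and ['X]
     cancels in their difference. *)
  rewrite {1}(dX _ s0) (dX _ s'0) !mulr_suml -sumrB; apply: eq_bigr => i _.
  rewrite -(FQ _ s0 i) -(FQ _ s'0 i) /F -mul_polyC rmorphB /=.
  by rewrite !polyCM polyCB cross_difference.
have : N (((s%:C)%C ^+ n - (s'%:C)%C ^+ n) *: ('X^(n.-1) * u) *+ n) =
    (`|s ^+ n - s' ^+ n| * N ('X^(n.-1) * u)) * n%:R.
  rewrite -scaler_nat !N_scale -!rmorphXn -rmorphB nm_real /= mulrC; congr (_ * _).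
  by rewrite -(rmorph_nat (real_complex R)) nm_real ger0_norm.
rewrite {}key => key.
have n0' : 0 < n%:R :> R by rewrite ltr0n.
rewrite -(ler_pM2r n0') -key (le_trans (N_sum _))// {key}.
rewrite [leRHS]mulr_natr -[X in _ *+ X]card_ord -sumr_const ler_sum// => i _.
rewrite N_scale nmM w1 mul1r nm_real -[leRHS]mulrA ler_wpM2l//.
rewrite ler_pdivlMl ?exprn_gt0// expr2 -[leLHS]mulrA.
have wB r : 0 < r <= B -> nm (w i * r%:C%C) <= B.
  by move=> /andP[r0 rB]; rewrite nmM w1 mul1r nm_real gtr0_norm.
have l1 := low (w i * s%:C%C) (Q s i * Q s' i * u) (wB _ _).
rewrite (le_trans (ler_wpM2l (ltW e0) (l1 _)))//; first by rewrite s0.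
rewrite (le_trans (low (w i * s'%:C%C) _ (wB _ _)))//; first by rewrite s'0.
rewrite -(FQ _ s0 i) -(FQ _ s'0 i) -/(F s i) -/(F s' i).
rewrite le_eqVlt; apply/orP; left; apply/eqP; congr N.
exact: distribute_factors.
Qed.


Let bernoulli_ge (x : R) k : 0 <= x -> 1 + k%:R * x <= (1 + x) ^+ k.
Proof.
move=> x0; elim: k => [|k IH]; first by rewrite mul0r addr0 expr0.
rewrite exprS (le_trans _ (ler_wpM2l _ IH)) ?addr_ge0// -natr1.
have := mulr_ge0 (ler0n R k) (mulr_ge0 x0 x0); lra.
Qed.

Let ring4 (K : comNzRingType) (X s t u : K) :
  (X - s) * (X - t) * u = X * (X * u) - (s + t) * (X * u) + (s * t) * u.
Proof. ring. Qed.

(** By contradiction, as a substitute for non-emptiness of the spectrum. If all ['X - z%:P] with |z|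
    <= M + 1 are bounded below by [e], then [resolvent_average_lipschitz] forces acceleration: when
    ['X^n] multiplies the seminorm of [u] by at least s^n, it multiplies that of ['X^n * u] by at
    least (s + q)^n. Iterating drives the rate s beyond the bound M. *)
Lemma approximate_eigenvalue (M e : R) :
  (forall p, N ('X * p) <= M * N p) -> 0 < N 1 -> 0 < e ->
  exists z p, [/\ nm z <= M + 1, 0 < N p & N (('X - z%:P) * p) <= e * N p].
Proof.
move=> NX N1 e0; apply: contrapT => no.
pose B := M + 1.
have low z p : nm z <= B -> e * N p <= N (('X - z%:P) * p).
  move=> zB; have := N_ge0 p; rewrite le_eqVlt => /predU1P[<-|Np].
    by rewrite mulr0.
  by rewrite leNgt; apply/negP => lt; apply: no; exists z, p; split => //; exact: ltW.
have M0 : 0 <= M by have := le_trans (N_ge0 _) (NX 1); rewrite pmulr_lge0.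
have lowX p : e * N p <= N ('X * p).
  have := low 0 p; rewrite polyC0 subr0 Normc.normc0; apply.
  by rewrite /B; lra.
have eM : e <= M by have := le_trans (lowX 1) (NX 1); rewrite ler_pM2r.
have M_gt0 : 0 < M by exact: lt_le_trans eM.
have Nn n p : e ^+ n * N p <= N ('X^n * p) <= M ^+ n * N p.
  elim: n => [|n /andP[IH1 IH2]]; first by rewrite !expr0 !mul1r !lexx.
  rewrite !exprS -!mulrA; apply/andP; split.
    by rewrite (le_trans _ (lowX _))// ler_wpM2l// ltW.
  by rewrite (le_trans (NX _))// ler_wpM2l.
(* [q] makes [q / e ^+ 2 * M] at most 1/16, which absorbs the factor 4 of [vle] and leaves 1/4
   against 1/2. The exponent [n] below satisfies n q >= B, so by Bernoulli's inequality raising the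
   rate by [q] at least doubles its n-th power. *)
pose q : R := Num.min 1 (e ^+ 2 / (16 * M)).
have q0 : 0 < q by rewrite /q lt_min ltr01/= divr_gt0 ?exprn_gt0// mulr_gt0.
have q1 : q <= 1 by rewrite /q ge_min lexx.
have qe : q / e ^+ 2 * M <= 1 / 16.
  rewrite mulrAC ler_pdivrMr ?exprn_gt0// -ler_pdivlMr//.
  rewrite /q ge_min; apply/orP; right.
  have -> // : e ^+ 2 / (16 * M) = 1 / 16 * e ^+ 2 / M by field; rewrite gt_eqF.
pose n := (Num.truncn (B / q)).+1.
have nq : B <= n%:R * q by rewrite -ler_pdivrMr// ltW// truncnS_gt.
have B0 : 0 < B by rewrite /B; lra.
have grow s : 0 < s <= B -> 2 * s ^+ n <= (s + q) ^+ n.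
  move=> /andP[s0 sB]; have -> : s + q = s * (1 + q / s) by rewrite mulrDr mulr1 mulrCA divff ?mulr1// gt_eqF.
  rewrite exprMn mulrC ler_pM2l ?exprn_gt0//.
  have qs : 0 <= q / s by rewrite divr_ge0// ltW.
  apply: le_trans (bernoulli_ge _ qs).
  have : 1 <= n%:R * (q / s) by rewrite mulrA ler_pdivlMr// mul1r (le_trans sB).
  lra.
have step s u : 0 < s -> s + q <= B -> 0 < N u ->
    s ^+ n * N u <= N ('X^n * u) ->
    (s + q) ^+ n * N ('X^n * u) <= N ('X^n * ('X^n * u)).
  move=> s0 sqB Nu h1; rewrite leNgt; apply/negP => h2.
  set s' := s + q in h2 sqB *.
  have s'0 : 0 < s' by rewrite /s'; lra.
  have := @resolvent_average_lipschitz e B s s' n u e0.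
  rewrite s0 s'0 sqB (_ : s <= B) /=; last by rewrite /s' in sqB; lra.
  move=> /(_ isT isT isT low).
  set A := N ('X^(n.-1) * u).
  have A0 : 0 < A by rewrite (lt_le_trans _ (proj1 (andP (Nn _ _))))// mulr_gt0// exprn_gt0.
  have nA : N ('X^n * u) <= M * A by rewrite exprS -mulrA NX.
  have gr := grow s; rewrite -/s' s0 (_ : s <= B) /= in gr; last by rewrite /s' in sqB; lra.
  have {}gr := gr isT.
  have sn0 : 0 < s ^+ n by exact: exprn_gt0.
  have s'n0 : 0 < s' ^+ n by exact: exprn_gt0.
  have -> : `|s - s'| = q by rewrite /s' opprD addNKr normrN gtr0_norm.
  rewrite ler0_norm; last by lra.
  set v := N _ => h3.
  have vle : v <= 4 * s' ^+ n * (M * A).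
    have -> : v = N ('X^n * ('X^n * u) - (s ^+ n + s' ^+ n)%:C%C *: ('X^n * u) +
                    (s ^+ n * s' ^+ n)%:C%C *: u).
      have eD : (s ^+ n + s' ^+ n)%:C%C = (s%:C ^+ n + s'%:C ^+ n)%C :> R[i].
        by rewrite rmorphD !rmorphXn.
      have eM' : (s ^+ n * s' ^+ n)%:C%C = (s%:C ^+ n * s'%:C ^+ n)%C :> R[i].
        by rewrite rmorphM !rmorphXn.
      by rewrite /v eD eM' ring4 -!mul_polyC polyCD polyCM.
    rewrite (le_trans (N_add _ _))// N_scale nm_real.
    have t1 := N_add ('X^n * ('X^n * u)) (- ((s ^+ n + s' ^+ n)%:C%C *: ('X^n * u))).
    rewrite N_opp N_scale nm_real ger0_norm in t1; last by rewrite addr_ge0// ltW.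
    rewrite ger0_norm; last by rewrite mulr_ge0// ltW.
    have t2 : s' ^+ n * (s ^+ n * N u) <= s' ^+ n * N ('X^n * u) by rewrite ler_wpM2l// ltW.
    have t3 : s ^+ n * N ('X^n * u) <= s' ^+ n * N ('X^n * u).
      by rewrite ler_wpM2r//; lra.
    have t4 : s' ^+ n * N ('X^n * u) <= s' ^+ n * (M * A) by rewrite ler_wpM2l// ltW.
    lra.
  have q2 : 0 <= q / e ^+ 2 by rewrite divr_ge0 ?exprn_ge0// ltW.
  have h4 : q / e ^+ 2 * v <= 1 / 4 * (s' ^+ n * A).
    rewrite (le_trans (ler_wpM2l q2 vle))//.
    have := ler_wpM2r (ltW (mulr_gt0 s'n0 A0)) qe; lra.
  have h5 : 2 * s ^+ n * A <= s' ^+ n * A by rewrite ler_wpM2r// ltW.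
  have := mulr_gt0 s'n0 A0; lra.
have NXn k : 0 < N 'X^k.
  have /andP[+ _] := Nn k 1; rewrite mulr1; apply: lt_le_trans.
  by rewrite mulr_gt0// exprn_gt0.
have npos : (0 < n)%N by [].
(* The rate starts at [e], the lower bound for z = 0, and gains [q] per step; the bound [M ^+ n] on
   multiplication by ['X^n] keeps it below M, which fails for large j. *)
have claim j : e + j%:R * q <= M /\
    (e + j%:R * q) ^+ n * N 'X^(n * j) <= N ('X^n * 'X^(n * j)).
  elim: j => [|j [IH1 IH2]].
    by rewrite mul0r addr0 muln0; split => //; case/andP: (Nn n 1).
  have s0 : 0 < e + j%:R * q by rewrite ltr_wpDr// mulr_ge0// ltW.
  have sq : e + j.+1%:R * q = e + j%:R * q + q by rewrite -natr1 mulrDl mul1r addrA.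
  have : (e + j.+1%:R * q) ^+ n * N 'X^(n * j.+1) <= N ('X^n * 'X^(n * j.+1)).
    rewrite mulnS exprD sq; apply: step => //; rewrite /B; lra.
  move=> h; split => //.
  have s'0 : 0 <= e + j.+1%:R * q by rewrite addr_ge0 ?mulr_ge0// ltW.
  rewrite -(ler_pXn2r npos) ?nnegrE// -(ler_pM2r (NXn (n * j.+1)%N)).
  by rewrite (le_trans h)//; case/andP: (Nn n 'X^(n * j.+1)).
have [] := claim (Num.truncn (M / q)).+1.
rewrite leNgt => /negP[]; rewrite ltr_wpDl ?ltW// -ltr_pdivrMr//.
exact: truncnS_gt.
Qed.


End ApproximateEigenvalue.

(** * Complex derivatives *)

Section RealPrimitive.
Context {R : realType}.
Implicit Types f g P : R -> R.

Lemma is_derive_eps (f : R -> R) (t l : R) :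
  (forall e : R, 0 < e -> exists2 d : R, 0 < d &
     forall h, `|h| < d -> `|f (t + h) - f t - l * h| <= e * `|h|) ->
  is_derive t 1 f l.
Proof.
move=> H.
have cv : (fun h => h^-1 *: ((f \o shift t) (h *: (1 : R)) - f t)) @ 0^' --> l.
  apply/cvgrPdist_le => e e0; have [d d0 Hd] := H e e0.
  near=> h; have h0 : h != 0 by near: h; exact: nbhs_dnbhs_neq.
  have hd : `|h| < d by near: h; apply: dnbhs0_lt.
  have {}Hd := Hd h hd; rewrite /= /shift /= scaler1 (addrC h).
  rewrite -(ler_pM2r (_ : 0 < `|h|)) ?normr_gt0// -normrM mulrBl.
  rewrite -[_^-1 *: _]/(_^-1 * _) mulrAC mulVf// mul1r distrC.
  by rewrite (le_trans _ Hd).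
by apply: DeriveDef; [apply/cvg_ex; exists l|exact/cvg_lim].
Unshelve. all: end_near. Qed.

Lemma derive_eps (f : R -> R) (t l : R) : is_derive t 1 f l ->
  forall e : R, 0 < e -> exists2 d : R, 0 < d &
     forall h, `|h| < d -> `|f (t + h) - f t - l * h| <= e * `|h|.
Proof.
move=> [] /= df dl e e0.
have cv : (fun h => h^-1 *: ((f \o shift t) (h *: (1 : R)) - f t)) @ 0^' --> l.
  by rewrite -dl; exact: df.
move/cvgrPdist_le : cv => /(_ e e0) [d /= d0 Hd]; exists d => // h hd.
have [->|h0] := eqVneq h 0; first by rewrite addr0 subrr mulr0 subr0 !normr0 mulr0.
have := Hd h; rewrite /ball_/= sub0r normrN => /(_ hd h0).
rewrite /= /shift /= scaler1 (addrC h) => {}Hd.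
rewrite -(ler_pM2r (_ : 0 < `|h|)) ?normr_gt0// -normrM mulrBl in Hd.
rewrite -[_^-1 *: _]/(_^-1 * _) mulrAC mulVf// mul1r distrC in Hd.
by rewrite (le_trans _ Hd).
Qed.

Lemma derive0_itv (f : R -> R) (a b : R) :
  (forall x, a < x < b -> is_derive x 1 f 0) ->
  forall x y, a < x < b -> a < y < b -> f x = f y.
Proof.
move=> H; suff le x y : a < x < b -> a < y < b -> x <= y -> f x = f y.
  move=> x y hx hy; have [/le ->//|/ltW/le ->//] := leP x y.
move=> /andP[ax xb] /andP[ay yb] xy.
have dH z : z \in `[x, y] -> is_derive z 1 f 0.
  by rewrite in_itv/= => /andP[xz zy]; apply: H; rewrite (lt_le_trans ax xz) (le_lt_trans zy yb).
have dM z : z \in `]x, y[ -> is_derive z 1 f ((fun=> 0) z).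
  by move=> hz; apply: dH; exact: subset_itv_oo_cc.
have cM : {within `[x, y], continuous f}.
  by apply: derivable_within_continuous => z hz; have [] := dH z hz.
have [c _] := MVT_segment xy dM cM.
by rewrite mul0r => /eqP; rewrite subr_eq0 => /eqP.
Qed.

(** An integral from a fixed base point is differentiated only to the right of that point.
    Primitives on growing intervals are therefore normalised at 0 and glued; by [derive0_itv] they
    agree where both are defined. *)
Lemma exists_primitive (f : R -> R) : continuous f ->
  exists P : R -> R, P 0 = 0 /\ forall x : R, is_derive x 1 P (f x).
Proof.
move=> cf.
have loc (n : nat) : exists P : R -> R, forall x : R, `|x| < n.+1%:R -> is_derive x 1 P (f x).
  exists (fun x => \int[lebesgue_measure]_(t in `[- n.+1%:R, x]) f t) => x.
  rewrite ltr_norml => /andP[nx xn].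
  have ic : lebesgue_measure.-integrable `[- n.+1%:R, n.+1%:R] (EFin \o f).
    apply: continuous_compact_integrable; first exact: segment_compact.
    exact: continuous_subspaceT.
  have [d1 d2] := @continuous_FTC1_closed R f (- n.+1%:R) x n.+1%:R xn ic nx (cf x).
  apply: DeriveDef; first exact: d1.
  by rewrite -derive1E; exact: d2.
have [Q HQ] := choice loc.
pose P x := let n := Num.truncn `|x| in Q n x - Q n 0.
have PE (n : nat) x : `|x| < n.+1%:R -> P x = Q n x - Q n 0.
  move=> xn; rewrite /P; set m := Num.truncn _.
  have mn : (m <= n)%N by rewrite -ltnS -(ltr_nat R) (le_lt_trans _ xn)// truncn_le.
  have xm : `|x| < m.+1%:R by exact: truncnS_gt.
  have D (z : R) : - m.+1%:R < z < m.+1%:R -> is_derive z 1 (Q m - Q n) 0.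
    move=> hz; rewrite -(subrr (f z)); apply: is_deriveB; apply: HQ.
      by rewrite ltr_norml.
    by rewrite ltr_norml; move: hz; have := mn; rewrite -ltnS -(ler_nat R); lra.
  have h : Q m x - Q n x = Q m 0 - Q n 0.
    apply: (derive0_itv D); first by rewrite -ltr_norml.
    by rewrite ltr0n ltrNl oppr0 ltr0n.
  lra.
exists P; split; first by rewrite /P subrr.
move=> x; pose n := (Num.truncn `|x|).+1.
have xn : `|x| < n%:R by exact: truncnS_gt.
have xn1 : `|x| < n.+1%:R by rewrite (lt_trans xn)// ltr_nat.
apply: is_derive_eps => e e0; have [d d0 Hd] := derive_eps (HQ n x xn1) e0.
exists (Num.min d 1); first by rewrite lt_min d0 ltr01.
move=> h; rewrite lt_min => /andP[hd h1].
rewrite (PE n x)// (PE n (x + h)).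
  have -> : Q n (x + h) - Q n 0 - (Q n x - Q n 0) = Q n (x + h) - Q n x by lra.
  exact: Hd.
by rewrite (le_lt_trans (ler_normD _ _))// -natr1 ltrD.
Qed.

End RealPrimitive.

(** * Complex derivatives in epsilon-delta form *)

Section ComplexBasics.
Context {R : realType}.
Local Notation C := (R[i]).
Implicit Types (F G : C -> C) (z w l : C) (f : R -> C).

Lemma Re_le_nm z : `|Re z| <= nm z.
Proof.
case: z => a b /=; rewrite -sqrtr_sqr ler_wsqrtr// lerDl; exact: sqr_ge0.
Qed.

Lemma Im_le_nm z : `|Im z| <= nm z.
Proof.
case: z => a b /=; rewrite -sqrtr_sqr ler_wsqrtr// lerDr; exact: sqr_ge0.
Qed.

Lemma nm_le_ReIm z : nm z <= `|Re z| + `|Im z|.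
Proof.
case: z => a b /=; rewrite -(ger0_norm (addr_ge0 (normr_ge0 a) (normr_ge0 b))).
rewrite -sqrtr_sqr ler_wsqrtr// sqrrD !real_normK ?num_real// lerD2r lerDl.
by rewrite mulrn_wge0// mulr_ge0.
Qed.

Lemma ReD z w : Re (z + w) = Re z + Re w. Proof. by case: z w => [? ?] []. Qed.
Lemma ImD z w : Im (z + w) = Im z + Im w. Proof. by case: z w => [? ?] []. Qed.
Lemma ReN z : Re (- z) = - Re z. Proof. by case: z. Qed.
Lemma ImN z : Im (- z) = - Im z. Proof. by case: z. Qed.
Lemma ReM z w : Re (z * w) = Re z * Re w - Im z * Im w.
Proof. by case: z w => [? ?] []. Qed.
Lemma ImM z w : Im (z * w) = Re z * Im w + Im z * Re w.
Proof. by case: z w => [? ?] []. Qed.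
Lemma eq_ReIm z w : Re z = Re w -> Im z = Im w -> z = w.
Proof. by case: z w => [? ?] [? ?] /= -> ->. Qed.
Lemma nm_sqr z : nm z ^+ 2 = Re z ^+ 2 + Im z ^+ 2.
Proof. by case: z => a b /=; rewrite sqr_sqrtr// addr_ge0// sqr_ge0. Qed.

(** Stated with the real-valued modulus so that all estimates stay in [R]; [derivable_cderiv] and
    [cderiv_derivable] connect it with the derivative on R[i] used in [entire2]. *)
Definition cderiv F z l := forall e : R, 0 < e -> exists2 d : R, 0 < d &
  forall h, nm h < d -> nm (F (z + h) - F z - l * h) <= e * nm h.

Definition ccont_at F z := forall e : R, 0 < e -> exists2 d : R, 0 < d &
  forall h, nm h < d -> nm (F (z + h) - F z) <= e.

Definition entire F := forall z, exists l, cderiv F z l.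

Lemma cderiv_cont F z l : cderiv F z l -> ccont_at F z.
Proof.
move=> dF e e0; have [d d0 Hd] := dF 1 ltr01.
have l1 : 0 < nm l + 1 by rewrite ltr_wpDl// nm_ge0.
exists (Num.min d (e / (nm l + 1))); first by rewrite lt_min d0 divr_gt0.
move=> h; rewrite lt_min ltr_pdivlMr// => /andP[/Hd hd he].
rewrite (_ : F (z + h) - F z = F (z + h) - F z - l * h + l * h); last by rewrite subrK.
rewrite (le_trans (nmD _ _))// nmM (le_trans _ (ltW he))// mulrDr mulr1.
by rewrite mul1r in hd; rewrite addrC mulrC lerD2l.
Qed.

Lemma entire_cont F : entire F -> forall z, ccont_at F z.
Proof. by move=> eF z; have [l /cderiv_cont] := eF z. Qed.

Lemma cderiv_eq F G z l m : (forall w, F w = G w) -> l = m ->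
  cderiv F z l -> cderiv G z m.
Proof. by move=> FG <- dF e /dF[d d0 Hd]; exists d => // h /Hd; rewrite !FG. Qed.

Lemma cderiv_affine a b z : cderiv (fun w => a + b * w) z b.
Proof.
move=> e e0; exists 1 => // h _.
rewrite (_ : _ - _ - _ = 0) ?Normc.normc0 ?mulr_ge0 ?nm_ge0 ?ltW//.
by rewrite mulrDr; ring.
Qed.

Lemma cderiv_cst a z : cderiv (fun=> a) z 0.
Proof.
by apply: cderiv_eq (cderiv_affine a 0 z) => // w; rewrite mul0r addr0.
Qed.

Lemma cderiv_id z : cderiv id z 1.
Proof.
by apply: cderiv_eq (cderiv_affine 0 1 z) => // w; rewrite mul1r add0r.
Qed.

Lemma cderivD F G z l m : cderiv F z l -> cderiv G z m ->
  cderiv (fun w => F w + G w) z (l + m).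
Proof.
move=> dF dG e e0; have e2 : 0 < e / 2 by rewrite divr_gt0.
have [d d0 Hd] := dF _ e2; have [d' d'0 Hd'] := dG _ e2.
exists (Num.min d d'); first by rewrite lt_min d0.
move=> h; rewrite lt_min => /andP[/Hd h1 /Hd' h2].
rewrite (_ : _ - _ - _ = (F (z + h) - F z - l * h) + (G (z + h) - G z - m * h)); last ring.
by rewrite (le_trans (nmD _ _))// (le_trans (lerD h1 h2))// -mulrDl -splitr.
Qed.

Lemma cderivM F G z l m : cderiv F z l -> cderiv G z m ->
  cderiv (fun w => F w * G w) z (l * G z + F z * m).
Proof.
move=> dF dG e e0.
pose K := 1 + nm (F z) + nm (G z) + nm l.
have K1 : 1 <= K by rewrite /K; have := nm_ge0 (F z); have := nm_ge0 (G z); have := nm_ge0 l; lra.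
have K0 : 0 < K by lra.
pose e' := Num.min 1 (e / (3 * K)).
have e'0 : 0 < e' by rewrite lt_min ltr01 divr_gt0// mulr_gt0.
have e'1 : e' <= 1 by rewrite ge_min lexx.
have e'e : 3 * (e' * K) <= e.
  rewrite mulrCA -ler_pdivlMr ?mulr_gt0//; by rewrite ge_min lexx orbT.
have [d d0 Hd] := dF _ e'0; have [d' d'0 Hd'] := dG _ e'0.
have [d'' d''0 Hd''] := cderiv_cont dG e'0.
exists (Num.min d (Num.min d' d'')); first by rewrite !lt_min d0 d'0.
move=> h; rewrite !lt_min => /and3P[/Hd h1 /Hd' h2 /Hd'' h3].
rewrite (_ : _ - _ - _ = (F (z + h) - F z - l * h) * G (z + h) +
   (F z * (G (z + h) - G z - m * h) + l * h * (G (z + h) - G z))); last ring.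
have G1 : nm (G (z + h)) <= K.
  rewrite -(subrK (G z) (G (z + h))) (le_trans (nmD _ _))// /K.
  have := nm_ge0 (F z); have := nm_ge0 l; lra.
have p1 : nm ((F (z + h) - F z - l * h) * G (z + h)) <= e' * nm h * K.
  by rewrite nmM ler_pM ?nm_ge0.
have p2 : nm (F z * (G (z + h) - G z - m * h)) <= K * (e' * nm h).
  rewrite nmM ler_pM ?nm_ge0// /K; have := nm_ge0 (G z); have := nm_ge0 l; lra.
have p3 : nm (l * h * (G (z + h) - G z)) <= K * nm h * e'.
  rewrite !nmM ler_pM ?mulr_ge0 ?nm_ge0// ler_wpM2r ?nm_ge0// /K.
  have := nm_ge0 (G z); have := nm_ge0 (F z); lra.
have := ler_wpM2r (nm_ge0 h) e'e.
have := nmD ((F (z + h) - F z - l * h) * G (z + h)) (F z * (G (z + h) - G z - m * h) + l * h * (G (z + h) - G z)).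
have := nmD (F z * (G (z + h) - G z - m * h)) (l * h * (G (z + h) - G z)).
lra.
Qed.

Lemma cderiv_comp F G z l m : cderiv G z m -> cderiv F (G z) l ->
  cderiv (fun w => F (G w)) z (l * m).
Proof.
move=> dG dF e e0.
pose K := 1 + nm m + nm l.
have K1 : 1 <= K by rewrite /K; have := nm_ge0 m; have := nm_ge0 l; lra.
have K0 : 0 < K by lra.
pose e' := Num.min 1 (e / (2 * K)).
have e'0 : 0 < e' by rewrite lt_min ltr01 divr_gt0// mulr_gt0.
have e'1 : e' <= 1 by rewrite ge_min lexx.
have e'e : 2 * (e' * K) <= e.
  rewrite mulrCA -ler_pdivlMr ?mulr_gt0//; by rewrite ge_min lexx orbT.
have [d d0 Hd] := dF _ e'0; have [d' d'0 Hd'] := dG _ e'0.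
exists (Num.min d' (d / K)); first by rewrite lt_min d'0 divr_gt0.
move=> h; rewrite lt_min ltr_pdivlMr// => /andP[/Hd' h2 hK].
set k := G (z + h) - G z.
have kh : nm k <= K * nm h.
  rewrite (_ : k = (k - m * h) + m * h); last ring.
  rewrite (le_trans (nmD _ _))// nmM /K; move: h2; rewrite -/k.
  have := ler_wpM2r (nm_ge0 h) e'1; have := mulr_ge0 (nm_ge0 l) (nm_ge0 h); lra.
have /Hd : nm k < d by rewrite (le_lt_trans kh)// mulrC.
rewrite (_ : G z + k = G (z + h)); last by rewrite /k; ring.
move=> h1.
rewrite (_ : _ - _ - _ = (F (G (z + h)) - F (G z) - l * k) + l * (k - m * h)); last ring.
rewrite (le_trans (nmD _ _))// nmM.
have p1 : e' * nm k <= e' * (K * nm h) by rewrite ler_wpM2l// ltW.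
have p2 : nm l * nm (k - m * h) <= K * (e' * nm h).
  rewrite ler_pM ?nm_ge0// /K; have := nm_ge0 m; lra.
have := ler_wpM2r (nm_ge0 h) e'e; lra.
Qed.


End ComplexBasics.

(** * Integrals of complex-valued functions of a real variable *)

Section ComplexPrimitive.
Context {R : realType}.
Local Notation C := (R[i]).
Implicit Types (F G : C -> C) (z w l : C) (f g Q : R -> C).

Definition rderiv f (t : R) l :=
  is_derive t 1 (fun s : R => Re (f s)) (Re l) /\
  is_derive t 1 (fun s : R => Im (f s)) (Im l).

Definition rcont f :=
  continuous (fun s : R => Re (f s)) /\ continuous (fun s : R => Im (f s)).

Lemma rderiv_eps f t l :
  (forall e : R, 0 < e -> exists2 d : R, 0 < d &
    forall h : R, `|h| < d -> nm (f (t + h) - f t - l * h%:C%C) <= e * `|h|) ->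
  rderiv f t l.
Proof.
move=> H; split; apply: is_derive_eps => e /H[d d0 Hd]; exists d => // h /Hd; apply: le_trans.
  rewrite (le_trans _ (Re_le_nm _))//.
  by rewrite !ReD !ReN ReM /= mulr0 subr0.
rewrite (le_trans _ (Im_le_nm _))//.
by rewrite !ImD !ImN ImM /= mulr0 add0r.
Qed.

Lemma derive_rderiv f t l : rderiv f t l ->
  forall e : R, 0 < e -> exists2 d : R, 0 < d &
    forall h : R, `|h| < d -> nm (f (t + h) - f t - l * h%:C%C) <= e * `|h|.
Proof.
move=> [H1 H2] e e0; have e2 : 0 < e / 2 by rewrite divr_gt0.
have [d d0 Hd] := derive_eps H1 e2; have [d' d'0 Hd'] := derive_eps H2 e2.
exists (Num.min d d'); first by rewrite lt_min d0.
move=> h; rewrite lt_min => /andP[/Hd h1 /Hd' h2].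
rewrite (le_trans (nm_le_ReIm _))//.
rewrite !ReD !ReN ReM !ImD !ImN ImM /= !mulr0 subr0 add0r.
by rewrite (le_trans (lerD h1 h2))// -mulrDl -splitr.
Qed.

Lemma rderivD f g t l m : rderiv f t l -> rderiv g t m ->
  rderiv (fun s => f s + g s) t (l + m).
Proof.
move=> /derive_rderiv Hf /derive_rderiv Hg; apply: rderiv_eps => e e0.
have e2 : 0 < e / 2 by rewrite divr_gt0.
have [d d0 Hd] := Hf _ e2; have [d' d'0 Hd'] := Hg _ e2.
exists (Num.min d d'); first by rewrite lt_min d0.
move=> h; rewrite lt_min => /andP[/Hd h1 /Hd' h2].
rewrite (_ : _ - _ - _ = (f (t + h) - f t - l * h%:C%C) + (g (t + h) - g t - m * h%:C%C)); last ring.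
by rewrite (le_trans (nmD _ _))// (le_trans (lerD h1 h2))// -mulrDl -splitr.
Qed.

Lemma rderivZ a f t l : rderiv f t l -> rderiv (fun s => a * f s) t (a * l).
Proof.
move=> /derive_rderiv Hf; apply: rderiv_eps => e e0.
have a1 : 0 < nm a + 1 by rewrite ltr_wpDl// nm_ge0.
have [d d0 Hd] := Hf _ (divr_gt0 e0 a1).
exists d => // h /Hd; rewrite mulrAC ler_pdivlMr// mulrC => h1.
rewrite (_ : _ - _ - _ = a * (f (t + h) - f t - l * h%:C%C)); last ring.
by rewrite nmM (le_trans _ h1)// ler_wpM2r ?nm_ge0// lerDl.
Qed.

Lemma rderivN f t l : rderiv f t l -> rderiv (fun s => - f s) t (- l).
Proof.
move=> /(rderivZ (- 1)); rewrite mulN1r; congr (rderiv _ _ _).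
by apply/funext => s; rewrite mulN1r.
Qed.

Lemma rderivB f g t l m : rderiv f t l -> rderiv g t m ->
  rderiv (fun s => f s - g s) t (l - m).
Proof. by move=> hf hg; apply: rderivD => //; exact: rderivN. Qed.

Lemma rderiv_line F z v t l : cderiv F (z + t%:C%C * v) l ->
  rderiv (fun s => F (z + s%:C%C * v)) t (l * v).
Proof.
move=> dF; apply: rderiv_eps => e e0.
have v1 : 0 < nm v + 1 by rewrite ltr_wpDl// nm_ge0.
have [d d0 Hd] := dF _ (divr_gt0 e0 v1).
exists (d / (nm v + 1)); first by rewrite divr_gt0.
move=> h; rewrite ltr_pdivlMr// => hd.
have hv : nm (h%:C%C * v) <= `|h| * (nm v + 1).
  by rewrite nmM nm_real ler_wpM2l// lerDl.
have /Hd h1 := le_lt_trans hv hd.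
have -> : F (z + (t + h)%:C%C * v) - F (z + t%:C%C * v) - l * v * h%:C%C =
    F (z + t%:C%C * v + h%:C%C * v) - F (z + t%:C%C * v) - l * (h%:C%C * v).
  by rewrite rmorphD /= mulrDl addrA -!mulrA (mulrC v).
rewrite (le_trans h1)// (le_trans (ler_wpM2l (ltW (divr_gt0 e0 v1)) hv))//.
by rewrite mulrCA divfK ?gt_eqF// mulrC.
Qed.

Lemma rderiv0_cst f : (forall t, rderiv f t 0) -> forall a b, f a = f b.
Proof.
move=> H a b; apply: eq_ReIm.
  by apply: (@is_derive_0_is_cst R (fun s => Re (f s))) => t; case: (H t).
by apply: (@is_derive_0_is_cst R (fun s => Im (f s))) => t; case: (H t).
Qed.

(** The factor 2 comes from applying the mean value theorem separately to the real and to the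
    imaginary part. *)
Lemma rderiv_bound f (df : R -> C) a b K : a <= b ->
  (forall t, rderiv f t (df t)) -> (forall t, a <= t <= b -> nm (df t) <= K) ->
  nm (f b - f a) <= 2 * (K * (b - a)).
Proof.
move=> ab H HK.
have bnd (u : C -> R) (hu : forall z, `|u z| <= nm z) :
    (forall t : R, is_derive t 1 (fun s : R => u (f s)) (u (df t))) ->
    `|u (f b) - u (f a)| <= K * (b - a).
  move=> Hu.
  have cu : {within `[a, b], continuous (fun s => u (f s))}.
    by apply: derivable_within_continuous => s _; have [] := Hu s.
  have [c cab ->] := MVT_segment ab (fun (s : R) _ => Hu s) cu.
  rewrite normrM (@ger0_norm _ (b - a)) ?subr_ge0//.
  by rewrite ler_wpM2r ?subr_ge0// (le_trans (hu _))// HK// -in_itv.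
rewrite (le_trans (nm_le_ReIm _))// ReD ReN ImD ImN mulrDl mul1r lerD//.
  by apply: bnd; [exact: Re_le_nm|move=> t; case: (H t)].
by apply: bnd; [exact: Im_le_nm|move=> t; case: (H t)].
Qed.

Lemma rcont_line F z v : (forall w, ccont_at F w) ->
  rcont (fun s => F (z + s%:C%C * v)).
Proof.
move=> cF; have v1 : 0 < nm v + 1 by rewrite ltr_wpDl// nm_ge0.
split=> t; apply/cvgrPdist_le => e e0; have [d d0 Hd] := cF (z + t%:C%C * v) e e0;
  near=> s; rewrite distrC.
  rewrite -ReN -ReD (le_trans (Re_le_nm _))//.
  have -> : z + s%:C%C * v = z + t%:C%C * v + (s - t)%:C%C * v.
    by rewrite rmorphB /=; ring.
  apply: Hd; rewrite nmM nm_real (@le_lt_trans _ _ (`|s - t| * (nm v + 1)))//.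
    by rewrite ler_wpM2l// lerDl.
  rewrite -ltr_pdivlMr// distrC; near: s; apply/nbhs_ballP.
  by exists (d / (nm v + 1)) => //=; rewrite divr_gt0.
rewrite -ImN -ImD (le_trans (Im_le_nm _))//.
have -> : z + s%:C%C * v = z + t%:C%C * v + (s - t)%:C%C * v.
  by rewrite rmorphB /=; ring.
apply: Hd; rewrite nmM nm_real (@le_lt_trans _ _ (`|s - t| * (nm v + 1)))//.
  by rewrite ler_wpM2l// lerDl.
rewrite -ltr_pdivlMr// distrC; near: s; apply/nbhs_ballP.
by exists (d / (nm v + 1)) => //=; rewrite divr_gt0.
Unshelve. all: end_near. Qed.

Lemma exists_cprimitive f : rcont f -> exists Q, forall t, rderiv Q t (f t).
Proof.
move=> [/exists_primitive[P [_ HP]] /exists_primitive[Q [_ HQ]]].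
by exists (fun t => (P t +i* Q t)%C) => t; split; [exact: HP|exact: HQ].
Qed.

(* Junk value [0] when [f] has no primitive. *)
Definition cint f (a b : R) : C :=
  let Q := xget (fun=> 0) [set Q | forall t, rderiv Q t (f t)] in Q b - Q a.

Lemma cintE f Q a b : (forall t, rderiv Q t (f t)) -> cint f a b = Q b - Q a.
Proof.
move=> HQ; rewrite /cint; case: xgetP => [P _ HP|/(_ Q)//].
suff : P b - Q b = P a - Q a.
  by move=> h; rewrite -[P b](subrK (Q b)) h; ring.
apply: (@rderiv0_cst (fun t => P t - Q t)) => t.
by rewrite -(subrr (f t)); apply: rderivB.
Qed.

Lemma cint_split f a b c : cint f a c = cint f a b + cint f b c.
Proof. by rewrite /cint; ring. Qed.

Lemma cintD f g a b : rcont f -> rcont g ->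
  cint (fun t => f t + g t) a b = cint f a b + cint g a b.
Proof.
move=> /exists_cprimitive[P HP] /exists_cprimitive[Q HQ].
rewrite (cintE _ _ HP) (cintE _ _ HQ) (@cintE _ (fun t => P t + Q t)); first by ring.
by move=> t; exact: rderivD.
Qed.

Lemma cintZ x f a b : rcont f -> cint (fun t => x * f t) a b = x * cint f a b.
Proof.
move=> /exists_cprimitive[P HP].
rewrite (cintE _ _ HP) (@cintE _ (fun t => x * P t)); first by ring.
by move=> t; exact: rderivZ.
Qed.

Lemma nm_cint_le f a b K : a <= b -> rcont f ->
  (forall t, a <= t <= b -> nm (f t) <= K) -> nm (cint f a b) <= 2 * (K * (b - a)).
Proof.
move=> ab /exists_cprimitive[P HP] HK.
by rewrite (cintE _ _ HP); apply: rderiv_bound HK.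
Qed.

End ComplexPrimitive.

(** * Goursat's theorem and the maximum principle *)

Section Goursat.
Context {R : realType}.
Local Notation C := (R[i]).
Implicit Types (F G W : C -> C) (z w l : C).
Local Notation I := ((0 +i* 1)%C : C).

(** The contour integral along the boundary of the rectangle, counterclockwise, with the sides
    parametrised by their real or imaginary part. *)
Definition rect_int F (x1 x2 y1 y2 : R) : C :=
  cint (fun t => F (t +i* y1)%C) x1 x2 - cint (fun t => F (t +i* y2)%C) x1 x2 +
  I * (cint (fun t => F (x2 +i* t)%C) y1 y2 - cint (fun t => F (x1 +i* t)%C) y1 y2).

Lemma rect_int_split F x1 x2 x3 y1 y2 y3 :
  rect_int F x1 x3 y1 y3 =
  rect_int F x1 x2 y1 y2 + rect_int F x2 x3 y1 y2 +
  (rect_int F x1 x2 y2 y3 + rect_int F x2 x3 y2 y3).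
Proof.
rewrite /rect_int !(cint_split _ x1 x2 x3) !(cint_split _ y1 y2 y3); ring.
Qed.

Let hlineE F y : (fun t : R => F (t +i* y)%C) = (fun t => F ((0 +i* y)%C + t%:C%C * 1)).
Proof. by apply/funext => t; congr F; apply: eq_ReIm => /=; ring. Qed.

Let vlineE F x : (fun t : R => F (x +i* t)%C) = (fun t => F (x%:C%C + t%:C%C * I)).
Proof. by apply/funext => t; congr F; apply: eq_ReIm => /=; ring. Qed.

Lemma rcont_hline F y : (forall w, ccont_at F w) -> rcont (fun t : R => F (t +i* y)%C).
Proof. by move=> cF; rewrite hlineE; exact: rcont_line. Qed.

Lemma rcont_vline F x : (forall w, ccont_at F w) -> rcont (fun t : R => F (x +i* t)%C).
Proof. by move=> cF; rewrite vlineE; exact: rcont_line. Qed.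

Lemma rect_int_primitive F W x1 x2 y1 y2 : (forall z, cderiv W z (F z)) ->
  rect_int F x1 x2 y1 y2 = 0.
Proof.
move=> WF.
have H y : cint (fun t => F (t +i* y)%C) x1 x2 = W (x2 +i* y)%C - W (x1 +i* y)%C.
  apply: (@cintE _ _ (fun t => W (t +i* y)%C)) => t; rewrite hlineE.
  rewrite [F _](_ : _ = F ((0 +i* y)%C + t%:C%C * 1) * 1).
    by apply: rderiv_line; exact: WF.
  by rewrite mulr1; congr F; apply: eq_ReIm => /=; ring.
have V x : cint (fun t => F (x +i* t)%C) y1 y2 = - I * (W (x +i* y2)%C - W (x +i* y1)%C).
  rewrite mulrBr; apply: (@cintE _ _ (fun t => - I * W (x +i* t)%C)) => t.
  rewrite (_ : F _ = - I * (F (x%:C%C + t%:C%C * I) * I)).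
    by apply: rderivZ; rewrite vlineE; apply: rderiv_line; exact: WF.
  rewrite mulrCA mulNr (_ : I * I = -1); last by apply: eq_ReIm => /=; ring.
  by rewrite opprK mulr1; congr F; apply: eq_ReIm => /=; ring.
rewrite /rect_int !H !V -mulrBr mulrA (_ : I * - I = 1); first by ring.
by apply: eq_ReIm => /=; ring.
Qed.

Lemma rect_intD F G x1 x2 y1 y2 :
  (forall w, ccont_at F w) -> (forall w, ccont_at G w) ->
  rect_int (fun z => F z + G z) x1 x2 y1 y2 = rect_int F x1 x2 y1 y2 + rect_int G x1 x2 y1 y2.
Proof.
move=> cF cG; rewrite /rect_int.
rewrite !(cintD _ _ (rcont_hline _ cF) (rcont_hline _ cG)).
rewrite !(cintD _ _ (rcont_vline _ cF) (rcont_vline _ cG)); ring.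
Qed.

Lemma nm_rect_int_le F K x1 x2 y1 y2 : (forall w, ccont_at F w) ->
  x1 <= x2 -> y1 <= y2 ->
  (forall x y, x1 <= x <= x2 -> y1 <= y <= y2 -> nm (F (x +i* y)%C) <= K) ->
  nm (rect_int F x1 x2 y1 y2) <= 4 * (K * ((x2 - x1) + (y2 - y1))).
Proof.
move=> cF x12 y12 HK.
have nI : nm I = 1 by rewrite /= expr0n expr1n add0r sqrtr1.
have H y : y1 <= y <= y2 -> nm (cint (fun t => F (t +i* y)%C) x1 x2) <= 2 * (K * (x2 - x1)).
  by move=> hy; apply: nm_cint_le => //; [exact: rcont_hline|move=> t ht; apply: HK].
have V x : x1 <= x <= x2 -> nm (cint (fun t => F (x +i* t)%C) y1 y2) <= 2 * (K * (y2 - y1)).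
  by move=> hx; apply: nm_cint_le => //; [exact: rcont_vline|move=> t ht; apply: HK].
rewrite /rect_int (le_trans (nmD _ _))// nmM nI mul1r.
have := nmB (cint (fun t => F (t +i* y1)%C) x1 x2) (cint (fun t => F (t +i* y2)%C) x1 x2).
have := nmB (cint (fun t => F (x2 +i* t)%C) y1 y2) (cint (fun t => F (x1 +i* t)%C) y1 y2).
have := H y1; have := H y2; have := V x1; have := V x2; rewrite !lexx x12 y12.
move=> /(_ isT) ? /(_ isT) ? /(_ isT) ? /(_ isT) ?; lra.
Qed.

Lemma four_split (c : R) (z1 z2 z3 z4 : C) : c <= nm (z1 + z2 + (z3 + z4)) ->
  [\/ c / 4 <= nm z1, c / 4 <= nm z2, c / 4 <= nm z3 | c / 4 <= nm z4].
Proof.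
move=> h; have [|h1] := leP (c / 4) (nm z1); first by constructor 1.
have [|h2] := leP (c / 4) (nm z2); first by constructor 2.
have [|h3] := leP (c / 4) (nm z3); first by constructor 3.
have [|h4] := leP (c / 4) (nm z4); first by constructor 4.
have := nmD (z1 + z2) (z3 + z4); have := nmD z1 z2; have := nmD z3 z4; lra.
Qed.

Lemma nested_point (s : nat -> R) (a : R) :
  (forall n, s n <= s n.+1) -> (forall n, s n.+1 + a / 2 ^+ n.+1 <= s n + a / 2 ^+ n) ->
  0 <= a -> exists x, forall n, s n <= x <= s n + a / 2 ^+ n.
Proof.
move=> s_nd s_ub a0.
have pos n : 0 <= a / 2 ^+ n by rewrite divr_ge0// exprn_ge0.
have mono : {homo s : m n / (m <= n)%N >-> m <= n}.
  by apply: homo_leq => // x y z; exact: le_trans.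
have mono' : {homo (fun n => s n + a / 2 ^+ n) : m n / (m <= n)%N >-> n <= m}.
  by apply: (homo_leq (r := fun x y => y <= x)) => // x y z h1 h2; exact: le_trans h2 h1.
have ub n : ubound (range s) (s n + a / 2 ^+ n).
  move=> _ [m _ <-]; have [mn|/ltnW nm] := leqP m n.
    by rewrite (le_trans (mono _ _ mn))// lerDl.
  by rewrite (le_trans _ (mono' _ _ nm))// lerDl.
exists (sup (range s)) => n; apply/andP; split.
  by apply: ub_le_sup; [exists (s 0%N + a / 2 ^+ 0); exact: ub|exists n].
by apply: ge_sup; [exists (s 0%N), 0%N|exact: ub].
Qed.

Theorem goursat F x1 x2 y1 y2 : entire F -> x1 < x2 -> y1 < y2 ->
  rect_int F x1 x2 y1 y2 = 0.
Proof.
move=> eF x12 y12; have cF := entire_cont eF.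
apply: nm0_eq0; apply: contrapT => /eqP; rewrite neq_lt ltNge nm_ge0/= => c0.
set c := nm _ in c0.
pose a := x2 - x1; pose b := y2 - y1.
have a0 : 0 < a by rewrite subr_gt0.
have b0 : 0 < b by rewrite subr_gt0.
pose J n (p : R * R) := rect_int F p.1 (p.1 + a / 2 ^+ n) p.2 (p.2 + b / 2 ^+ n).
(* Quartering: one quarter carries at least a quarter of the integral. The last clause is an
   implication, so that a successor exists for every corner and choice gives a function. *)
have step n (p : R * R) : exists q : R * R,
    [/\ p.1 <= q.1, p.2 <= q.2, q.1 + a / 2 ^+ n.+1 <= p.1 + a / 2 ^+ n,
        q.2 + b / 2 ^+ n.+1 <= p.2 + b / 2 ^+ n &
        c / 4 ^+ n <= nm (J n p) -> c / 4 ^+ n.+1 <= nm (J n.+1 q)].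
  pose a' := a / 2 ^+ n.+1; pose b' := b / 2 ^+ n.+1.
  have a'0 : 0 <= a' by rewrite divr_ge0 ?exprn_ge0// ltW.
  have b'0 : 0 <= b' by rewrite divr_ge0 ?exprn_ge0// ltW.
  have ea : a / 2 ^+ n = a' + a' by rewrite /a' exprS; field; rewrite expf_neq0.
  have eb : b / 2 ^+ n = b' + b' by rewrite /b' exprS; field; rewrite expf_neq0.
  have c4 : c / 4 ^+ n.+1 = c / 4 ^+ n / 4 by rewrite exprSr invfM mulrA.
  have [hJ|hJ] := leP (c / 4 ^+ n) (nm (J n p)); last first.
    exists p; rewrite !lexx; split => //; rewrite ?ea ?eb ?lerD2l -/a' -/b'; try lra.
  move: (hJ); rewrite {1}/J ea eb !addrA (rect_int_split F _ (p.1 + a') _ _ (p.2 + b') _).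
  move=> /four_split; rewrite -c4.
  by case=> h; [exists p|exists (p.1 + a', p.2)|exists (p.1, p.2 + b')|exists (p.1 + a', p.2 + b')];
    rewrite /J -/a' -/b' ?ea ?eb /=; split; first [exact: (fun=> h)|lra].
have /choice[st Hst] : forall np : nat * (R * R), exists q : R * R,
    [/\ np.2.1 <= q.1, np.2.2 <= q.2, q.1 + a / 2 ^+ np.1.+1 <= np.2.1 + a / 2 ^+ np.1,
        q.2 + b / 2 ^+ np.1.+1 <= np.2.2 + b / 2 ^+ np.1 &
        c / 4 ^+ np.1 <= nm (J np.1 np.2) -> c / 4 ^+ np.1.+1 <= nm (J np.1.+1 q)].
  by move=> [n p]; exact: step.
pose s := fix s n := if n is m.+1 then st (m, s m) else (x1, y1).
have sS n : s n.+1 = st (n, s n) by [].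
have big n : c / 4 ^+ n <= nm (J n (s n)).
  elim: n => [|n IH]; last by rewrite sS; case: (Hst (n, s n)) => _ _ _ _; apply.
  by rewrite /J !expr0 !divr1 /= /a /b ![_ + (_ - _)]addrC !subrK.
have [X HX] : exists x, forall n, (s n).1 <= x <= (s n).1 + a / 2 ^+ n.
  apply: (@nested_point (fun n => (s n).1)); last exact: ltW;
    by move=> n; rewrite sS; case: (Hst (n, s n)).
have [Y HY] : exists x, forall n, (s n).2 <= x <= (s n).2 + b / 2 ^+ n.
  apply: (@nested_point (fun n => (s n).2)); last exact: ltW;
    by move=> n; rewrite sS; case: (Hst (n, s n)).
pose Z : C := (X +i* Y)%C; have [l dF] := eF Z.
have ab0 : 0 < a + b by rewrite addr_gt0.
(* With this tolerance the integral of the remainder [E] over the n-th rectangle is at most half of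
   c / 4^n, while the affine part [A] has a primitive and contributes nothing. *)
pose e := c / (8 * (a + b) ^+ 2).
have e0 : 0 < e by rewrite divr_gt0// mulr_gt0// exprn_gt0.
have [d d0 Hd] := dF e e0.
pose n := (Num.truncn ((a + b) / d)).+1.
pose A z := (F Z - l * Z) + l * z.
pose E z := F z + - (F Z - l * Z + l * z).
have cA z : ccont_at A z by apply: cderiv_cont (cderiv_affine _ _ _).
have cE z : ccont_at E z.
  have [l' dl'] := eF z.
  apply: (@cderiv_cont _ E z (l' + - l)); apply: cderivD; first exact: dl'.
  apply: cderiv_eq (cderiv_affine (- (F Z - l * Z)) (- l) z) => // w.
  by ring.
have n2 : n%:R <= 2 ^+ n :> R by rewrite -natrX ler_nat ltnW// ltn_expl.
have small : (a + b) / 2 ^+ n < d.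
  rewrite ltr_pdivrMr ?exprn_gt0// mulrC -ltr_pdivrMr// (lt_le_trans _ n2)//.
  exact: truncnS_gt.
have JE : J n (s n) = rect_int E (s n).1 ((s n).1 + a / 2 ^+ n) (s n).2 ((s n).2 + b / 2 ^+ n).
  rewrite /J (_ : F = fun z => A z + E z); last first.
    by apply/funext => z; rewrite /A /E addrC subrK.
  rewrite rect_intD// (@rect_int_primitive A (fun z => (F Z - l * Z) * z + l / 2 * (z * z))) ?add0r//.
  move=> z; rewrite /A.
  have := cderivD (cderiv_affine 0 (F Z - l * Z) z)
    (cderivM (cderiv_cst (l / 2) z) (cderivM (cderiv_id z) (cderiv_id z))).
  apply: cderiv_eq => [w|]; first by rewrite add0r.
  by field.
have := big n; rewrite JE leNgt => /negP; apply.
apply: le_lt_trans (nm_rect_int_le (K := e * ((a + b) / 2 ^+ n)) cE _ _ _) _.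
- by rewrite lerDl divr_ge0 ?exprn_ge0// ltW.
- by rewrite lerDl divr_ge0 ?exprn_ge0// ltW.
- move=> x y /andP[hx1 hx2] /andP[hy1 hy2].
  have dist : nm ((x +i* y)%C - Z) <= (a + b) / 2 ^+ n.
    rewrite (le_trans (nm_le_ReIm _))// mulrDl lerD//= ler_norml.
      by have := HX n; lra.
    by have := HY n; lra.
  rewrite /E (_ : _ + - _ = F (Z + ((x +i* y)%C - Z)) - F Z - l * ((x +i* y)%C - Z)); last first.
    by rewrite [Z + _]addrC subrK; ring.
  by rewrite (le_trans (Hd _ (le_lt_trans dist small)))// ler_wpM2l// ltW.
rewrite ![_ + _ - _]addrAC !subrr !add0r -mulrDl.
have -> : 4 * (e * ((a + b) / 2 ^+ n) * ((a + b) / 2 ^+ n)) = c / 2 / 4 ^+ n.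
  have e4 : 4 ^+ n = 2 ^+ n * 2 ^+ n :> R by rewrite -exprMn; congr (_ ^+ n); ring.
  rewrite /e e4; field; rewrite expf_neq0//=; rewrite gt_eqF// addr_gt0//.
by rewrite ltr_pM2r ?invr_gt0 ?exprn_gt0//; lra.
Qed.

End Goursat.

(** * The complex exponential and polar form *)

Section ComplexExponential.
Context {R : realType}.
Local Notation C := (R[i]).
Implicit Types (F G W : C -> C) (z w l : C).
Local Notation I := ((0 +i* 1)%C : C).

Definition cexp z : C :=
  ((expR (Re z) * cos (Im z)) +i* (expR (Re z) * sin (Im z)))%C.

Lemma cexpD z w : cexp (z + w) = cexp z * cexp w.
Proof.
by apply: eq_ReIm; rewrite ?ReM ?ImM /= ReD ImD expRD ?cosD ?sinD; ring.
Qed.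

Lemma cexp0 : cexp 0 = 1.
Proof. by apply: eq_ReIm; rewrite /= expR0 ?cos0 ?sin0 mul1r. Qed.

Lemma nm_cexp z : nm (cexp z) = expR (Re z).
Proof.
apply/eqP; rewrite -(@eqrXn2 _ 2) ?nm_ge0 ?expR_ge0//; apply/eqP.
by rewrite nm_sqr /= !exprMn -mulrDr cos2Dsin2 mulr1.
Qed.

Lemma cexpNK z : cexp (- z) * cexp z = 1.
Proof. by rewrite -cexpD addNr cexp0. Qed.

Lemma cderiv_cexp0 : cderiv cexp 0 1.
Proof.
move=> e e0; pose e' := Num.min (1/2) (e / 6).
have e'0 : 0 < e' by rewrite lt_min !divr_gt0.
have e'1 : e' <= 1 / 2 by rewrite ge_min lexx.
have e'e : 6 * e' <= e by rewrite mulrC -ler_pdivlMr// ge_min lexx orbT.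
have [d1 d10 H1] := derive_eps (is_derive_expR (0 : R)) e'0.
have [d2 d20 H2] := derive_eps (is_derive_cos (0 : R)) e'0.
have [d3 d30 H3] := derive_eps (is_derive_sin (0 : R)) e'0.
exists (Num.min (Num.min d1 (Num.min d2 d3)) (e' / 2)).
  by rewrite !lt_min d10 d20 d30 divr_gt0.
case=> x y; rewrite !lt_min => /andP[/and3P[h1 h2 h3] h4].
rewrite add0r cexp0 mul1r.
have xh := Re_le_nm (x +i* y)%C; have yh := Im_le_nm (x +i* y)%C.
set r := nm (x +i* y)%C in h1 h2 h3 h4 xh yh *; rewrite /= in xh yh.
have {H1} := H1 x (le_lt_trans xh h1).
have {H2} := H2 y (le_lt_trans yh h2).
have {H3} := H3 y (le_lt_trans yh h3).
rewrite !add0r expR0 cos0 sin0 ?mul1r ?oppr0 ?mul0r ?subr0 ?addr0 ?mul1r => H3 H2 H1.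
have ex : `|expR x - 1| <= e'.
  have := ler_normD (expR x - 1 - x) x; rewrite subrK => t.
  have : e' * `|x| <= 1 / 2 * `|x| by rewrite ler_wpM2r.
  lra.
have ex2 : `|expR x| <= 2.
  have := ler_normD (expR x - 1) 1; rewrite subrK normr1 => t; lra.
have k1 : `|expR x * (cos y - 1)| <= 2 * (e' * r).
  rewrite normrM ler_pM// (le_trans H2)// ler_wpM2l// ltW//.
have k2 : `|expR x * (sin y - y)| <= 2 * (e' * r).
  rewrite normrM ler_pM// (le_trans H3)// ler_wpM2l// ltW//.
have k3 : `|(expR x - 1) * y| <= e' * r by rewrite normrM ler_pM.
have k4 : e' * `|x| <= e' * r by rewrite ler_wpM2l// ltW.
rewrite (le_trans (nm_le_ReIm _))//=.
have -> : expR x * cos y - 1 - x = expR x * (cos y - 1) + (expR x - 1 - x) by ring.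
have -> : expR x * sin y - 0 - y = expR x * (sin y - y) + (expR x - 1) * y by ring.
have := ler_normD (expR x * (cos y - 1)) (expR x - 1 - x).
have := ler_normD (expR x * (sin y - y)) ((expR x - 1) * y).
have : 6 * e' * r <= e * r by rewrite ler_wpM2r// nm_ge0.
lra.
Qed.

Lemma cderiv_cexp z : cderiv cexp z (cexp z).
Proof.
have d1 := cderiv_affine (- z) 1 z.
have d2 : cderiv (fun w => cexp (- z + 1 * w)) z (1 * 1).
  by apply: cderiv_comp d1 _; rewrite mul1r addNr; exact: cderiv_cexp0.
apply: cderiv_eq (cderivM (cderiv_cst (cexp z) z) d2); last by ring.
by move=> w; rewrite -cexpD mul1r addNKr.
Qed.

(** The coordinate [w] uniformises the punctured plane: [h] is in the closed unit disc exactly when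
    [w] is in the closed upper half-plane, where Phragmen-Lindelof applies. *)
Lemma cexp_polar h : h != 0 -> exists w, cexp (I * w) = h /\ Im w = - ln (nm h).
Proof.
move=> h0; have n0 := nm_gt0 h0.
have [t [ht1 ht2]] : exists t, cos t = Re h / nm h /\ sin t = Im h / nm h.
  have hx : -1 <= Re h / nm h <= 1.
    by rewrite -ler_norml normrM normfV (gtr0_norm n0) ler_pdivrMr// mul1r Re_le_nm.
  have [_ ca] := acos_def hx.
  have sa : `|sin (acos (Re h / nm h))| = `|Im h / nm h|.
    apply/eqP; rewrite -(@eqrXn2 _ 2)// !real_normK ?num_real//; apply/eqP.
    have := cos2Dsin2 (acos (Re h / nm h)); rewrite ca => e1.
    have e2 : (Im h / nm h) ^+ 2 = 1 - (Re h / nm h) ^+ 2.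
      by rewrite !exprMn !exprVn nm_sqr; field; rewrite -nm_sqr expf_neq0// gt_eqF.
    by rewrite e2; lra.
  have /eqP := sa; rewrite eqr_norm2 => /orP[]/eqP hs.
    by exists (acos (Re h / nm h)).
  by exists (- acos (Re h / nm h)); rewrite cosN sinN hs opprK.
exists (t +i* (- ln (nm h)))%C; split => //.
have e1 : I * (t +i* - ln (nm h))%C = (ln (nm h) +i* t)%C.
  by apply: eq_ReIm => /=; ring.
rewrite e1 /cexp /= lnK ?posrE// ht1 ht2.
by apply: eq_ReIm => /=; rewrite mulrCA divff ?mulr1// gt_eqF.
Qed.

End ComplexExponential.

(** * Mean values over circles and equality at a maximum *)

Section MaximumModulus.
Context {R : realType}.
Local Notation C := (R[i]).
Implicit Types (F G W : C -> C) (z w l : C).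
Local Notation I := ((0 +i* 1)%C : C).

Lemma rderiv_eq (f g : R -> C) t l m : (forall s, f s = g s) -> l = m ->
  rderiv f t l -> rderiv g t m.
Proof. by move=> /funext -> <-. Qed.

(* The integral of F (a + exp w) over a vertical period does not depend on the
   abscissa of the segment; let the abscissa tend to - oo. *)
Lemma circle_mean F a (q : R) : entire F ->
  cint (fun t : R => F (a + cexp (q +i* t)%C)) (- pi) pi = (2 * pi)%:C%C * F a.
Proof.
move=> eF; pose Phi w := F (a + cexp w).
have eP : entire Phi.
  move=> w; have [l dl] := eF (a + cexp w); exists (l * cexp w).
  apply: (@cderiv_comp _ F (fun v => a + cexp v)) => //.
  apply: cderiv_eq (cderivD (cderiv_cst a w) (cderiv_cexp w)) => //.
  by rewrite add0r.
have pipos : - pi < pi :> R by have := pi_gt0 R; lra.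
have per t : Phi (t +i* - pi)%C = Phi (t +i* pi)%C.
  by rewrite /Phi /cexp /= cosN sinN sinpi oppr0.
have cst p r : p < r -> cint (fun t : R => Phi (p +i* t)%C) (- pi) pi =
    cint (fun t : R => Phi (r +i* t)%C) (- pi) pi.
  move=> pr; have := goursat eP pr pipos; rewrite /rect_int.
  rewrite (_ : (fun t : R => Phi (t +i* - pi)%C) = (fun t : R => Phi (t +i* pi)%C)).
    rewrite subrr add0r => /eqP; rewrite mulf_eq0 => /orP[/eqP[] /eqP|].
      by rewrite oner_eq0.
    by rewrite subr_eq0 => /eqP ->.
  exact/funext.
apply/eqP; rewrite -subr_eq0; apply/eqP/nm0_eq0/eqP.
rewrite eq_le nm_ge0 andbT; apply/ler_addgt0Pr => e e0; rewrite add0r.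
have p0 : 0 < 4 * pi :> R by rewrite mulr_gt0// pi_gt0.
have [d d0 Hd] := entire_cont eF a (divr_gt0 e0 p0).
pose p := Num.min (q - 1) (ln (d / 2)).
have pq : p < q by rewrite gt_min; apply/orP; left; lra.
have pd : expR p < d.
  rewrite (@le_lt_trans _ _ (d / 2))//; last by lra.
  rewrite -[leRHS]lnK ?posrE ?divr_gt0// ler_expR ge_min; apply/orP; right.
  exact: lexx.
rewrite -/(Phi _) -(cst _ _ pq).
have cP := entire_cont eP.
have cc : rcont (fun t : R => Phi (p +i* t)%C) by exact: rcont_vline.
have dcst : forall t : R, rderiv (fun s : R => s%:C%C * F a) t (F a).
  move=> t.
  have dz : cderiv (fun z => z * F a) (0 + t%:C%C * 1) (F a).
    by apply: cderiv_eq (cderiv_affine 0 (F a) _) => // w; ring.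
  by apply: rderiv_eq (rderiv_line dz) => [s|]; ring.
have e1 : cint (fun=> F a) (- pi) pi = (2 * pi)%:C%C * F a.
  by rewrite (cintE _ _ dcst) rmorphN /= rmorphM /= rmorph_nat; ring.
have cc2 : rcont (fun t : R => - 1 * F a).
  have := @rcont_line R (fun=> -1 * F a) 0 0; apply => w.
  exact: cderiv_cont (cderiv_cst _ _).
have cc3 : rcont (fun t : R => F a).
  have := @rcont_line R (fun=> F a) 0 0; apply => w.
  exact: cderiv_cont (cderiv_cst _ _).
have -> : cint (fun t : R => Phi (p +i* t)%C) (- pi) pi - (2 * pi)%:C%C * F a =
    cint (fun t : R => Phi (p +i* t)%C + -1 * F a) (- pi) pi.
  by rewrite cintD// cintZ// e1 mulN1r.
rewrite (le_trans (nm_cint_le (K := e / (4 * pi)) (ltW pipos) _ _))//.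
- have := @rcont_vline R (fun w => Phi w + -1 * F a) p; apply => w.
  have [l dl] := eP w; apply: (@cderiv_cont _ _ _ (l + 0)).
  by apply: cderivD => //; exact: cderiv_cst.
- move=> t _; rewrite mulN1r; apply: Hd.
  by rewrite nm_cexp.
have pne : pi != 0 :> R by rewrite gt_eqF// pi_gt0.
rewrite opprK.
have aux (x : R) : x != 0 -> 2 * (e / (4 * x) * (x + x)) = e by move=> ?; field.
rewrite (aux _ pne).
exact: lexx.
Qed.

(** After multiplication by the conjugate [c] of [F a], the real part is at most [nm (F a) ^+ 2] on
    the circle and has this value as its mean. The nondecreasing primitive [g] of the difference
    takes equal values at - pi and pi, so it is constant and equality holds at t = 0. *)
Lemma max_on_circle F a (r : R) : entire F -> 0 < r ->
  (forall h, nm h = r -> nm (F (a + h)) <= nm (F a)) ->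
  nm (F a) <= nm (F (a + r%:C%C)).
Proof.
move=> eF r0 H.
have [->|/eqP Fa0] := pselect (F a = 0); first by rewrite Normc.normc0 nm_ge0.
have nFa := nm_gt0 Fa0.
pose q := ln r; pose c := (Re (F a) -i* Im (F a))%C.
have nc : nm c = nm (F a) by rewrite /c; case: (F a) => x y /=; rewrite sqrrN.
pose f (t : R) := c * F (a + cexp (q +i* t)%C).
have nf t : nm (f t) <= nm (F a) ^+ 2.
  rewrite nmM nc expr2 ler_wpM2l ?nm_ge0// H// nm_cexp /= lnK//.
have cG : rcont (fun t : R => F (a + cexp (q +i* t)%C)).
  have := @rcont_vline R (fun w => F (a + cexp w)) q; apply => w.
  have [l dl] := eF (a + cexp w); apply: (@cderiv_cont _ _ _ (l * (0 + cexp w))).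
  apply: (@cderiv_comp _ F (fun v => a + cexp v)) => //.
  exact: cderivD (cderiv_cst a w) (cderiv_cexp w).
have [Q HQ] : exists Q, forall t, rderiv Q t (f t).
  have [P HP] := exists_cprimitive cG.
  by exists (fun t => c * P t) => t; apply: rderivZ.
have Qpi : Q pi - Q (- pi) = c * ((2 * pi)%:C%C * F a).
  by rewrite -(cintE _ _ HQ) cintZ// circle_mean.
pose g (t : R) := nm (F a) ^+ 2 * t - Re (Q t).
have dg (t : R) : is_derive t 1 g (nm (F a) ^+ 2 - Re (f t)).
  apply: is_derive_eps => e e0; have [HR _] := HQ t.
  have [d d0 Hd] := derive_eps HR e0; exists d => // h /Hd.
  rewrite -normrN; congr (`| _ | <= _); rewrite /g; ring.
have dg0 t : 0 <= nm (F a) ^+ 2 - Re (f t).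
  rewrite subr_ge0 (le_trans (ler_norm _))// (le_trans (Re_le_nm _))//.
have pp := pi_gt0 R; have pipi : - pi <= pi :> R by lra.
have gmono : {in `[- pi, pi] &, {homo g : x y / x <= y}}.
  apply: ger0_derive1_le_cc.
  - by move=> t _; have [] := dg t.
  - by move=> t _; rewrite derive1E; have [_ ->] := dg t.
  - by apply: derivable_within_continuous => t _; have [] := dg t.
have gend : g pi = g (- pi).
  have := congr1 (@complex.Re R) Qpi; rewrite ReD ReN !ReM !ImM /= => h.
  rewrite /g nm_sqr.
  have : Re (Q pi) = Re (Q (- pi)) + (Re (Q pi) - Re (Q (- pi))) by ring.
  rewrite h => ->; ring.
have gc t : - pi <= t <= pi -> g t = g pi.
  move=> /andP[h1 h2]; apply/eqP; rewrite eq_le {2}gend; apply/andP; split.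
    by apply: gmono => //; rewrite in_itv/= ?h1 ?h2 ?pipi ?lexx.
  by apply: gmono => //; rewrite in_itv/= ?h1 ?h2 ?pipi ?lexx.
have f0 : Re (f 0) = nm (F a) ^+ 2.
  apply/eqP; rewrite eq_sym -subr_eq0 eq_le dg0 andbT.
  apply/ler_addgt0Pr => e e0; rewrite add0r.
  have [d d0 Hd] := derive_eps (dg 0) e0.
  pose h := Num.min d pi / 2.
  have h0 : 0 < h by rewrite divr_gt0// lt_min d0.
  have hd : h < Num.min d pi by rewrite /h ltr_pdivrMr// ltr_pMr ?ltr1n// lt_min d0.
  have {Hd} := Hd h; rewrite gtr0_norm// (lt_le_trans hd) ?ge_min ?lexx// => /(_ isT).
  have hp : h < pi by rewrite (lt_le_trans hd) ?ge_min ?lexx ?orbT.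
  rewrite add0r (gc h) ?(gc 0); try lra.
  rewrite subrr sub0r normrN normrM (gtr0_norm h0) ler_pM2r// => /(le_trans _); apply.
  exact: ler_norm.
have : Re (f 0) <= nm (f 0) by rewrite (le_trans (ler_norm _))// Re_le_nm.
rewrite f0 nmM nc expr2 ler_pM2l// (_ : cexp _ = r%:C%C)//.
by apply: eq_ReIm; rewrite /= ?cos0 ?sin0 ?mulr1 ?mulr0 ?lnK.
Qed.

End MaximumModulus.

(** * Growth estimates of Phragmen-Lindelof and Schwarz type *)

Section PhragmenLindelof.
Context {R : realType}.
Local Notation C := (R[i]).
Implicit Types (F G W : C -> C) (z w l : C).
Local Notation I := ((0 +i* 1)%C : C).

Lemma nm_lip z w : `|nm z - nm w| <= nm (z - w).
Proof.
rewrite ler_norml; have := nmD (z - w) w; have := nmD (w - z) z.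
rewrite !subrK (nm_distC w z) => h1 h2; lra.
Qed.

(** If the maximum exceeds [m], all its points are interior. By compactness one of them has the
    largest abscissa, and [max_on_circle] produces another one further to the right. *)
Lemma maximum_modulus_rect F x1 x2 y1 y2 m : entire F ->
  (forall x y, x1 <= x <= x2 -> y1 <= y <= y2 ->
     [|| x == x1, x == x2, y == y1 | y == y2] -> nm (F (x +i* y)%C) <= m) ->
  forall x y, x1 <= x <= x2 -> y1 <= y <= y2 -> nm (F (x +i* y)%C) <= m.
Proof.
move=> eF Hb x y hx hy; have cF := entire_cont eF.
pose K : set (R * R) := `[x1, x2]%classic `*` `[y1, y2]%classic.
have cK : compact K by apply: compact_setX; exact: segment_compact.
have Kp (p : R * R) : K p <-> (x1 <= p.1 <= x2 /\ y1 <= p.2 <= y2).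
  by rewrite /K /= !in_itv.
pose u (p : R * R) := nm (F (p.1 +i* p.2)%C).
have cu : continuous u.
  move=> p; apply/cvgrPdist_le => e e0; have [d d0 Hd] := cF (p.1 +i* p.2)%C e e0.
  have d2 : 0 < d / 2 by rewrite divr_gt0.
  have nb : nbhs p (ball p (d / 2)) by apply/nbhs_ballP; exists (d / 2).
  apply: filterS nb => q [/= q1 q2].
  rewrite (le_trans (nm_lip _ _))// nm_distC.
  have -> : (q.1 +i* q.2)%C = (p.1 +i* p.2)%C + ((q.1 - p.1) +i* (q.2 - p.2))%C.
    by apply: eq_ReIm => /=; ring.
  apply: Hd; rewrite (le_lt_trans (nm_le_ReIm _))//= (splitr d) ltrD//; rewrite distrC; [exact: q1|exact: q2].
have Kxy : K !=set0 by exists (x, y); apply/Kp.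
have [c0 c0K Hc0] := compact_EVT_max Kxy cK (continuous_subspaceT cu).
rewrite inE in c0K.
set M := u c0; have HM p : K p -> u p <= M by move=> Kpp; apply: Hc0; rewrite inE.
apply: le_trans (HM (x, y) (proj2 (Kp (x, y)) (conj hx hy))) _.
rewrite leNgt; apply/negP => mM.
pose K' := K `&` u @^-1` [set r | r = M].
have cK' : compact K'.
  apply: compact_closedI => //; apply: preimage_closed => [p _|]; first exact: cu.
  exact: closed_eq.
have cfst : continuous (fst : R * R -> R) by move=> p; exact: cvg_fst.
have [c1 c1K Hc1] := compact_EVT_max (ex_intro K' c0 (conj c0K erefl)) cK' (continuous_subspaceT cfst).
rewrite inE in c1K; case: c1K => /Kp[h1 h2] /= uM.
have /norP[n1 /norP[n2 /norP[n3 n4]]] :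
    ~~ [|| c1.1 == x1, c1.1 == x2, c1.2 == y1 | c1.2 == y2].
  apply/negP => hb; have := Hb _ _ h1 h2 hb; rewrite -/(u c1) uM; lra.
have /andP[l1 l2] : x1 < c1.1 < x2.
  by rewrite !lt_neqAle (eq_sym x1) n1 n2.
have /andP[l3 l4] : y1 < c1.2 < y2.
  by rewrite !lt_neqAle (eq_sym y1) n3 n4.
pose r := Num.min (Num.min (x2 - c1.1) (c1.1 - x1)) (Num.min (y2 - c1.2) (c1.2 - y1)).
have r0 : 0 < r by rewrite !lt_min !subr_gt0 l1 l2 l3 l4.
have rle : [/\ r <= x2 - c1.1, r <= c1.1 - x1, r <= y2 - c1.2 & r <= c1.2 - y1].
  by rewrite /r !ge_min !lexx ?orbT.
case: rle => r1 r2 r3 r4.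
have inK h : nm h = r -> K (c1.1 + Re h, c1.2 + Im h).
  move=> nh; apply/Kp => /=; have := Re_le_nm h; have := Im_le_nm h.
  rewrite nh !ler_norml; lra.
have pE h : (c1.1 +i* c1.2)%C + h = ((c1.1 + Re h) +i* (c1.2 + Im h))%C.
  by apply: eq_ReIm; rewrite ?ReD ?ImD.
have mc h : nm h = r -> nm (F ((c1.1 +i* c1.2)%C + h)) <= nm (F (c1.1 +i* c1.2)%C).
  by move=> nh; rewrite -/(u c1) uM pE; exact: (HM _ (inK _ nh)).
have := max_on_circle eF r0 mc; rewrite pE /= addr0 -/(u c1) uM => geM.
have nr : nm (r%:C%C : C) = r by rewrite nm_real gtr0_norm.
have Kr := inK _ nr; rewrite /= addr0 in Kr.
have : (c1.1 + r, c1.2) \in K'.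
  rewrite inE; split => //=; apply/eqP; rewrite eq_le; apply/andP; split => //.
  exact: (HM _ Kr).
by move=> /Hc1 /=; lra.
Qed.

Lemma expR_Mle (x K : R) : 0 < K -> K <= x -> K <= expR x.
Proof. by move=> K0 Kx; have := expR_ge1Dx x; lra. Qed.

(* The multiplier exp (i k z - e z^2) decays in strips and has no poles. *)
Lemma phragmen_lindelof G (K m : R) : entire G ->
  (forall z, 0 <= Im z -> nm (G z) <= K) ->
  (forall z, Im z = 0 -> nm (G z) <= m) ->
  forall z, 0 <= Im z -> nm (G z) <= m.
Proof.
move=> eG GK Gm.
suff pos (m' : R) : 0 < m' -> (forall z, Im z = 0 -> nm (G z) <= m') ->
    forall z, 0 <= Im z -> nm (G z) <= m'.
  move=> z z0; apply/ler_addgt0Pr => e e0.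
  apply: pos => //; last by move=> w w0; rewrite (le_trans (Gm w w0))// lerDl ltW.
  by rewrite ltr_wpDl// (le_trans (nm_ge0 (G 0)) (Gm 0 _)).
move=> {Gm}m0 Gm [x0 y0] /= y00; move: m' m0 Gm => {}m m0 Gm.
pose A := Num.max K m; have KA : K <= A by rewrite le_max lexx.
have mA : m <= A by rewrite le_max lexx orbT.
have A0 : 0 < A by exact: lt_le_trans mA.
(* On the top side Im z = Y of a rectangle only the bound [A] is known; the multiplier with k = L /
   Y lowers it there by exp L = A / m, down to [m]. *)
pose L := ln (A / m); have Am : 1 <= A / m by rewrite ler_pdivlMr// mul1r.
have L0 : 0 <= L by rewrite ln_ge0.
have eL : expR L = A / m by rewrite lnK// posrE divr_gt0.
have main (Y e : R) : 0 < Y -> y0 <= Y -> 0 < e ->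
    nm (G (x0 +i* y0)%C) <= m * expR (L / Y * y0 + e * (x0 ^+ 2 + Y ^+ 2)).
  move=> Y0 yY e0; pose k := L / Y.
  have k0 : 0 <= k by rewrite divr_ge0// ltW.
  pose P z := G z * cexp ((k%:C%C * I) * z + (- e)%:C%C * (z * z)).
  have eP : entire P.
    move=> z; have [l dl] := eG z.
    have dq : cderiv (fun w => (k%:C%C * I) * w + (- e)%:C%C * (w * w)) z
        ((k%:C%C * I) + (0 * (z * z) + (- e)%:C%C * (1 * z + z * 1))).
      apply: cderivD.
        by apply: cderiv_eq (cderiv_affine 0 (k%:C%C * I) z) => // w; rewrite add0r.
      exact: cderivM (cderiv_cst _ _) (cderivM (cderiv_id z) (cderiv_id z)).
    eexists; apply: cderivM dl _; exact: cderiv_comp dq (cderiv_cexp _).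
  have nP x y : nm (P (x +i* y)%C) =
      nm (G (x +i* y)%C) * expR (- (k * y) - e * (x ^+ 2 - y ^+ 2)).
    by rewrite nmM nm_cexp; congr (_ * expR _); rewrite /=; ring.
  pose T := Num.max (Num.max `|x0| 1) (A / m / e).
  have Tx : `|x0| <= T by rewrite !le_max lexx.
  have T1 : 1 <= T by rewrite !le_max lexx orbT.
  have Te : A / m / e <= T by rewrite le_max lexx orbT.
  have eT : A <= m * expR (e * T ^+ 2).
    rewrite -ler_pdivrMl// mulrC (expR_Mle (divr_gt0 A0 m0))//.
    move: Te; rewrite ler_pdivrMr// (mulrC T) => /le_trans; apply.
    by rewrite ler_wpM2l ?(ltW e0)// expr2 ler_peMr//; lra.
  pose B := m * expR (e * Y ^+ 2).
  have bnd x y : - T <= x <= T -> 0 <= y <= Y ->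
      [|| x == - T, x == T, y == 0 | y == Y] -> nm (P (x +i* y)%C) <= B.
    move=> hx /andP[hy1 hy2]; rewrite nP /B.
    have Gx : nm (G (x +i* y)%C) <= A by rewrite (le_trans (GK _ _)).
    have ky : 0 <= k * y by rewrite mulr_ge0.
    have yY2 : y ^+ 2 <= Y ^+ 2 by rewrite ler_sqr ?nnegrE// ltW.
    have eyY : e * y ^+ 2 <= e * Y ^+ 2 by rewrite ler_wpM2l// ltW.
    have ex : 0 <= e * x ^+ 2 by rewrite mulr_ge0 ?sqr_ge0// ltW.
    have side : x ^+ 2 = T ^+ 2 ->
        nm (G (x +i* y)%C) * expR (- (k * y) - e * (x ^+ 2 - y ^+ 2)) <= m * expR (e * Y ^+ 2).
      move=> ->.
      rewrite (le_trans (ler_wpM2r (expR_ge0 _) (le_trans Gx eT)))//.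
      rewrite -mulrA -expRD ler_wpM2l ?(ltW m0)// ler_expR; lra.
    case/or4P => /eqP e1.
    - by apply: side; rewrite e1 sqrrN.
    - by apply: side; rewrite e1.
    - rewrite ler_pM ?nm_ge0 ?expR_ge0//; first by apply: Gm.
      by rewrite ler_expR e1 mulr0; rewrite e1 in ky eyY; lra.
    - rewrite (le_trans (ler_wpM2r (expR_ge0 _) Gx))//.
      have -> : A = m * expR L by rewrite eL mulrCA mulfV ?mulr1// gt_eqF.
      rewrite -mulrA -expRD ler_wpM2l ?(ltW m0)// ler_expR e1 /k divfK ?gt_eqF//.
      lra.
  have hx0 : - T <= x0 <= T by rewrite -ler_norml.
  have hy0 : 0 <= y0 <= Y by rewrite y00.
  have := maximum_modulus_rect eP bnd hx0 hy0.
  rewrite nP -ler_pdivlMr ?expR_gt0// /B => /le_trans; apply.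
  rewrite -expRN -[leLHS]mulrA -expRD ler_wpM2l ?(ltW m0)// ler_expR -/k.
  have : 0 <= e * y0 ^+ 2 by rewrite mulr_ge0 ?sqr_ge0// ltW.
  lra.
rewrite leNgt; apply/negP => lt.
set N := nm _ in lt main.
have Nm : 1 < N / m by rewrite ltr_pdivlMr// mul1r.
pose t := ln (N / m); have t0 : 0 < t by rewrite ln_gt0.
have N0 : 0 < N by exact: lt_trans lt.
have et : expR t = N / m by rewrite lnK// posrE divr_gt0.
(* [Y] is fixed before [e]: it makes L y0 / Y at most t / 4, and [e] then makes e (x0^2 + Y^2) equal
   to t / 4, so the exponent in [main] stays below t. *)
pose Y := y0 + 1 + 4 * L * y0 / t.
have q0 : 0 <= 4 * L * y0 / t by rewrite divr_ge0 ?(ltW t0)// !mulr_ge0.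
have Y0 : 0 < Y by rewrite /Y; lra.
have yY : y0 <= Y by rewrite /Y; lra.
have s0 : 0 < x0 ^+ 2 + Y ^+ 2 by rewrite ltr_wpDl ?sqr_ge0// exprn_gt0.
pose e := t / (4 * (x0 ^+ 2 + Y ^+ 2)).
have e0 : 0 < e by rewrite divr_gt0// mulr_gt0.
have := main Y e Y0 yY e0; rewrite leNgt => /negP; apply.
have -> : N = m * expR t by rewrite et mulrCA mulfV ?mulr1// gt_eqF.
rewrite ltr_pM2l// ltr_expR.
have -> : e * (x0 ^+ 2 + Y ^+ 2) = t / 4 by rewrite /e; field; rewrite gt_eqF.
have : L / Y * y0 <= t / 4.
  rewrite mulrAC ler_pdivrMr// /Y; have : t * (4 * L * y0 / t) = 4 * L * y0.
    by rewrite mulrCA mulfV ?mulr1// gt_eqF.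
  by have := mulr_ge0 (ltW t0) y00; lra.
lra.
Qed.

Definition exp_type (s : R) F := entire F /\
  exists K, forall z, nm (F z) <= K * expR (s * `|Im z|).

(** The product of F with exp (i s z) is bounded in the upper half-plane and has modulus |F| on the
    real axis, so Phragmen-Lindelof replaces the unknown constant by [m]. The lower half-plane
    follows by z -> - z. *)
Lemma exp_type_le s F m : exp_type s F ->
  (forall x : R, nm (F x%:C%C) <= m) -> forall z, nm (F z) <= m * expR (s * `|Im z|).
Proof.
move=> [eF [K HK]] Hm.
have up (H : C -> C) : entire H -> (forall z, nm (H z) <= K * expR (s * `|Im z|)) ->
    (forall x : R, nm (H x%:C%C) <= m) ->
    forall z, 0 <= Im z -> nm (H z) <= m * expR (s * `|Im z|).
  move=> eH HHK HHm z z0; pose G w := H w * cexp (s%:C%C * I * w).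
  have nG w : nm (G w) = nm (H w) * expR (- (s * Im w)).
    by rewrite nmM nm_cexp; congr (_ * expR _); rewrite !ReM !ImM /=; ring.
  have eG : entire G.
    move=> w; have [l dl] := eH w; eexists; apply: cderivM dl _.
    apply: cderiv_comp (cderiv_cexp _).
    by apply: cderiv_eq (cderiv_affine 0 (s%:C%C * I) w) => // v; rewrite add0r.
  have := @phragmen_lindelof G K m eG _ _ z z0; rewrite nG.
  rewrite -ler_pdivlMr ?expR_gt0// -expRN opprK ger0_norm//; apply.
  - move=> w w0; rewrite nG -ler_pdivlMr ?expR_gt0// -expRN opprK.
    by have := HHK w; rewrite (ger0_norm w0).
  - move=> w w0; rewrite nG w0 mulr0 oppr0 expR0 mulr1.
    by rewrite (_ : w = (Re w)%:C%C)//; apply: eq_ReIm.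
move=> z; have [z0|/ltW z0] := leP 0 (Im z); first exact: up.
have := up (fun w => F (- w)) _ _ _ (- z); rewrite ImN oppr_ge0 opprK normrN; apply => //.
- move=> w; have [l dl] := eF (- w); exists (l * -1); apply: cderiv_comp dl.
  by apply: cderiv_eq (cderiv_affine 0 (-1) w) => // v; ring.
- by move=> w; have := HK (- w); rewrite ImN normrN.
- by move=> x; have := Hm (- x); rewrite rmorphN.
Qed.

(* Schwarz's lemma without removable singularities: for h = exp (i w) the
   quotient (F (a + h) - F a) / h is entire in w and bounded on a half-plane. *)
Lemma entire_lipschitz F a B : entire F ->
  (forall h, nm h <= 1 -> nm (F (a + h)) <= B) ->
  forall h, nm h <= 1 -> nm (F (a + h) - F a) <= 2 * B * nm h.
Proof.
move=> eF HB.
have B0 : 0 <= B by rewrite (le_trans (nm_ge0 (F (a + 0))))// HB// Normc.normc0.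
have B2 h : nm h <= 1 -> nm (F (a + h) - F a) <= 2 * B.
  move=> h1; have := HB 0; rewrite Normc.normc0 addr0 => /(_ ler01) ha.
  by rewrite (le_trans (nmB _ _))//; have := HB h h1; lra.
pose G w := (F (a + cexp (I * w)) - F a) * cexp (- (I * w)).
have [l dl] := eF a.
have [d d0 Hd] := dl 1 ltr01.
have nI w : nm (cexp (I * w)) = expR (- Im w).
  by rewrite nm_cexp ReM /=; congr expR; ring.
have nG w : nm (G w) = nm (F (a + cexp (I * w)) - F a) / nm (cexp (I * w)).
  rewrite nmM nI nm_cexp ReN ReM /= -expRN; congr (_ * expR _); ring.
have eG : entire G.
  move=> w; have [l' dl'] := eF (a + cexp (I * w)).
  have dI v : cderiv (fun w => v * w) w v.
    by apply: cderiv_eq (cderiv_affine 0 v w) => // u; rewrite add0r.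
  have dE v : cderiv (fun w => cexp (v * w)) w (cexp (v * w) * v).
    exact: (cderiv_comp (dI v) (cderiv_cexp _)).
  have d1 := cderivD (cderiv_cst a w) (dE I).
  have d2 := cderiv_comp d1 dl'.
  have d3 := cderivD d2 (cderiv_cst (- F a) w).
  have := cderivM d3 (dE (- I)).
  set D := (X in cderiv _ _ X) => hD; exists D.
  by apply: cderiv_eq hD => // u; rewrite /G mulNr.
(* Differentiability at [a] bounds the quotient for |h| < d, and the bound 2 B / d covers larger
   |h|. This depends on [F], but Phragmen-Lindelof brings it down to the boundary value 2 B. *)
pose K := Num.max (1 + nm l) (2 * B / d).
have GK w : 0 <= Im w -> nm (G w) <= K.
  move=> w0; rewrite nG; have nz0 : 0 < nm (cexp (I * w)) by rewrite nI expR_gt0.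
  have nz1 : nm (cexp (I * w)) <= 1 by rewrite nI -expR0 ler_expR oppr_le0.
  rewrite ler_pdivrMr//.
  have [zd|dz] := ltP (nm (cexp (I * w))) d.
    have := Hd _ zd; set u := cexp _ in nz0 *; rewrite mul1r => h1.
    have := nmD (F (a + u) - F a - l * u) (l * u); rewrite subrK nmM => h2.
    rewrite (@le_trans _ _ ((1 + nm l) * nm u))//; first lra.
    by rewrite ler_wpM2r ?nm_ge0// le_max lexx.
  rewrite (le_trans (B2 _ nz1))// -ler_pdivrMr//.
  rewrite (@le_trans _ _ (2 * B / d))//; last by rewrite le_max lexx orbT.
  by rewrite ler_wpM2l ?mulr_ge0// lef_pV2// posrE.
have Gm w : Im w = 0 -> nm (G w) <= 2 * B.
  move=> w0; rewrite nG nI w0 oppr0 expR0 divr1; apply: B2.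
  by rewrite nI w0 oppr0 expR0.
move=> h h1; have [->|hn] := eqVneq h 0.
  by rewrite addr0 subrr Normc.normc0 mulr0.
have [w [wh wi]] := cexp_polar hn.
have := phragmen_lindelof eG GK Gm (z := w).
rewrite wi oppr_ge0 nG wh ler_pdivrMr ?nm_gt0//; apply.
exact: ln_le0.
Qed.

End PhragmenLindelof.

(** * Functions of exponential type and their limits along ultrafilters *)

Section UltraLimits.
Context {R : realType} (U : set_system nat) {UF : UltraFilter U}.
Hypothesis Ucof : forall N, U [set n | (N <= n)%N].
Local Notation C := (R[i]).
Implicit Types (a b : nat -> C) (l m : C).

Definition ulims a l := forall e : R, 0 < e -> U [set n | nm (a n - l) <= e].

Lemma ulims_cst l : ulims (fun=> l) l.
Proof.
by move=> e e0; apply: filterE => n /=; rewrite subrr Normc.normc0 ltW.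
Qed.

Lemma ulimsD a b l m : ulims a l -> ulims b m -> ulims (fun n => a n + b n) (l + m).
Proof.
move=> ha hb e e0; have e2 : 0 < e / 2 by rewrite divr_gt0.
apply: filterS2 (ha _ e2) (hb _ e2) => n /= h1 h2.
rewrite (_ : _ - _ = (a n - l) + (b n - m)); last by ring.
by rewrite (le_trans (nmD _ _))// (splitr e) lerD.
Qed.

Lemma ulimsM a b l m : ulims a l -> ulims b m -> ulims (fun n => a n * b n) (l * m).
Proof.
move=> ha hb e e0.
pose K := 1 + nm l + nm m.
have K1 : 1 <= K by rewrite /K; have := nm_ge0 m; have := nm_ge0 l; lra.
have K0 : 0 < K by lra.
pose e' := Num.min 1 (e / (2 * K)).
have e'0 : 0 < e' by rewrite lt_min ltr01 divr_gt0// mulr_gt0.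
have e'1 : e' <= 1 by rewrite ge_min lexx.
have e'e : 2 * (e' * K) <= e.
  rewrite mulrCA -ler_pdivlMr ?mulr_gt0//; by rewrite ge_min lexx orbT.
apply: filterS2 (ha _ e'0) (hb _ e'0) => n /= h1 h2.
rewrite (_ : _ - _ = (a n - l) * b n + l * (b n - m)); last by ring.
have bK : nm (b n) <= K.
  by have := nmD (b n - m) m; rewrite subrK /K; have := nm_ge0 l; lra.
have lK : nm l <= K by rewrite /K; have := nm_ge0 m; lra.
have p1 : nm ((a n - l) * b n) <= e' * K by rewrite nmM ler_pM ?nm_ge0.
have p2 : nm (l * (b n - m)) <= K * e' by rewrite nmM ler_pM ?nm_ge0.
have := nmD ((a n - l) * b n) (l * (b n - m)); lra.
Qed.

Lemma ulimsZ x a l : ulims a l -> ulims (fun n => x * a n) (x * l).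
Proof. by move=> ha; apply: ulimsM => //; exact: ulims_cst. Qed.

Lemma ulimsB a b l m : ulims a l -> ulims b m -> ulims (fun n => a n - b n) (l - m).
Proof.
move=> ha hb; rewrite -mulN1r; have := ulimsD ha (ulimsZ (-1) hb).
by rewrite (_ : (fun n => _) = (fun n => a n - b n))//; apply/funext => n; rewrite mulN1r.
Qed.

Lemma ulims_le a l (B : R) : ulims a l -> (forall e, 0 < e -> U [set n | nm (a n) <= B + e]) ->
  nm l <= B.
Proof.
move=> ha hB; apply/ler_addgt0Pr => e e0; have e2 : 0 < e / 2 by rewrite divr_gt0.
have [n [/= h1 h2]] := filter_ex (filterI (ha _ e2) (hB _ e2)).
have := nmD (l - a n) (a n); rewrite subrK nm_distC; lra.
Qed.

Lemma ulims_leT a l (B : R) : ulims a l -> (forall n, nm (a n) <= B) -> nm l <= B.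
Proof.
move=> ha hB; apply: (ulims_le ha) => e e0; apply: filterE => n /=.
by rewrite (le_trans (hB n))// lerDl ltW.
Qed.

Lemma ulims_unique a l m : ulims a l -> ulims a m -> l = m.
Proof.
move=> hl hm; apply/eqP; rewrite -subr_eq0; apply/eqP/nm0_eq0/eqP.
rewrite eq_le nm_ge0 andbT; apply: (ulims_leT (ulimsB hl hm)) => n.
by rewrite subrr Normc.normc0.
Qed.

Lemma ulims_near a b l : ulims a l ->
  (forall e : R, 0 < e -> U [set n | nm (b n - a n) <= e]) -> ulims b l.
Proof.
move=> ha hb; have h0 : ulims (fun n => b n - a n) 0.
  by move=> e /hb; apply: filterS => n /=; rewrite subr0.
have := ulimsD h0 ha; rewrite add0r.
by rewrite (_ : (fun n => _) = b)//; apply/funext => n; rewrite subrK.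
Qed.

Lemma ulims_cvg a l : (forall e : R, 0 < e -> exists N, forall n, (N <= n)%N -> nm (a n - l) <= e) ->
  ulims a l.
Proof. by move=> ha e /ha[N HN]; apply: filterS (Ucof N) => n /= /HN. Qed.

(** Compactness of the interval [- K, K], applied to real and imaginary parts. As [U] is the same
    for every bounded sequence, pointwise limits of functions exist at all points simultaneously. *)
Lemma ulims_exists a (K : R) : (forall n, nm (a n) <= K) -> exists l, ulims a l.
Proof.
move=> aK.
have real (u : nat -> R) : (forall n, `|u n| <= K) ->
    exists x : R, forall e : R, 0 < e -> U [set n | `|u n - x| <= e].
  move=> uK; have Uu : UltraFilter (u @ U).
    split => [|G PG sG]; first exact: fmap_proper_filter.
    apply/seteqP; split => // A GA; have [//|UA] := in_ultra_setVsetC (u @^-1` A) UF.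
    have : (A `&` ~` A) !=set0 by apply: (@filter_ex _ G); apply: filterI => //; exact: sG.
    by move=> [x []].
  have := @segment_compact R (- K) K; rewrite compact_ultra.
  move=> /(_ (u @ U) Uu) []; first by apply: (@filterE _ U) => n; rewrite /= in_itv/= -ler_norml; exact: uK.
  move=> x [_ /= /cvgrPdist_le hx]; exists x => e /hx.
  by apply: filterS => n /=; rewrite distrC.
have [x hx] := real (fun n => Re (a n)) (fun n => le_trans (Re_le_nm _) (aK n)).
have [y hy] := real (fun n => Im (a n)) (fun n => le_trans (Im_le_nm _) (aK n)).
exists (x +i* y)%C => e e0; have e2 : 0 < e / 2 by rewrite divr_gt0.
apply: filterS2 (hx _ e2) (hy _ e2) => n /= h1 h2.
rewrite (le_trans (nm_le_ReIm _))// (splitr e) lerD//.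
  by rewrite ReD ReN.
by rewrite ImD ImN.
Qed.

End UltraLimits.

(** * Estimates depending only on the type and the bound on the real axis *)

Section ExponentialType.
Context {R : realType}.
Local Notation C := (R[i]).
Implicit Types (F G W : C -> C) (z w l : C) (s : R).

Lemma exp_typeD s F G : exp_type s F -> exp_type s G -> exp_type s (fun z => F z + G z).
Proof.
move=> [eF [K HK]] [eG [L HL]]; split.
  move=> z; have [l dl] := eF z; have [m dm] := eG z; exists (l + m); exact: cderivD.
exists (K + L) => z; rewrite (le_trans (nmD _ _))// mulrDl lerD//.
Qed.

Lemma exp_typeZ s c F : exp_type s F -> exp_type s (fun z => c * F z).
Proof.
move=> [eF [K HK]]; split.
  move=> z; have [l dl] := eF z; exists (0 * F z + c * l).
  by apply: cderivM => //; exact: cderiv_cst.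
by exists (nm c * K) => z; rewrite nmM -mulrA ler_wpM2l// nm_ge0.
Qed.

Lemma entire_shift F h : entire F -> entire (fun z => F (z + h)).
Proof.
move=> eF z; have [l dl] := eF (z + h); exists (l * (1 + 0)).
by apply: (@cderiv_comp _ F (fun z => z + h)) => //; apply: cderivD; [exact: cderiv_id|exact: cderiv_cst].
Qed.

Lemma exp_type_shift s F (t : R) : exp_type s F -> exp_type s (fun z => F (z + t%:C%C)).
Proof.
move=> [eF [K HK]]; split; first exact: entire_shift.
by exists K => z; rewrite (le_trans (HK _))// ImD /= addr0.
Qed.

Lemma exp_typeB s F G : exp_type s F -> exp_type s G -> exp_type s (fun z => F z - G z).
Proof.
move=> hF hG; have := exp_typeD hF (exp_typeZ (-1) hG).
by rewrite (_ : (fun z => _) = (fun z => F z - G z))//; apply/funext => z; rewrite mulN1r.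
Qed.

Section Bounds.
Variables (s m : R) (F : C -> C).
Hypotheses (s0 : 0 <= s) (tF : exp_type s F) (Fm : forall x : R, nm (F x%:C%C) <= m).

Let m0 : 0 <= m. Proof. exact: le_trans (nm_ge0 _) (Fm 0). Qed.

Let local_bound z h (r : R) : nm h <= r -> nm (F (z + h)) <= m * expR (s * (`|Im z| + r)).
Proof.
move=> hr; rewrite (le_trans (exp_type_le tF Fm _))// ler_wpM2l// ler_expR ler_wpM2l//.
by rewrite ImD (le_trans (ler_normD _ _))// lerD2l (le_trans _ hr)// Im_le_nm.
Qed.

Lemma exp_type_lipschitz z h : nm h <= 1 ->
  nm (F (z + h) - F z) <= 2 * (m * expR (s * (`|Im z| + 1))) * nm h.
Proof.
apply: entire_lipschitz; first by case: tF.
by move=> k k1; exact: local_bound.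
Qed.

(** A weak form of Bernstein's inequality: |F| is at most m exp s in the unit disc about a real
    point, and [entire_lipschitz] contributes the factor 2. Increments longer than 1 are covered by
    boundedness. The constant depends on s alone. *)
Lemma exp_type_lipschitz_real (x h : R) :
  nm (F (x + h)%:C%C - F x%:C%C) <= 2 * expR s * m * `|h|.
Proof.
have es : 1 <= expR s by rewrite -expR0 ler_expR.
have [h1|h1] := leP `|h| 1.
  have := @exp_type_lipschitz x%:C%C h%:C%C; rewrite nm_real => /(_ h1).
  by rewrite rmorphD /= normr0 add0r mulr1 (mulrC m) mulrA.
rewrite (le_trans (nmB _ _))//.
have := Fm (x + h); have := Fm x => h2 h3.
have : m <= expR s * m by rewrite ler_peMl.
have : expR s * m <= expR s * m * `|h| by rewrite ler_peMr ?mulr_ge0 ?expR_ge0// ltW.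
lra.
Qed.

(** [entire_lipschitz] is used twice: for F it makes the difference [H] small like [h], and for [H]
    it gains the factor [k]. *)
Lemma exp_type_second_difference z h k : nm h <= 1 -> nm k <= 1 ->
  nm (F (z + k + h) - F (z + k) - (F (z + h) - F z)) <=
  4 * (m * expR (s * (`|Im z| + 2))) * nm h * nm k.
Proof.
move=> h1 k1; pose H w := F (w + h) - F w.
have eF : entire F by case: tF.
have eH : entire H.
  move=> w; have [l dl] := entire_shift h eF w; have [l' dl'] := eF w.
  exists (l + -1 * l'); apply: cderiv_eq (_ : _ = _) (cderivD dl (cderivM (cderiv_cst (-1) w) dl')).
    by move=> v; rewrite /H mulN1r.
  by rewrite mul0r add0r.
have HB k' : nm k' <= 1 -> nm (H (z + k')) <= 2 * (m * expR (s * (`|Im z| + 2))) * nm h.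
  move=> k'1; rewrite (le_trans (exp_type_lipschitz _ h1))//.
  rewrite ler_wpM2r ?nm_ge0// ler_wpM2l// ler_wpM2l// ler_expR ler_wpM2l//.
  have := Im_le_nm k'; have := ler_normD (Im z) (Im k'); rewrite ImD; lra.
have := entire_lipschitz eH HB k1; rewrite /H => /le_trans; apply.
by rewrite le_eqVlt; apply/orP; left; apply/eqP; ring.
Qed.

(** The step [h] is cut into n equal steps [k]. The increments along them differ from the first one
    by second differences, which sum to O(h^2), and n times the first increment tends to l h. The
    remainder depends on [F] only through [m] and [s], which is what makes it survive limits. *)
Lemma exp_type_taylor z l h : cderiv F z l -> nm h <= 1 ->
  nm (F (z + h) - F z - l * h) <= 4 * (m * expR (s * (`|Im z| + 2))) * nm h ^+ 2.
Proof.
move=> dl h1; set K := 4 * _.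
have K0 : 0 <= K by rewrite !mulr_ge0// expR_ge0.
apply/ler_addgt0Pr => e e0.
have h0 : 0 < nm h + 1 by rewrite ltr_wpDl// nm_ge0.
have [d d0 Hd] := dl _ (divr_gt0 e0 h0).
pose n := (Num.truncn (nm h / d)).+1.
have n0 : 0 < n%:R :> R by rewrite ltr0n.
have nd : nm h / n%:R < d by rewrite ltr_pdivrMr// mulrC -ltr_pdivrMr// truncnS_gt.
pose k : C := h / n%:R.
have nk : nm k = nm h / n%:R.
  by rewrite nmM Normc.normcV -(rmorph_nat (real_complex R)) nm_real ger0_norm// ltW.
have n1 : 1 <= n%:R :> R by rewrite ler1n.
have k1 : nm k <= nm h by rewrite nk ler_pdivrMr// ler_peMr// nm_ge0.
have kn : n%:R * k = h.
  by rewrite /k mulrCA mulfV ?mulr1// pnatr_eq0.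
have tel : F (z + h) - F z - n%:R * (F (z + k) - F z) =
    \sum_(j < n) (F (z + j%:R * k + k) - F (z + j%:R * k) - (F (z + k) - F z)).
  rewrite sumrB sumr_const card_ord mulr_natl; congr (_ - _).
  pose u (j : nat) := F (z + j%:R * k).
  rewrite -[LHS](_ : u n - u 0%N = _); last by rewrite /u mul0r addr0 kn.
  rewrite -(telescope_sumr _ (leq0n n)) big_mkord; apply: eq_bigr => j _.
  by rewrite /u -natr1 mulrDl mul1r addrA.
have part1 : nm (F (z + h) - F z - n%:R * (F (z + k) - F z)) <= K * nm h ^+ 2.
  rewrite tel (le_trans (nm_sum _ _ _))//.
  have -> : K * nm h ^+ 2 = \sum_(j < n) (K * nm h ^+ 2 / n%:R).
    by rewrite sumr_const card_ord -[RHS]mulr_natr divfK// gt_eqF.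
  apply: ler_sum => j _.
  have jk : nm (j%:R * k) <= nm h.
    rewrite nmM -(rmorph_nat (real_complex R)) nm_real ger0_norm// nk mulrA mulrAC.
    by rewrite ler_piMl ?nm_ge0// ler_pdivrMr// mul1r ler_nat ltnW.
  rewrite (le_trans (exp_type_second_difference _ (le_trans k1 h1) (le_trans jk h1)))//.
  rewrite -/K nk.
  have := ler_wpM2l (mulr_ge0 K0 (divr_ge0 (nm_ge0 h) (ltW n0))) jk.
  by move=> /le_trans; apply; rewrite le_eqVlt; apply/orP; left; apply/eqP; ring.
have part2 : nm (n%:R * (F (z + k) - F z) - l * h) <= e.
  rewrite -{1}kn mulrCA -mulrBr nmM -(rmorph_nat (real_complex R)) nm_real ger0_norm ?(ltW n0)//.
  have := Hd k; rewrite nk => /(_ nd) h2.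
  rewrite (le_trans (ler_wpM2l (ltW n0) h2))//.
  rewrite (_ : _ * _ = e * (nm h / (nm h + 1))).
    by rewrite ger_pMr// ler_pdivrMr// mul1r lerDl.
  by field; rewrite !gt_eqF.
rewrite (_ : _ - _ - _ = (F (z + h) - F z - n%:R * (F (z + k) - F z)) + (n%:R * (F (z + k) - F z) - l * h)); last by ring.
by rewrite (le_trans (nmD _ _))// lerD.
Qed.

Lemma nm_derivative_le z l : cderiv F z l ->
  nm l <= 6 * (m * expR (s * (`|Im z| + 2))).
Proof.
move=> dl; have n1 : nm (1 : C) <= 1 by rewrite Normc.normc1.
have := exp_type_taylor dl n1; rewrite Normc.normc1 expr1n !mulr1 => t1.
have := exp_type_lipschitz z n1; rewrite Normc.normc1 mulr1 => t2.
have t3 : m * expR (s * (`|Im z| + 1)) <= m * expR (s * (`|Im z| + 2)).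
  by rewrite ler_wpM2l// ler_expR ler_wpM2l//; lra.
have := nmB (F (z + 1) - F z) (F (z + 1) - F z - l).
rewrite (_ : _ - (_ - l) = l); last by ring.
lra.
Qed.

End Bounds.

(** In place of a normal family argument: the remainder bound of [exp_type_taylor] is uniform in n,
    so it passes to the pointwise limit and there expresses differentiability, with the limit of the
    derivatives as derivative. *)
Lemma exp_type_limit (U : set_system nat) (UF : UltraFilter U) s m (F : nat -> C -> C) :
  0 <= s -> (forall n, exp_type s (F n)) -> (forall n (x : R), nm (F n x%:C%C) <= m) ->
  exists G, [/\ exp_type s G, forall z, ulims U (fun n => F n z) (G z) &
    forall z (D : nat -> C), (forall n, cderiv (F n) z (D n)) ->
      exists l, ulims U D l /\ cderiv G z l].
Proof.
move=> s0 tF Fm.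
have bnd n z := exp_type_le (tF n) (Fm n) z.
have /choice[G HG] : forall z, exists l, ulims U (fun n => F n z) l.
  by move=> z; apply: (ulims_exists (K := m * expR (s * `|Im z|))).
suff H z (D : nat -> C) : (forall n, cderiv (F n) z (D n)) ->
    exists l, ulims U D l /\ cderiv G z l.
  exists G; split => //; split; last by exists m => z; apply: (ulims_leT (HG z)).
  move=> z; have /choice[D /H[l [_ dl]]] : forall n, exists l, cderiv (F n) z l.
    by move=> n; case: (tF n) => + _; apply.
  by exists l.
move=> HD; pose K := m * expR (s * (`|Im z| + 2)).
have K0 : 0 <= K by rewrite mulr_ge0 ?expR_ge0// (le_trans (nm_ge0 _) (Fm 0%N 0)).
have [l Hl] : exists l, ulims U D l.
  apply: (ulims_exists (K := 6 * K)) => n.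
  exact: (nm_derivative_le s0 (tF n) (Fm n) (HD n)).
have ineq h : nm h <= 1 -> nm (G (z + h) - G z - l * h) <= 4 * K * nm h ^+ 2.
  move=> h1; have hh : ulims U (fun=> h) h by exact: ulims_cst.
  apply: (ulims_leT (ulimsB (ulimsB (HG (z + h)) (HG z)) (ulimsM Hl hh))) => n.
  exact: (exp_type_taylor s0 (tF n) (Fm n) (HD n)).
exists l; split => // e e0; exists (Num.min 1 (e / (4 * K + 1))).
  by rewrite lt_min ltr01 divr_gt0//; lra.
move=> h; rewrite lt_min => /andP[h1 h2]; rewrite (le_trans (ineq h (ltW h1)))//.
rewrite expr2 mulrA ler_wpM2r ?nm_ge0//.
have K41 : 0 < 4 * K + 1 by lra.
move: h2; rewrite ltr_pdivlMr// => h2.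
have := nm_ge0 h; lra.
Qed.

Lemma exists_free_ultrafilter : exists U : set_system nat,
  UltraFilter U /\ forall N, U [set n | (N <= n)%N].
Proof.
have [U [UF sU]] := @ultraFilterLemma _ (\oo : set_system nat) _.
by exists U; split => // N; apply: sU; exists N.
Qed.

(** The derivative is the limit of difference quotients with steps 1 / (n + 1). These are of type
    [s], and [exp_type_lipschitz_real] bounds them uniformly on the real axis. *)
Lemma exp_type_deriv s m F : 0 <= s -> exp_type s F ->
  (forall x : R, nm (F x%:C%C) <= m) ->
  exists G, [/\ exp_type s G, forall z, cderiv F z (G z) &
    forall x : R, nm (G x%:C%C) <= 2 * expR s * m].
Proof.
move=> s0 tF Fm; have [U [UF Ucof]] := exists_free_ultrafilter.
pose q (n : nat) : R := n.+1%:R^-1.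
have q0 n : 0 < q n by rewrite invr_gt0.
pose Fn (n : nat) z := (q n)^-1%:C%C * (F (z + (q n)%:C%C) - F z).
have tn n : exp_type s (Fn n).
  by apply: exp_typeZ; apply: exp_typeB => //; exact: exp_type_shift.
have bn n (x : R) : nm (Fn n x%:C%C) <= 2 * expR s * m.
  rewrite nmM nm_real ger0_norm ?invr_ge0 ?(ltW (q0 n))// -rmorphD /=.
  rewrite ler_pdivrMl// mulrC.
  have := exp_type_lipschitz_real s0 tF Fm x (q n).
  by rewrite ger0_norm ?(ltW (q0 n)).
have [G [tG HG _]] := exp_type_limit UF s0 tn bn.
have eF : entire F by case: tF.
have dG z : cderiv F z (G z).
  have [l dl] := eF z; suff -> : G z = l by [].
  apply: (ulims_unique (HG z)); apply: ulims_cvg => // e e0.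
  have [d d0 Hd] := dl e e0; exists (Num.truncn d^-1) => n hn.
  have qd : nm ((q n)%:C%C : C) < d.
    rewrite nm_real gtr0_norm// /q -ltf_pV2 ?posrE// invrK.
    by rewrite (lt_le_trans (truncnS_gt _))// ler_nat ltnS.
  have := Hd _ qd; rewrite nm_real gtr0_norm// => h1.
  have -> : Fn n z - l = (q n)^-1%:C%C * (F (z + (q n)%:C%C) - F z - l * (q n)%:C%C).
    rewrite mulrBr; congr (_ - _); rewrite mulrCA -rmorphM /= mulVf ?mulr1// gt_eqF//.
  by rewrite nmM nm_real ger0_norm ?invr_ge0 ?(ltW (q0 n))// ler_pdivrMl// [leRHS]mulrC.
exists G; split => // x; exact: (ulims_leT (HG _)).
Qed.

End ExponentialType.

Section SupNorm.
Context {R : realType}.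
Implicit Types (g h : R * R -> R[i]).

Lemma le_sup_norm g m x : (forall y, nm (g y) <= m) -> nm (g x) <= sup_norm g.
Proof.
move=> gm; apply: ub_le_sup; last by exists x.
by exists m => _ [y _ <-]; exact: gm.
Qed.

Lemma sup_norm_le g m : (forall y, nm (g y) <= m) -> sup_norm g <= m.
Proof.
move=> gm; apply: ge_sup; first by exists (nm (g 0)), 0.
by move=> _ [y _ <-]; exact: gm.
Qed.

Lemma sup_norm_near g m r : (forall y, nm (g y) <= m) -> r < sup_norm g ->
  exists x, r < nm (g x).
Proof.
move=> gm h; have hs : has_sup [set nm (g x) | x in [set: R * R]].
  split; first by exists (nm (g 0)), 0.
  by exists m => _ [y _ <-]; exact: gm.
have e0 : 0 < sup_norm g - r by rewrite subr_gt0.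
have [_ [x _ <-]] := sup_adherent e0 hs.
by rewrite -/(sup_norm g) opprB addrC subrK => hx; exists x.
Qed.

End SupNorm.

(** * Restrictions to the real axis and their derivatives *)

Section Lines.
Context {R : realType}.
Local Notation C := (R[i]).
Implicit Types (F G : C -> C) (f g h : R -> C).
Variable s : R.
Hypothesis s0 : 0 <= s.

Definition on_line f := exists F, exp_type s F /\ forall x, f x = F x%:C%C.

(** The derivative is witnessed by entire extensions of both functions, so that the relation records
    the exponential type and is closed under bounded pointwise limits. *)
Definition lder f g := exists F G, [/\ exp_type s F, exp_type s G,
  forall z, cderiv F z (G z), forall x, f x = F x%:C%C & forall x, g x = G x%:C%C].

Definition bernstein_const : R := 2 * expR s.

Lemma cderiv_real_unique F G (x : R) l m : cderiv F x%:C%C l -> cderiv G x%:C%C m ->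
  (forall x : R, F x%:C%C = G x%:C%C) -> l = m.
Proof.
move=> dF dG FG; apply/eqP; rewrite -subr_eq0; apply/eqP/nm0_eq0/eqP.
rewrite eq_le nm_ge0 andbT; apply/ler_addgt0Pr => e e0; rewrite add0r.
have e2 : 0 < e / 2 by rewrite divr_gt0.
have [d d0 Hd] := dF _ e2; have [d' d'0 Hd'] := dG _ e2.
pose r := Num.min d d' / 2; have r0 : 0 < r by rewrite divr_gt0// lt_min d0.
have rd : r < Num.min d d' by rewrite /r ltr_pdivrMr// ltr_pMr ?ltr1n// lt_min d0.
have nr : nm (r%:C%C : C) = r by rewrite nm_real gtr0_norm.
have := Hd r%:C%C; rewrite nr (lt_le_trans rd) ?ge_min ?lexx// => /(_ isT) h1.
have := Hd' r%:C%C; rewrite nr (lt_le_trans rd) ?ge_min ?lexx ?orbT// => /(_ isT) h2.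
rewrite -rmorphD /= !FG in h1; rewrite -rmorphD /= in h2.
rewrite -(ler_pM2r r0) -{1}nr -nmM.
rewrite (_ : (l - m) * _ = (G (x + r)%:C%C - G x%:C%C - m * r%:C%C) - (G (x + r)%:C%C - G x%:C%C - l * r%:C%C)); last ring.
by rewrite (le_trans (nmB _ _))// (le_trans (lerD h2 h1))// -mulrDl -splitr.
Qed.

Lemma on_lineD f g : on_line f -> on_line g -> on_line (fun x => f x + g x).
Proof.
move=> [F [tF fF]] [G [tG gG]]; exists (fun z => F z + G z); split.
  exact: exp_typeD.
by move=> x; rewrite fF gG.
Qed.

Lemma on_lineZ c f : on_line f -> on_line (fun x => c * f x).
Proof.
move=> [F [tF fF]]; exists (fun z => c * F z); split; first exact: exp_typeZ.
by move=> x; rewrite fF.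
Qed.

Lemma on_line_shift t f : on_line f -> on_line (fun x => f (x + t)).
Proof.
move=> [F [tF fF]]; exists (fun z => F (z + t%:C%C)); split; first exact: exp_type_shift.
by move=> x; rewrite fF rmorphD.
Qed.

Lemma on_line_lipschitz f m (x t : R) : on_line f -> (forall x, nm (f x) <= m) ->
  nm (f (x + t) - f x) <= bernstein_const * m * `|t|.
Proof.
move=> [F [tF fF]] fm; rewrite !fF; apply: exp_type_lipschitz_real => // y.
by rewrite -fF.
Qed.

Lemma on_line_deriv f m : on_line f -> (forall x, nm (f x) <= m) ->
  exists g, [/\ lder f g, on_line g & forall x, nm (g x) <= bernstein_const * m].
Proof.
move=> [F [tF fF]] fm; have Fm (x : R) : nm (F x%:C%C) <= m by rewrite -fF.
have [G [tG dG Gm]] := exp_type_deriv s0 tF Fm.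
by exists (fun x => G x%:C%C); split => //; [exists F, G|exists G].
Qed.

Lemma lder_line f g : lder f g -> on_line f /\ on_line g.
Proof. by move=> [F [G [tF tG _ fF gG]]]; split; [exists F|exists G]. Qed.

Lemma lder_unique f g h : lder f g -> lder f h -> forall x, g x = h x.
Proof.
move=> [F [G [_ _ dF fF gG]]] [F' [G' [_ _ dF' fF' gG']]] x; rewrite gG gG'.
by apply: cderiv_real_unique (dF _) (dF' _) _ => y; rewrite -fF -fF'.
Qed.

Lemma lder_bound f g m : lder f g -> (forall x, nm (f x) <= m) ->
  forall x, nm (g x) <= bernstein_const * m.
Proof.
move=> dfg fm; have [lf _] := lder_line dfg.
by have [h [dfh _ hm]] := on_line_deriv lf fm => x; rewrite (lder_unique dfg dfh).
Qed.

Lemma lderD f g f' g' : lder f f' -> lder g g' ->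
  lder (fun x => f x + g x) (fun x => f' x + g' x).
Proof.
move=> [F [F' [tF tF' dF fF fF']]] [G [G' [tG tG' dG gG gG']]].
exists (fun z => F z + G z), (fun z => F' z + G' z); split.
- exact: exp_typeD.
- exact: exp_typeD.
- by move=> z; exact: cderivD.
- by move=> x; rewrite fF gG.
- by move=> x; rewrite fF' gG'.
Qed.

Lemma lderZ c f f' : lder f f' -> lder (fun x => c * f x) (fun x => c * f' x).
Proof.
move=> [F [F' [tF tF' dF fF fF']]].
exists (fun z => c * F z), (fun z => c * F' z); split.
- exact: exp_typeZ.
- exact: exp_typeZ.
- move=> z; apply: cderiv_eq (cderivM (cderiv_cst c z) (dF z)) => //.
  by rewrite mul0r add0r.
- by move=> x; rewrite fF.
- by move=> x; rewrite fF'.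
Qed.

Lemma lder_shift t f f' : lder f f' -> lder (fun x => f (x + t)) (fun x => f' (x + t)).
Proof.
move=> [F [F' [tF tF' dF fF fF']]].
exists (fun z => F (z + t%:C%C)), (fun z => F' (z + t%:C%C)); split.
- exact: exp_type_shift.
- exact: exp_type_shift.
- move=> z.
  have d1 : cderiv (fun w => w + t%:C%C) z 1.
    apply: cderiv_eq (cderivD (cderiv_id z) (cderiv_cst t%:C%C z)) => //.
    by rewrite addr0.
  by apply: cderiv_eq (cderiv_comp d1 (dF _)) => //; rewrite mulr1.
- by move=> x; rewrite fF rmorphD.
- by move=> x; rewrite fF' rmorphD.
Qed.

Lemma lder_eq f f' g g' : (forall x, f x = g x) -> (forall x, f' x = g' x) ->
  lder f f' -> lder g g'.
Proof. by move=> /funext -> /funext ->. Qed.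

(** Differentiation reverses the sign between the two reflected terms, and [lder_reflectionN]
    reverses it back: the original relation returns after two derivatives. *)
Lemma lder_reflection f f' (a : R) : lder f f' ->
  (forall t, f (a + t) + f (a - t) = 0) -> forall t, f' (a + t) - f' (a - t) = 0.
Proof.
move=> [F [F' [tF tF' dF fF fF']]] H t.
have dl : cderiv (fun w => a%:C%C + w) t%:C%C 1.
  by apply: cderiv_eq (cderiv_affine a%:C%C 1 _) => // w; rewrite mul1r.
have dr : cderiv (fun w => a%:C%C - w) t%:C%C (-1).
  by apply: cderiv_eq (cderiv_affine a%:C%C (-1) _) => // w; rewrite mulN1r.
have d1 := cderivD (cderiv_comp dl (dF _)) (cderiv_comp dr (dF _)).
have := cderiv_real_unique d1 (cderiv_cst 0 _).
rewrite mulr1 mulrN1 -rmorphD -rmorphB /= -!fF'; apply => x.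
by rewrite -rmorphD -rmorphB /= -!fF H.
Qed.

Lemma lder_reflectionN f f' (a : R) : lder f f' ->
  (forall t, f (a + t) - f (a - t) = 0) -> forall t, f' (a + t) + f' (a - t) = 0.
Proof.
move=> [F [F' [tF tF' dF fF fF']]] H t.
have dl : cderiv (fun w => a%:C%C + w) t%:C%C 1.
  by apply: cderiv_eq (cderiv_affine a%:C%C 1 _) => // w; rewrite mul1r.
have dr : cderiv (fun w => a%:C%C - w) t%:C%C (-1).
  by apply: cderiv_eq (cderiv_affine a%:C%C (-1) _) => // w; rewrite mulN1r.
have d1 := cderivD (cderiv_comp dl (dF _))
  (cderivM (cderiv_cst (-1) _) (cderiv_comp dr (dF _))).
have := cderiv_real_unique d1 (cderiv_cst 0 _).
rewrite mulr1 mul0r add0r mulrN1 mulN1r opprK -rmorphD -rmorphB /= -!fF'; apply => x.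
by rewrite mulN1r -rmorphD -rmorphB /= -!fF H.
Qed.

Context (U : set_system nat) {UF : UltraFilter U}.

Lemma on_line_limit (f : nat -> R -> C) g m : (forall n, on_line (f n)) ->
  (forall n x, nm (f n x) <= m) -> (forall x, ulims U (fun n => f n x) (g x)) ->
  on_line g.
Proof.
move=> /choice[F HF] fm fg.
have [G [tG HG _]] := exp_type_limit UF s0 (fun n => proj1 (HF n))
  (fun n (x : R) => eq_rect _ (fun u => nm u <= m) (fm n x) _ (proj2 (HF n) x)).
exists G; split => // x; apply: (ulims_unique (fg x)).
by rewrite (_ : (fun n => f n x) = fun n => F n x%:C%C)//; apply/funext => n; case: (HF n).
Qed.

Lemma lder_limit (f f' : nat -> R -> C) g g' m : (forall n, lder (f n) (f' n)) ->
  (forall n x, nm (f n x) <= m) -> (forall x, ulims U (fun n => f n x) (g x)) ->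
  (forall x, ulims U (fun n => f' n x) (g' x)) -> lder g g'.
Proof.
move=> dff fm fg fg'.
have fm' n x : nm (f' n x) <= bernstein_const * m by apply: lder_bound (dff n) (fm n) x.
have /choice[F /choice[F' HF]] := dff.
have Fm n (x : R) : nm (F n x%:C%C) <= m by case: (HF n) => _ _ _ <- _.
have Fm' n (x : R) : nm (F' n x%:C%C) <= bernstein_const * m by case: (HF n) => _ _ _ _ <-.
have tF n : exp_type s (F n) by case: (HF n).
have tF' n : exp_type s (F' n) by case: (HF n).
have dF n z : cderiv (F n) z (F' n z) by case: (HF n).
have [G [tG HG dG]] := exp_type_limit UF s0 tF Fm.
have [G' [tG' HG' _]] := exp_type_limit UF s0 tF' Fm'.
exists G, G'; split => //.
- move=> z; have [l [hl dl]] := dG z (fun n => F' n z) (fun n => dF n z).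
  by rewrite (ulims_unique (HG' z) hl).
- move=> x; apply: (ulims_unique (fg x)).
  by rewrite (_ : (fun n => f n x) = fun n => F n x%:C%C)//; apply/funext => n; case: (HF n).
- move=> x; apply: (ulims_unique (fg' x)).
  by rewrite (_ : (fun n => f' n x) = fun n => F' n x%:C%C)//; apply/funext => n; case: (HF n).
Qed.

End Lines.

(** * Bounded functions of exponential type on the plane *)

Section Planar.
Context {R : realType}.
Local Notation C := (R[i]).
Implicit Types (g h : R * R -> C).
Variable s : R.
Hypothesis s0 : 0 <= s.
Local Notation B := (bernstein_const s).
Local Notation lder := (lder s).
Local Notation on_line := (on_line s).

Lemma bernstein_const_gt0 : 0 < B.
Proof. by rewrite mulr_gt0// expR_gt0. Qed.

Definition swap_args g : R * R -> C := fun p => g (p.2, p.1).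

(** Every line parallel to an axis carries its own one-variable entire extension, so that the
    one-variable estimates apply row by row and column by column. *)
Definition planar g := [/\ exists m, forall x, nm (g x) <= m,
  forall y, on_line (fun x => g (x, y)) & forall x, on_line (fun y => g (x, y))].

Definition dx g h := forall y, lder (fun x => g (x, y)) (fun x => h (x, y)).

Lemma planarD g h : planar g -> planar h -> planar (fun p => g p + h p).
Proof.
move=> [[m gm] gx gy] [[k hk] hx hy]; split.
- by exists (m + k) => p; rewrite (le_trans (nmD _ _))// lerD.
- by move=> y; exact: on_lineD.
- by move=> x; exact: on_lineD.
Qed.

Lemma planarZ c g : planar g -> planar (fun p => c * g p).
Proof.
move=> [[m gm] gx gy]; split.
- by exists (nm c * m) => p; rewrite nmM ler_wpM2l ?nm_ge0.
- by move=> y; exact: on_lineZ.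
- by move=> x; exact: on_lineZ.
Qed.

Lemma planar_shift v g : planar g -> planar (fun p => g (p + v)).
Proof.
move=> [[m gm] gx gy]; split; first by exists m.
- by move=> y; exact: (on_line_shift v.1 (gx (y + v.2))).
- by move=> x; exact: (on_line_shift v.2 (gy (x + v.1))).
Qed.

Lemma planar_swap g : planar g -> planar (swap_args g).
Proof. by move=> [[m gm] gx gy]; split => //; exists m => p; exact: gm. Qed.

Lemma planar_lipschitz g m p v : planar g -> (forall x, nm (g x) <= m) ->
  nm (g (p + v) - g p) <= B * m * (`|v.1| + `|v.2|).
Proof.
case: p v => [p1 p2] [v1 v2] [_ gx gy] gm /=.
rewrite (_ : _ - _ = (g (p1 + v1, p2 + v2) - g (p1, p2 + v2)) +
  (g (p1, p2 + v2) - g (p1, p2))); last by rewrite addrA subrK.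
rewrite (le_trans (nmD _ _))// mulrDr lerD//.
  exact: (@on_line_lipschitz _ _ s0 (fun x => g (x, p2 + v2))).
exact: (@on_line_lipschitz _ _ s0 (fun y => g (p1, y))).
Qed.

Lemma dxD g h g' h' : dx g g' -> dx h h' -> dx (fun p => g p + h p) (fun p => g' p + h' p).
Proof. by move=> dg dh y; exact: lderD (dg y) (dh y). Qed.

Lemma dxZ c g g' : dx g g' -> dx (fun p => c * g p) (fun p => c * g' p).
Proof. by move=> dg y; refine (lderZ c (dg y)). Qed.

Lemma dx_shift v g g' : dx g g' -> dx (fun p => g (p + v)) (fun p => g' (p + v)).
Proof. by move=> dg y; refine (lder_shift v.1 (dg (y + v.2))). Qed.

Lemma dx_unique g h h' : dx g h -> dx g h' -> h = h'.
Proof. by move=> d1 d2; apply/funext => -[x y]; exact: lder_unique (d1 y) (d2 y) x. Qed.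

Lemma dx_bound g g' m : dx g g' -> (forall p, nm (g p) <= m) ->
  forall p, nm (g' p) <= B * m.
Proof. by move=> dg gm [x y]; exact: (lder_bound s0 (dg y) (fun x => gm (x, y)) x). Qed.

Let q (n : nat) : R := n.+1%:R^-1.

Let lder_quotient (U : set_system nat) {UF : UltraFilter U}
    (Ucof : forall N, U [set n | (N <= n)%N]) f f' x : lder f f' ->
  ulims U (fun n => (q n)^-1%:C%C * (f (x + q n) - f x)) (f' x).
Proof.
move=> [F [F' [_ _ dF fF fF']]]; apply: ulims_cvg => // e e0.
have q0 n : 0 < q n by rewrite invr_gt0.
have [d d0 Hd] := dF x%:C%C e e0; exists (Num.truncn d^-1) => n hn.
have qd : nm ((q n)%:C%C : C) < d.
  rewrite nm_real gtr0_norm// /q -ltf_pV2 ?posrE// invrK.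
  by rewrite (lt_le_trans (truncnS_gt _))// ler_nat ltnS.
have := Hd _ qd; rewrite nm_real gtr0_norm// -rmorphD /= -!fF -fF' => h1.
have -> : (q n)^-1%:C%C * (f (x + q n) - f x) - f' x =
    (q n)^-1%:C%C * (f (x + q n) - f x - f' x * (q n)%:C%C).
  by rewrite [RHS]mulrBr; congr (_ - _); rewrite mulrCA -rmorphM /= mulVf ?mulr1// gt_eqF.
by rewrite nmM nm_real ger0_norm ?invr_ge0 ?(ltW (q0 n))// ler_pdivrMl// [leRHS]mulrC.
Qed.

Let quotient_bound f m (n : nat) x : on_line f -> (forall x, nm (f x) <= m) ->
  nm ((q n)^-1%:C%C * (f (x + q n) - f x)) <= B * m.
Proof.
have q0 : 0 < q n by rewrite invr_gt0.
move=> lf fm; rewrite nmM nm_real ger0_norm ?invr_ge0 ?(ltW q0)//.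
rewrite ler_pdivrMl// [leRHS]mulrC.
by have := on_line_lipschitz s0 x (q n) lf fm; rewrite gtr0_norm.
Qed.

Lemma dx_exists g : planar g -> exists2 h, planar h & dx g h.
Proof.
move=> [[m gm] gx gy].
have /choice[k Hk] y := on_line_deriv s0 (gx y) (fun x => gm (x, y)).
pose h (p : R * R) := k p.2 p.1.
have dgh : dx g h by move=> y; case: (Hk y).
have hm p : nm (h p) <= B * m by have [_ _] := Hk p.2; exact.
exists h => //; split; [by exists (B * m)|by move=> y; case: (Hk y)|move=> x].
(* Along a column, [h] is the limit of difference quotients in the first variable, each of which is
   a combination of two columns of [g]. *)
have [U [UF Ucof]] := exists_free_ultrafilter.
apply: (@on_line_limit _ _ s0 U UF
  (fun n y => (q n)^-1%:C%C * (g (x + q n, y) - g (x, y))) _ (B * m)).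
- move=> n; apply: on_lineZ.
  have := on_lineD (gy (x + q n)) (on_lineZ (-1) (gy x)).
  by rewrite (_ : (fun y => _) = fun y => g (x + q n, y) - g (x, y))//; apply/funext => y; rewrite mulN1r.
- by move=> n y; exact: quotient_bound (gx y) (fun x => gm (x, y)).
- by move=> y; exact: lder_quotient (dgh y).
Qed.

(** Symmetry of mixed derivatives. The difference quotients in y of [g] have those of [g'] as
    x-derivatives, and [lder_limit] carries this relation to the limits [h] and [h']. *)
Lemma dx_mixed g g' h h' : planar g -> dx g g' ->
  dx (swap_args g) (swap_args h) -> dx (swap_args g') (swap_args h') -> dx h h'.
Proof.
move=> [[m gm] gx gy] dg dh dh' y.
have [U [UF Ucof]] := exists_free_ultrafilter.
apply: (@lder_limit _ _ s0 U UF
  (fun n x => (q n)^-1%:C%C * (g (x, y + q n) - g (x, y)))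
  (fun n x => (q n)^-1%:C%C * (g' (x, y + q n) - g' (x, y))) _ _ (B * m)).
- move=> n; apply: lderZ; have := lderD (dg (y + q n)) (lderZ (-1) (dg y)).
  by apply: lder_eq => x; rewrite mulN1r.
- by move=> n x; exact: quotient_bound (gy x) (fun y => gm (x, y)).
- by move=> x; exact: lder_quotient (dh x).
- by move=> x; exact: lder_quotient (dh' x).
Qed.

Context (U : set_system nat) {UF : UltraFilter U}.

Lemma planar_limit (f : nat -> R * R -> C) g m : (forall n, planar (f n)) ->
  (forall n p, nm (f n p) <= m) -> (forall p, ulims U (fun n => f n p) (g p)) ->
  planar g.
Proof.
move=> pf fm fg; split.
- by exists m => p; apply: (ulims_leT (fg p)).
- move=> y; apply: (@on_line_limit _ _ s0 U UF (fun n x => f n (x, y)) _ m) => //.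
  by move=> n; case: (pf n).
- move=> x; apply: (@on_line_limit _ _ s0 U UF (fun n y => f n (x, y)) _ m) => //.
  by move=> n; case: (pf n).
Qed.

Lemma dx_limit (f f' : nat -> R * R -> C) g g' m : (forall n, dx (f n) (f' n)) ->
  (forall n p, nm (f n p) <= m) -> (forall p, ulims U (fun n => f n p) (g p)) ->
  (forall p, ulims U (fun n => f' n p) (g' p)) -> dx g g'.
Proof.
move=> df fm fg fg' y.
apply: (@lder_limit _ _ s0 U UF (fun n x => f n (x, y)) (fun n x => f' n (x, y)) _ _ m) => //.
by move=> n; exact: df.
Qed.

End Planar.

(** * Passage to an eigenfunction of a second derivative *)

Section SpectralStep.
Context {R : realType} (s : R) (T : Type).
Local Notation C := (R[i]).
Local Notation planar := (planar s).
Local Notation dx := (dx s).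
Local Notation B := (bernstein_const s).
Hypothesis s0 : 0 <= s.
Context (U : set_system nat) {UF : UltraFilter U}.
Hypothesis Ucof : forall N, U [set n | (N <= n)%N].
Variable Q : (R * R -> C) -> T -> Prop.
Hypothesis Q_planar : forall g M, Q g M -> planar g.
Hypothesis Q_lin : forall c g h M, Q g M -> Q h M -> Q (fun p => g p + c * h p) M.
Hypothesis Q_dxx : forall g g' g'' M, Q g M -> dx g g' -> planar g' -> dx g' g'' ->
  planar g'' -> Q g'' M.
Hypothesis Q_shift : forall v g M, Q g M -> exists M', Q (fun p => g (p + v)) M'.
Hypothesis Q_lim : forall (f : nat -> R * R -> C) (M : nat -> T) g,
  (forall n, Q (f n) (M n)) -> (forall n p, nm (f n p) <= 1) ->
  (forall p, ulims U (fun n => f n p) (g p)) -> exists M', Q g M'.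

(** [Q] is left abstract so that the step serves twice: for d1^2, and, with the arguments exchanged,
    for d2^2 on functions that are already eigenfunctions in the other variable. [M] follows the
    translations and limits through which the function passes. *)
Lemma spectral_step g M p0 : Q g M -> g p0 != 0 ->
  exists z h h' M', [/\ Q h M', h 0 != 0, dx h h' & dx h' (fun p => z * h p)].
Proof.
move=> Qg gp0.
have nxt (u : R * R -> C) : exists v : (R * R -> C) * (R * R -> C),
    Q u M -> [/\ planar v.1, dx u v.1, dx v.1 v.2 & Q v.2 M].
  have [Qu|nQ] := pselect (Q u M); last by exists (u, u).
  have [v pv uv] := dx_exists s0 (Q_planar Qu); have [w pw vw] := dx_exists s0 pv.
  by exists (v, w) => _; split => //; exact: Q_dxx Qu uv pv vw pw.
have /choice[st Hst] := nxt.
(* [st] returns the first and second x-derivatives, so [h k] is the k-th power of d1^2 applied to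
   [g]. *)
pose h := fix h n := if n is k.+1 then (st (h k)).2 else g.
have Qh n : Q (h n) M by elim: n => [//|n IH]; case: (Hst _ IH).
have dh n : [/\ planar (st (h n)).1, dx (h n) (st (h n)).1, dx (st (h n)).1 (h n.+1) & Q (h n.+1) M].
  exact: Hst.
(* This is p(d1^2) g. Multiplication of p by ['X] becomes d1^2, which has norm at most B^2 by
   Bernstein's inequality, as [approximate_eigenvalue] requires. *)
pose act (p : {poly C}) (x : R * R) := \sum_(k < size p) p`_k * h k x.
have actw (p : {poly C}) n (x : R * R) : (size p <= n)%N -> act p x = \sum_(k < n) p`_k * h k x.
  move=> hn; rewrite /act (big_ord_widen n (fun k => p`_k * h k x) hn) big_mkcond.
  apply: eq_bigr => k _; case: ltnP => // hk; by rewrite nth_default// mul0r.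
have actD (p r : {poly C}) (x : R * R) : act (p + r) x = act p x + act r x.
  pose n := maxn (size p) (size r).
  rewrite (actw _ n _ (size_polyD _ _)) (actw p n) ?leq_maxl// (actw r n) ?leq_maxr//.
  by rewrite -big_split; apply: eq_bigr => k _; rewrite coefD mulrDl.
have actZ (c : C) (p : {poly C}) (x : R * R) : act (c *: p) x = c * act p x.
  rewrite (actw _ (size p)) ?size_scale_leq// /act mulr_sumr.
  by apply: eq_bigr => k _; rewrite coefZ mulrA.
have actX (p : {poly C}) (x : R * R) : act ('X * p) x = \sum_(k < size p) p`_k * h k.+1 x.
  rewrite (actw _ (size p).+1); last first.
    by rewrite (leq_trans (size_polyMleq _ _))// size_polyX.
  rewrite big_ord_recl coefXM eqxx mul0r add0r.
  by apply: eq_bigr => k _; rewrite coefXM /=.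
have Q0 : Q (fun=> 0) M.
  have := Q_lin (-1) Qg Qg; congr Q; apply/funext => x; by rewrite mulN1r subrr.
have Qsum n (c : nat -> C) (u : nat -> R * R -> C) : (forall k, Q (u k) M) ->
    Q (fun x => \sum_(k < n) c k * u k x) M.
  move=> Qu; elim: n => [|n IH].
    by rewrite (_ : (fun x => _) = fun=> 0)//; apply/funext => x; rewrite big_ord0.
  have := Q_lin (c n) IH (Qu n); congr Q.
  by apply/funext => x; rewrite big_ord_recr.
have Qact (p : {poly C}) : Q (act p) M by exact: (Qsum _ (fun k => p`_k)).
have dact (p : {poly C}) : exists2 v, dx (act p) v & dx v (act ('X * p)).
  exists (fun x => \sum_(k < size p) p`_k * (st (h k)).1 x).
    rewrite /act; elim: (size p) => [|n IH].
      have := dxZ 0 (and4_rec (fun _ d _ _ => d) (dh 0%N)).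
      by congr dx; apply/funext => x; rewrite big_ord0 mul0r.
    have := dxD IH (dxZ p`_n (and4_rec (fun _ d _ _ => d) (dh n))).
    by congr dx; apply/funext => x; rewrite big_ord_recr.
  rewrite (_ : act ('X * p) = fun x => \sum_(k < size p) p`_k * h k.+1 x); last first.
    by apply/funext => x; rewrite actX.
  elim: (size p) => [|n IH].
    have := dxZ 0 (and4_rec (fun _ _ d _ => d) (dh 0%N)).
    by congr dx; apply/funext => x; rewrite big_ord0 mul0r.
  have := dxD IH (dxZ p`_n (and4_rec (fun _ _ d _ => d) (dh n))).
  by congr dx; apply/funext => x; rewrite big_ord_recr.
have bact (p : {poly C}) : exists m, forall x, nm (act p x) <= m by case: (Q_planar (Qact p)).
have act_le (p : {poly C}) (x : R * R) : nm (act p x) <= sup_norm (act p).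
  by have [m hm] := bact p; exact: le_sup_norm hm.
pose N (p : {poly C}) := sup_norm (act p).
have ND p r : N (p + r) <= N p + N r.
  by apply: sup_norm_le => x; rewrite actD (le_trans (nmD _ _))// lerD.
have NZ_le c p : N (c *: p) <= nm c * N p.
  by apply: sup_norm_le => x; rewrite actZ nmM ler_wpM2l// nm_ge0.
have N_ge0 p : 0 <= N p by rewrite (le_trans (nm_ge0 _) (act_le p 0)).
have NZ c p : N (c *: p) = nm c * N p.
  apply/eqP; rewrite eq_le NZ_le /=; have [->|c0] := eqVneq c 0.
    by rewrite Normc.normc0 mul0r.
  have := NZ_le c^-1 (c *: p); rewrite scalerA mulVf// scale1r Normc.normcV.
  by rewrite ler_pdivlMl ?nm_gt0.
have NX p : N ('X * p) <= B ^+ 2 * N p.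
  apply: sup_norm_le => x; have [v d1 d2] := dact p.
  by rewrite expr2 -mulrA; apply: (dx_bound s0 d2); apply: (dx_bound s0 d1).
have N1 : 0 < N 1.
  have e1 (x : R * R) : act 1 x = g x.
    by rewrite /act size_poly1 big_ord1 coefC eqxx mul1r.
  by rewrite (lt_le_trans _ (act_le 1 p0))// e1 nm_gt0.
(* An approximate eigenvector is divided by its sup norm, and a point where it exceeds half of that
   norm is moved to the origin. The value at 0 then stays at least 1/2 in modulus, so the limit does
   not vanish. *)
have seq n : exists zk : C * (R * R -> C) * (R * R -> C) * (R * R -> C) * T,
    let: (z, f, f', f'', M') := zk in
    [/\ nm z <= B ^+ 2 + 1, (forall p, nm (f p) <= 1) /\ 1 / 2 <= nm (f 0),
      dx f f' /\ dx f' f'', Q f M' & forall p, nm (f'' p - z * f p) <= n.+1%:R^-1].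
  have e0 : 0 < n.+1%:R^-1 :> R by rewrite invr_gt0.
  have [z [p [z1 Np hz]]] := approximate_eigenvalue ND NZ NX N1 e0.
  have hN : N p / 2 < N p by rewrite ltr_pdivrMr// ltr_pMr ?ltr1n.
  have [m hm] := bact p; have [v hv] := sup_norm_near hm hN.
  have [f' d1 d2] := dact p; have [M' QM'] := Q_shift v (Qact p).
  pose c : C := (N p)^-1%:C%C.
  have c0 : nm c = (N p)^-1 by rewrite nm_real ger0_norm// invr_ge0.
  have [M'' QM''] : exists M'', Q (fun x => c * act p (x + v)) M''.
    exists M'; have := Q_lin (c - 1) QM' QM'; congr Q; apply/funext => x; ring.
  exists (z, (fun x => c * act p (x + v)), (fun x => c * f' (x + v)),
    (fun x => c * act ('X * p) (x + v)), M'') => /=; split => //.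
  - split=> [x|]; rewrite nmM c0; first by rewrite ler_pdivrMl// mulr1 act_le.
    by rewrite ler_pdivlMl// add0r mul1r ltW.
  - by split; apply: dxZ; apply: dx_shift.
  - move=> x; rewrite mulrCA -mulrBr nmM c0 ler_pdivrMl// [leRHS]mulrC.
    apply: le_trans hz; rewrite (le_trans _ (act_le _ (x + v)))//.
    have -> : ('X - z%:P) * p = 'X * p + (- z) *: p by rewrite mulrBl mul_polyC scaleNr.
    by rewrite actD actZ mulNr.
have /choice[S HS] := seq.
pose z n := (S n).1.1.1.1; pose f n := (S n).1.1.1.2; pose f' n := (S n).1.1.2.
pose f'' n := (S n).1.2; pose Mn n := (S n).2.
have {}HS n : [/\ nm (z n) <= B ^+ 2 + 1, (forall p, nm (f n p) <= 1) /\ 1 / 2 <= nm (f n 0),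
      dx (f n) (f' n) /\ dx (f' n) (f'' n), Q (f n) (Mn n) & forall p, nm (f'' n p - z n * f n p) <= n.+1%:R^-1].
  by have := HS n; rewrite /z /f /f' /f'' /Mn; case: (S n) => [[[[]]]].
have fb n p : nm (f n p) <= 1 by case: (HS n) => _ [+ _] _ _ _; apply.
have f'b n p : nm (f' n p) <= B * 1.
  by case: (HS n) => _ _ [d1 _] _ _; apply: (dx_bound s0 d1).
have [w hw] : exists w, ulims U z w.
  by apply: (ulims_exists (K := B ^+ 2 + 1)) => n; case: (HS n).
have /choice[u hu] : forall p, exists l, ulims U (fun n => f n p) l.
  by move=> p; apply: (ulims_exists (K := 1)).
have /choice[u' hu'] : forall p, exists l, ulims U (fun n => f' n p) l.
  by move=> p; apply: (ulims_exists (K := B * 1)).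
have [M' QM'] : exists M', Q u M'.
  by apply: (Q_lim (f := f) (M := Mn)) => // n; case: (HS n).
exists w, u, u', M'; split => //.
- apply/eqP => u00.
  have q4 : 0 < 1 / 4 :> R by rewrite divr_gt0.
  have := filter_ex (hu 0 (1 / 4) q4); rewrite u00 => -[n /=]; rewrite subr0.
  by case: (HS n) => _ [_ h2] _ _ _; lra.
- by apply: (dx_limit s0 (UF := UF) (f := f) (f' := f')) => // n; case: (HS n) => _ _ [].
- apply: (dx_limit s0 (UF := UF) (f := f') (f' := f'')) f'b hu' _.
    by move=> n; case: (HS n) => _ _ [].
  move=> p; apply: ulims_near (ulimsM hw (hu p)) _ => e e0.
  apply: filterS (Ucof (Num.truncn e^-1)) => n /= hn.
  have [_ _ _ _ /(_ p) hp] := HS n; rewrite (le_trans hp)//.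
  rewrite -(invrK e) lef_pV2 ?posrE ?invr_gt0// ltW//.
  by rewrite (lt_le_trans (truncnS_gt _))// ler_nat ltnS.
Qed.

End SpectralStep.

(** * Limits of translates *)

Section LocalCloseness.
Context {R : realType}.
Implicit Types (A B D L M : set (R * R)) (r e : R) (x u v : R * R).

Lemma pair_ext u v : u.1 = v.1 -> u.2 = v.2 -> u = v.
Proof. by case: u v => [? ?] [? ?] /= -> ->. Qed.

Definition close_within r e A B := forall u, A u -> `|u.1| < r -> `|u.2| < r ->
  exists v, [/\ B v, `|u.1 - v.1| < e & `|u.2 - v.2| < e].

Definition close r e A B := close_within r e A B /\ close_within r e B A.

Lemma close_within_trans r e A B D : close_within r e A B -> close_within (r + e) e B D ->
  close_within r (e + e) A D.
Proof.
move=> hAB hBD u Au u1 u2; have [v [Bv h1 h2]] := hAB u Au u1 u2.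
have [||w [Dw h3 h4]] := hBD v Bv.
- have := ler_distD u.1 v.1 0; rewrite !subr0 (distrC v.1); lra.
- have := ler_distD u.2 v.2 0; rewrite !subr0 (distrC v.2); lra.
exists w; split => //.
- have := ler_distD v.1 u.1 w.1; lra.
- have := ler_distD v.2 u.2 w.2; lra.
Qed.

Lemma close_withinW r r' e A B : r' <= r -> close_within r e A B -> close_within r' e A B.
Proof. by move=> rr h u Au u1 u2; apply: h => //; apply: lt_le_trans rr. Qed.

Lemma separation_translate L x : separation (translate L x) = separation L.
Proof.
congr ereal_inf; apply/seteqP; split=> d [u [v [Lu Lv uv ->]]].
  case: Lu uv => u' Lu' <-; case: Lv => v' Lv' <- uv.
  exists u', v'; split => //; first by move=> e; apply: uv; rewrite e.
  by congr (_ %:E); congr euclid_norm; rewrite opprB addrA subrK.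
exists (u - x), (v - x); split.
- by exists u.
- by exists v.
- by move=> /(congr1 (fun w => w + x)); rewrite !subrK.
- by congr (_ %:E); congr euclid_norm; rewrite opprB addrA subrK.
Qed.

(* A sequence-free form of [weak_limits]. *)
Definition translation_limit L M := (separation L <= separation M)%E /\
  forall r e, 0 < r -> 0 < e -> exists x, close r e (translate L x) M.

Lemma translation_limit_weak L M : uniformly_discrete L -> translation_limit L M ->
  weak_limits L M.
Proof.
move=> dL [sep H].
have k0 (k : nat) : 0 < k.+1%:R^-1 :> R by rewrite invr_gt0.
have /choice[x Hx] : forall k : nat, exists x, close k.+1%:R k.+1%:R^-1 (translate L x) M.
  by move=> k; apply: H.
exists x; split.
- have [d d0 dle] : exists2 d : R, 0 < d & (d%:E <= separation L)%E.
    move: dL; rewrite /uniformly_discrete; case: (separation L) => [d| |] //.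
      by rewrite lte_fin => d0; exists d.
    by move=> _; exists 1 => //; rewrite leey.
  by exists d => // k; rewrite separation_translate.
- exact: lt_le_trans sep.
- move=> r e r0 e0; exists (maxn (Num.truncn r) (Num.truncn e^-1)) => k.
  rewrite geq_max => /andP[hr he].
  have rk : r <= k.+1%:R by rewrite ltW// (lt_le_trans (truncnS_gt _))// ler_nat ltnS.
  have ke : k.+1%:R^-1 <= e.
    rewrite -(invrK e) lef_pV2 ?posrE ?invr_gt0// ltW//.
    by rewrite (lt_le_trans (truncnS_gt _))// ler_nat ltnS.
  have sub A B : close_within k.+1%:R k.+1%:R^-1 A B ->
      A `&` open_square r `<=` set_add B (open_square e).
    move=> h u [Au [/=]]; rewrite !in_itv/= -!ltr_norml => u1 u2.
    have [v [Bv h1 h2]] := h u Au (lt_le_trans u1 rk) (lt_le_trans u2 rk).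
    exists v => //; exists (u - v); last by rewrite addrC subrK.
    by split; rewrite /= in_itv/= -ltr_norml; [apply: lt_le_trans h1 ke|apply: lt_le_trans h2 ke].
  by case: (Hx k) => h1 h2; split; apply: sub.
Qed.

Lemma translation_limit_translate L x : translation_limit L (translate L x).
Proof.
split; first by rewrite separation_translate.
by move=> r e r0 e0; exists x; split=> u Lu _ _; exists u; rewrite !subrr normr0.
Qed.

Lemma translation_limit_shift L M v : translation_limit L M ->
  translation_limit L (translate M v).
Proof.
move=> [sep H]; split; first by rewrite separation_translate.
move=> r e r0 e0; have [|x [h1 h2]] := H (r + (`|v.1| + `|v.2|)) e _ e0.
  by rewrite ltr_wpDr// addr_ge0.
have aux (a b : R) : `|a - b| < r -> `|a| < r + `|b|.
  by move=> ab; have := ler_normD (a - b) b; rewrite subrK; lra.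
have n1 := normr_ge0 v.1; have n2 := normr_ge0 v.2.
exists (x + v); split=> u [a Aa <-{u}] /=.
  move=> u1 u2; have [|||w [Mw w1 w2]] := h1 (a - x).
  - by exists a.
  - by have := aux (a.1 - x.1) v.1; rewrite -addrA -opprD => /(_ u1) /=; lra.
  - by have := aux (a.2 - x.2) v.2; rewrite -addrA -opprD => /(_ u2) /=; lra.
  exists (w - v); split; first by exists w.
    by move: w1 => /=; congr (`| _ | < _); ring.
  by move: w2 => /=; congr (`| _ | < _); ring.
move=> u1 u2; have [|||w [[b Lb <-{w}] w1 w2]] := h2 a => //.
- by have := aux a.1 v.1 u1; lra.
- by have := aux a.2 v.2 u2; lra.
exists (b - (x + v)); split; first by exists b.
  by move: w1 => /=; congr (`| _ | < _); ring.
by move: w2 => /=; congr (`| _ | < _); ring.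
Qed.

Context (U : set_system nat) {UF : UltraFilter U}.

Definition ultralimit_set (M : nat -> set (R * R)) : set (R * R) :=
  [set u | forall e, 0 < e ->
    U [set n | exists v, [/\ M n v, `|u.1 - v.1| < e & `|u.2 - v.2| < e]]].

(** Compactness of a square along [U]. At indices with no suitable point [u] is 0, so that the whole
    sequence is bounded and has a limit. *)
Lemma ultralimit_point (P : nat -> R * R -> Prop) r :
  U [set n | exists u, [/\ P n u, `|u.1| < r & `|u.2| < r]] ->
  exists (u : nat -> R * R) l, U [set n | P n (u n)] /\
    forall e, 0 < e -> U [set n | `|(u n).1 - l.1| < e /\ `|(u n).2 - l.2| < e].
Proof.
move=> UP.
have /choice[u Hu] : forall n, exists u : R * R,
    (`|u.1| <= `|r| /\ `|u.2| <= `|r|) /\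
    ((exists u, [/\ P n u, `|u.1| < r & `|u.2| < r]) -> P n u).
  move=> n; have [[u [Pu u1 u2]]|nP] := pselect (exists u, [/\ P n u, `|u.1| < r & `|u.2| < r]).
    by exists u; split => //; split; rewrite (le_trans (ltW _) (ler_norm _)).
  by exists 0; rewrite /= normr0; split.
have [l hl] : exists l, ulims U (fun n => ((u n).1 +i* (u n).2)%C) l.
  apply: (ulims_exists (K := `|r| + `|r|)) => n; rewrite (le_trans (nm_le_ReIm _))//=.
  by have [[h1 h2] _] := Hu n; rewrite lerD.
exists u, (Re l, Im l); split; first by apply: filterS UP => n /=; case: (Hu n).
move=> e e0; have e2 : 0 < e / 2 by rewrite divr_gt0.
have ee : e / 2 < e by rewrite ltr_pdivrMr// ltr_pMr// ltr1n.
apply: filterS (hl _ e2) => n /= hn; split.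
  have := Re_le_nm (((u n).1 +i* (u n).2)%C - l); rewrite ReD ReN /=.
  by move=> h; rewrite (le_lt_trans h)// (le_lt_trans hn).
have := Im_le_nm (((u n).1 +i* (u n).2)%C - l); rewrite ImD ImN /=.
by move=> h; rewrite (le_lt_trans h)// (le_lt_trans hn).
Qed.

(** If closeness failed for almost all n, the offending points would converge along [U]. For points
    of [M n] the limit lies in [ultralimit_set], a contradiction. For points of [ultralimit_set],
    one fixed offending point has neighbours in [M n] that are also close to the later ones. *)
Lemma ultralimit_set_close (M : nat -> set (R * R)) r e : 0 < e ->
  U [set n | close r e (M n) (ultralimit_set M)].
Proof.
move=> e0; have e4 : 0 < e / 4 by rewrite divr_gt0.
apply: filterI.
  have [//|UC] := in_ultra_setVsetC [set n | close_within r e (M n) (ultralimit_set M)] UF.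
  have [|u [l [UP Ul]]] := ultralimit_point (P := fun n u => M n u /\
      ~ exists v, [/\ ultralimit_set M v, `|u.1 - v.1| < e & `|u.2 - v.2| < e]) (r := r).
    apply: filterS UC => n /= nC; apply: contrapT => H; apply: nC => u Mu u1 u2.
    by apply: contrapT => nv; apply: H; exists u.
  have lM : ultralimit_set M l.
    move=> e' e'0; apply: filterS2 UP (Ul _ e'0) => n /= [Mu _] [h1 h2].
    by exists (u n); split; rewrite // distrC.
  have [n [/= [_ nv] [h1 h2]]] := filter_ex (filterI UP (Ul _ e0)).
  by case: nv; exists l.
have [//|UC] := in_ultra_setVsetC [set n | close_within r e (ultralimit_set M) (M n)] UF.
have [|u [l [UP Ul]]] := ultralimit_point (P := fun n u => ultralimit_set M u /\
    ~ exists v, [/\ M n v, `|u.1 - v.1| < e & `|u.2 - v.2| < e]) (r := r).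
  apply: filterS UC => n /= nC; apply: contrapT => H; apply: nC => u Mu u1 u2.
  by apply: contrapT => nv; apply: H; exists u.
have [n0 [/= [Mu0 _] [h01 h02]]] := filter_ex (filterI UP (Ul _ e4)).
have [n [/= [[_ nv] [h1 h2]] [v [Mv v1 v2]]]] :=
  filter_ex (filterI (filterI UP (Ul _ e4)) (Mu0 _ e4)).
case: nv; exists v; split => //.
  have := ler_distD l.1 (u n).1 v.1; have := ler_distD (u n0).1 l.1 v.1.
  by rewrite (distrC l.1 (u n0).1); lra.
have := ler_distD l.2 (u n).2 v.2; have := ler_distD (u n0).2 l.2 v.2.
by rewrite (distrC l.2 (u n0).2); lra.
Qed.

Lemma translation_limit_ultralimit L (M : nat -> set (R * R)) :
  (forall n, translation_limit L (M n)) -> translation_limit L (ultralimit_set M).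
Proof.
move=> LM; split.
  apply: le_ereal_inf_tmp => _ [u [v [Mu Mv uv ->]]].
  apply/lee_addgt0Pr => e e0; rewrite -EFinD.
  have duv : 0 < `|u.1 - v.1| + `|u.2 - v.2|.
    rewrite lt_neqAle addr_ge0// andbT eq_sym paddr_eq0//; apply/negP => /andP[].
    rewrite !normr_eq0 !subr_eq0 => /eqP h1 /eqP h2; apply: uv.
    by rewrite (surjective_pairing u) h1 h2 -surjective_pairing.
  (* Moving both points by [e'] in each coordinate changes their distance by at most 4 e' <= e; the
     fifth keeps the approximating points distinct, so that the separation applies to them. *)
  pose e' := Num.min (e / 4) ((`|u.1 - v.1| + `|u.2 - v.2|) / 5).
  have e'0 : 0 < e' by rewrite lt_min !divr_gt0.
  have e'e : e' <= e / 4 by rewrite ge_min lexx.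
  have e'd : e' <= (`|u.1 - v.1| + `|u.2 - v.2|) / 5 by rewrite ge_min lexx orbT.
  have [n [/= [u' [Mu' u1 u2]] [v' [Mv' v1 v2]]]] := filter_ex (filterI (Mu _ e'0) (Mv _ e'0)).
  case: (LM n) => sep _; rewrite (le_trans sep)//.
  rewrite (@le_trans _ _ (euclid_norm (u' - v'))%:E)//.
    apply: ereal_inf_lbound; exists u', v'; split => // uv'.
    have := ler_distD u'.1 u.1 v.1; have := ler_distD u'.2 u.2 v.2.
    rewrite {2 4}uv' (distrC v'.1) (distrC v'.2); lra.
  rewrite lee_fin.
  have E (w : R * R) : euclid_norm w = nm ((w.1 +i* w.2)%C) by [].
  rewrite !E.
  have -> : ((u' - v').1 +i* (u' - v').2)%C =
      ((u - v).1 +i* (u - v).2)%C + ((v.1 - v'.1 - (u.1 - u'.1)) +i* (v.2 - v'.2 - (u.2 - u'.2)))%C.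
    by apply: eq_ReIm => /=; ring.
  rewrite (le_trans (nmD _ _))// lerD2l (le_trans (nm_le_ReIm _))//=.
  have := ler_normB (v.1 - v'.1) (u.1 - u'.1).
  have := ler_normB (v.2 - v'.2) (u.2 - u'.2).
  lra.
move=> r e r0 e0; have e2 : 0 < e / 2 by rewrite divr_gt0.
have [n /= hn] := filter_ex (ultralimit_set_close M (r + e / 2) e2).
have re : 0 < r + e / 2 by rewrite addr_gt0.
case: (LM n) => _ /(_ (r + e / 2) (e / 2) re e2)[x hx]; exists x.
have rle : r <= r + e / 2 by rewrite lerDl ltW.
have e_split : e / 2 + e / 2 = e by rewrite -splitr.
case: hn hx => h1 h2 [h3 h4]; split; rewrite -e_split.
  exact: close_within_trans (close_withinW rle h3) h1.
exact: close_within_trans (close_withinW rle h2) h4.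
Qed.

End LocalCloseness.

(** * Vanishing sums over reflected points *)

Section ReflectionSums.
Context {R : realType}.
Local Notation C := (R[i]).
Implicit Types (g : R * R -> C) (M : set (R * R)).
Variable s : R.
Hypothesis s0 : 0 <= s.

Definition reflection_sum g (l t : R * R) : C :=
  g (l.1 + t.1, l.2 + t.2) + g (l.1 - t.1, l.2 + t.2) +
  (g (l.1 + t.1, l.2 - t.2) + g (l.1 - t.1, l.2 - t.2)).

Definition reflection_null g M := forall l t, M l -> reflection_sum g l t = 0.

Lemma reflection_null_lin c g h M : reflection_null g M -> reflection_null h M ->
  reflection_null (fun p => g p + c * h p) M.
Proof.
move=> gM hM l t Ml; have e1 := gM l t Ml; have e2 := hM l t Ml.
rewrite /reflection_sum.
transitivity (reflection_sum g l t + c * reflection_sum h l t).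
  by rewrite /reflection_sum; ring.
by rewrite e1 e2 mulr0 addr0.
Qed.

Lemma reflection_null_shift v g M : reflection_null g M ->
  reflection_null (fun p => g (p + v)) (translate M v).
Proof.
move=> gM _ t [l Ml <-]; rewrite -(gM l t Ml) /reflection_sum.
by congr (g _ + g _ + (g _ + g _)); apply: pair_ext => /=; ring.
Qed.

(** Adding the two rows at ordinates l.2 + t.2 and l.2 - t.2 gives a function of one variable that
    is odd about l.1; two derivatives preserve this. *)
Lemma reflection_null_dxx g g' g'' M : reflection_null g M -> dx s g g' -> dx s g' g'' ->
  reflection_null g'' M.
Proof.
move=> gM d1 d2 l t Ml.
pose row (u : R * R -> C) x := u (x, l.2 + t.2) + u (x, l.2 - t.2).
have dr1 : lder s (row g) (row g') by exact: lderD (d1 _) (d1 _).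
have dr2 : lder s (row g') (row g'') by exact: lderD (d2 _) (d2 _).
have H0 x : row g (l.1 + x) + row g (l.1 - x) = 0.
  by have := gM l (x, t.2) Ml; rewrite /reflection_sum /row /= => <-; ring.
have := lder_reflectionN dr2 (lder_reflection dr1 H0) t.1.
by rewrite /reflection_sum /row => <-; ring.
Qed.

Lemma reflection_null_dyy g g' g'' M : reflection_null (swap_args g) M ->
  dx s g g' -> dx s g' g'' -> reflection_null (swap_args g'') M.
Proof.
move=> gM d1 d2 l t Ml.
pose row (u : R * R -> C) x := u (x, l.1 + t.1) + u (x, l.1 - t.1).
have dr1 : lder s (row g) (row g') by exact: lderD (d1 _) (d1 _).
have dr2 : lder s (row g') (row g'') by exact: lderD (d2 _) (d2 _).
have H0 x : row g (l.2 + x) + row g (l.2 - x) = 0.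
  have := gM l (t.1, x) Ml; rewrite /reflection_sum /row /swap_args /= => <-; ring.
have := lder_reflectionN dr2 (lder_reflection dr1 H0) t.2.
by rewrite /reflection_sum /row /swap_args => <-; ring.
Qed.

Context (U : set_system nat) {UF : UltraFilter U}.

Lemma reflection_null_limit (f : nat -> R * R -> C) (M : nat -> set (R * R)) g m :
  (forall n, planar s (f n)) -> (forall n p, nm (f n p) <= m) ->
  (forall n, reflection_null (f n) (M n)) ->
  (forall p, ulims U (fun n => f n p) (g p)) ->
  reflection_null g (ultralimit_set U M).
Proof.
move=> pf fm fM fg l t Ml; apply/nm0_eq0/eqP; rewrite eq_le nm_ge0 andbT.
have hlim : ulims U (fun n => reflection_sum (f n) l t) (reflection_sum g l t).
  by rewrite /reflection_sum; do !apply: ulimsD; exact: fg.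
have m0 : 0 <= m by exact: le_trans (nm_ge0 _) (fm 0%N 0).
have B0 := bernstein_const_gt0 s.
apply: (ulims_le hlim) => e e0.
(* Each of the four values moves by at most e / 4 when the base point passes from [l] to a point of
   [M n] within [e']; m + 1 keeps the denominator positive. *)
pose e' := e / (8 * bernstein_const s * (m + 1)).
have m1 : 0 < m + 1 by rewrite ltr_wpDl.
have e'0 : 0 < e' by apply: divr_gt0 => //; apply: mulr_gt0 => //; apply: mulr_gt0.
apply: filterS (Ml _ e'0) => n /= [v [Mv v1 v2]]; rewrite add0r.
have lip (x y : R) : nm (f n (l.1 + x, l.2 + y) - f n (v.1 + x, v.2 + y)) <= e / 4.
  rewrite (_ : (l.1 + x, l.2 + y) = (v.1 + x, v.2 + y) + (l.1 - v.1, l.2 - v.2)); last first.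
    by apply: pair_ext => /=; ring.
  rewrite (le_trans (planar_lipschitz s0 _ _ (pf n) (fm n)))//=.
  rewrite (@le_trans _ _ (bernstein_const s * (m + 1) * (e' + e')))//.
    rewrite ler_pM ?mulr_ge0 ?addr_ge0 ?(ltW B0)//.
      by rewrite ler_wpM2l ?(ltW B0)// lerDl.
    by rewrite lerD// ltW.
  by rewrite le_eqVlt; apply/orP; left; apply/eqP; rewrite /e'; field; rewrite !gt_eqF.
have e1 := fM n v t Mv.
have -> : reflection_sum (f n) l t = reflection_sum (f n) l t - reflection_sum (f n) v t.
  by rewrite e1 subr0.
rewrite /reflection_sum.
have -> (a b c d a' b' c' d' : C) : a + b + (c + d) - (a' + b' + (c' + d')) =
  (a - a') + (b - b') + ((c - c') + (d - d')) by ring.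
have := nmD (f n (l.1 + t.1, l.2 + t.2) - f n (v.1 + t.1, v.2 + t.2) +
  (f n (l.1 - t.1, l.2 + t.2) - f n (v.1 - t.1, v.2 + t.2)))
  (f n (l.1 + t.1, l.2 - t.2) - f n (v.1 + t.1, v.2 - t.2) +
  (f n (l.1 - t.1, l.2 - t.2) - f n (v.1 - t.1, v.2 - t.2))).
have := nmD (f n (l.1 + t.1, l.2 + t.2) - f n (v.1 + t.1, v.2 + t.2))
  (f n (l.1 - t.1, l.2 + t.2) - f n (v.1 - t.1, v.2 + t.2)).
have := nmD (f n (l.1 + t.1, l.2 - t.2) - f n (v.1 + t.1, v.2 - t.2))
  (f n (l.1 - t.1, l.2 - t.2) - f n (v.1 - t.1, v.2 - t.2)).
have := lip t.1 t.2; have := lip (- t.1) t.2; have := lip t.1 (- t.2); have := lip (- t.1) (- t.2).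
lra.
Qed.

End ReflectionSums.

(** * Bounded solutions of f'' = a f *)

Section Oscillation.
Context {R : realType}.
Local Notation C := (R[i]).
Implicit Types (f g : R -> C).
Variable s : R.
Hypothesis s0 : 0 <= s.
Local Notation lder := (lder s).

Lemma lder_rderiv f g t : lder f g -> rderiv f t (g t).
Proof.
move=> [F [G [_ _ dF fF gG]]].
have dt : cderiv F (0 + t%:C%C * 1) (g t) by rewrite mulr1 add0r gG.
by apply: rderiv_eq (rderiv_line dt) => [x|]; rewrite ?mulr1// add0r fF.
Qed.

Lemma rderiv_linear (c : C) (t : R) : rderiv (fun x : R => x%:C%C * c) t c.
Proof.
have dz : cderiv (fun z => z * c) (0 + t%:C%C * 1) c.
  by apply: cderiv_eq (cderiv_affine 0 c _) => // w; ring.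
by apply: rderiv_eq (rderiv_line dz) => [x|]; ring.
Qed.

Lemma lder_exp_cst f g (a b : C) : lder f g -> (forall x, g x = a * f x) ->
  b = - a -> forall x, f x * cexp (b * x%:C%C) = f 0.
Proof.
move=> [F [G [tF tG dF fF gG]]] ga -> x.
pose H z := F z * cexp (- a * z).
have HE t : f t * cexp (- a * t%:C%C) = H t%:C%C by rewrite /H fF.
have -> : f 0 = f 0 * cexp (- a * 0%:C%C) by rewrite mulr0 cexp0 mulr1.
apply: (rderiv0_cst (f := fun t : R => f t * cexp (- a * t%:C%C))) => t.
have d1 : cderiv (fun z => cexp (- a * z)) t%:C%C (cexp (- a * t%:C%C) * - a).
  apply: cderiv_comp (cderiv_cexp _).
  by apply: cderiv_eq (cderiv_affine 0 (- a) _) => // w; rewrite add0r.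
have dH : cderiv H (0 + t%:C%C * 1) 0.
  rewrite mulr1 add0r; apply: cderiv_eq (cderivM (dF _) d1) => //.
  by rewrite -gG ga fF; ring.
by apply: rderiv_eq (rderiv_line dH) => [y|]; rewrite ?mulr1// add0r HE.
Qed.

Lemma bounded_const_exp (c a : C) (m : R) : Re a != 0 ->
  (forall x : R, nm (c * cexp (a * x%:C%C)) <= m) -> c = 0.
Proof.
move=> a0 H; apply: contrapT => /eqP/nm_gt0 c0.
have H' (x : R) : nm c * expR (Re a * x) <= m.
  have := H x; rewrite nmM nm_cexp ReM /= mulr0 subr0; exact.
have := H' ((m / nm c) / Re a); rewrite mulrCA mulfV// mulr1 => h.
have := expR_ge1Dx (m / nm c); rewrite -(ler_pM2l c0) mulrDr mulr1 [nm c * (_ / _)]mulrCA mulfV ?gt_eqF// mulr1.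
lra.
Qed.

(** With mu^2 = a, the functions f' - mu f and f' + mu f are multiples of exp (- mu x) and exp (mu
    x). Boundedness kills both unless mu is imaginary; for mu = 0 it leaves the constants. When mu =
    i xi is nonzero, y0 = pi / (2 xi) makes f y0 the sine coefficient. The frequency and y0 are
    quantified before [f], so that all rows of a planar eigenfunction share them. *)
Lemma bounded_eigenfunction (a : C) :
  (forall f g m, lder f g -> lder g (fun x => a * f x) ->
     (forall x, nm (f x) <= m) -> forall x, f x = 0) \/
  exists xi y0 : R, forall f g m, lder f g -> lder g (fun x => a * f x) ->
     (forall x, nm (f x) <= m) ->
     forall x, f x = (cos (xi * x))%:C%C * f 0 + (sin (xi * x))%:C%C * f y0.
Proof.
pose mu := sqrtC a; have mu2 : mu * mu = a by rewrite -expr2 sqrtCK.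
have [m0|mn0] := eqVneq mu 0.
  right; exists 0, 0 => f g m dfg dgf fm x.
  have a0 : a = 0 by rewrite -mu2 m0 mul0r.
  have gc y : g y = g 0.
    apply: (rderiv0_cst (f := g)) => t.
    by have := lder_rderiv t dgf; rewrite a0 mul0r.
  have fl y : f y = f 0 + y%:C%C * g 0.
    have : f y - y%:C%C * g 0 = f 0 - 0%:C%C * g 0.
      apply: (rderiv0_cst (f := fun t : R => f t - t%:C%C * g 0)) => t.
      rewrite -(subrr (g 0)) -[X in rderiv _ _ (X - _)](gc t).
      exact: rderivB (lder_rderiv t dfg) (rderiv_linear _ _).
    by rewrite mul0r subr0 => <-; rewrite subrK.
  have g0 : g 0 = 0.
    apply: contrapT => /eqP/nm_gt0 gp.
    have fm0 : 0 <= m by exact: le_trans (nm_ge0 _) (fm 0).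
    pose y := (2 * m + 1) / nm (g 0).
    have e1 : f y - f 0 = y%:C%C * g 0 by rewrite (fl y) addrAC subrr add0r.
    have := nmB (f y) (f 0); have := fm y; have := fm 0.
    rewrite e1 nmM nm_real ger0_norm; last by rewrite divr_ge0 ?(ltW gp)//; lra.
    by rewrite divfK ?gt_eqF//; lra.
  by rewrite mul0r cos0 sin0 mul1r mul0r addr0 fl g0 mulr0 addr0.
pose u (f g : R -> C) x := g x + (- mu) * f x.
pose v (f g : R -> C) x := g x + mu * f x.
have uE f g : lder f g -> lder g (fun x => a * f x) ->
    forall x, u f g x = u f g 0 * cexp (- mu * x%:C%C).
  move=> dfg dgf x.
  have e : u f g x * cexp (mu * x%:C%C) = u f g 0.
    apply: (lder_exp_cst (lderD dgf (lderZ (- mu) dfg)) (a := - mu)); last by rewrite opprK.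
    by move=> t; rewrite -mu2; ring.
  by rewrite -e -mulrA [X in _ * X]mulrC mulNr cexpNK mulr1.
have vE f g : lder f g -> lder g (fun x => a * f x) ->
    forall x, v f g x = v f g 0 * cexp (mu * x%:C%C).
  move=> dfg dgf x.
  have e : v f g x * cexp (- mu * x%:C%C) = v f g 0.
    apply: (lder_exp_cst (lderD dgf (lderZ mu dfg)) (a := mu)) => //.
    by move=> t; rewrite -mu2; ring.
  by rewrite -e -mulrA mulNr cexpNK mulr1.
have ub f g m : lder f g -> (forall x, nm (f x) <= m) ->
    forall x, nm (u f g x) <= bernstein_const s * m + nm mu * m.
  move=> dfg fm x; rewrite (le_trans (nmD _ _))// lerD//.
    exact: lder_bound dfg fm x.
  by rewrite nmM nmN ler_wpM2l// nm_ge0.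
have vb f g m : lder f g -> (forall x, nm (f x) <= m) ->
    forall x, nm (v f g x) <= bernstein_const s * m + nm mu * m.
  move=> dfg fm x; rewrite (le_trans (nmD _ _))// lerD//.
    exact: lder_bound dfg fm x.
  by rewrite nmM ler_wpM2l// nm_ge0.
have mu2n0 : 2 * mu != 0 by rewrite mulf_neq0// pnatr_eq0.
have fE f g x : f x = (v f g x - u f g x) / (2 * mu).
  apply: (mulIf mu2n0); rewrite divfK// /u /v; ring.
have [re0|ren0] := eqVneq (Re mu) 0; last first.
  left=> f g m dfg dgf fm x; rewrite (fE f g x) (uE _ _ dfg dgf) (vE _ _ dfg dgf).
  have -> : u f g 0 = 0.
    apply: (@bounded_const_exp _ (- mu)); first by rewrite ReN oppr_eq0.
    by move=> y; rewrite -(uE _ _ dfg dgf); exact: ub dfg fm y.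
  have -> : v f g 0 = 0.
    apply: (@bounded_const_exp _ mu) => // y.
    by rewrite -(vE _ _ dfg dgf); exact: vb dfg fm y.
  by rewrite !mul0r subr0 mul0r.
right; pose xi := Im mu.
have xi0 : xi != 0.
  by apply: contraNneq mn0 => x0; apply/eqP/eq_ReIm.
have muE : mu = (0 +i* xi)%C by apply: eq_ReIm.
exists xi, (pi / 2 / xi) => f g m dfg dgf fm.
have cE (x : R) : cexp (mu * x%:C%C) = (cos (xi * x) +i* sin (xi * x))%C.
  rewrite muE; apply: eq_ReIm => /=.
    by rewrite !mul0r !mulr0 subr0 expR0 mul1r add0r.
  by rewrite !mul0r !mulr0 subr0 expR0 mul1r add0r.
have cNE (x : R) : cexp (- mu * x%:C%C) = (cos (xi * x) -i* sin (xi * x))%C.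
  rewrite muE; apply: eq_ReIm => /=.
    by rewrite !(mul0r,mulr0,oppr0,subr0,expR0,mul1r,add0r) mulNr cosN.
  by rewrite !(mul0r,mulr0,oppr0,subr0,expR0,mul1r,add0r) mulNr sinN.
have fx (x : R) : f x = (cos (xi * x))%:C%C * f 0 + (sin (xi * x))%:C%C * ((0 +i* 1)%C * g 0 / mu).
  rewrite (fE f g x) (uE _ _ dfg dgf) (vE _ _ dfg dgf) cE cNE /u /v.
  have -> : (cos (xi * x) +i* sin (xi * x))%C = (cos (xi * x))%:C%C + (0 +i* 1)%C * (sin (xi * x))%:C%C.
    by apply: eq_ReIm => /=; ring.
  have -> : (cos (xi * x) -i* sin (xi * x))%C = (cos (xi * x))%:C%C - (0 +i* 1)%C * (sin (xi * x))%:C%C.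
    by apply: eq_ReIm => /=; ring.
  by field.
have fy0 : f (pi / 2 / xi) = (0 +i* 1)%C * g 0 / mu.
  have e : xi * (pi / 2 / xi) = pi / 2 by rewrite mulrC divfK.
  by rewrite fx e cos_pihalf sin_pihalf mul0r add0r mul1r.
by move=> x; rewrite fx fy0.
Qed.

End Oscillation.

(** * Zero sets of trigonometric combinations *)

Section LatticeFromEigenfunction.
Context {R : realType}.
Local Notation C := (R[i]).

Lemma amplitude_phase (P Q : R) : exists rho t : R, forall x,
  P * cos x + Q * sin x = rho * cos (x + t).
Proof.
have [h0|h0] := eqVneq ((P -i* Q)%C : C) 0.
  exists 0, 0 => x; rewrite mul0r.
  have := congr1 (@complex.Re R) h0; have := congr1 (@complex.Im R) h0 => /= q p.
  by rewrite p (_ : Q = 0) ?mul0r ?addr0//; apply/eqP; rewrite -oppr_eq0 q.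
have [w [hw _]] := cexp_polar h0.
exists (expR (Re ((0 +i* 1)%C * w))), (Im ((0 +i* 1)%C * w)) => x.
have := congr1 (@complex.Re R) hw; have := congr1 (@complex.Im R) hw.
rewrite /cexp /=; set A := expR _; set T := Im (_ * w).
rewrite cosD => q p.
have -> : Q = - (A * sin T) by rewrite q opprK.
by rewrite -p; ring.
Qed.

(** Product-to-sum formulas turn the four products into cosines and sines of the sum and of the
    difference of the phases, and [amplitude_phase] merges each pair. The coefficient [a] is the
    value at the origin: since it is nonzero, the amplitudes can be normalised and the lattice
    misses the origin. *)
Lemma trig_zero_set_curvilinear (xi1 xi2 a b c d : R) (M : set (R * R)) :
  a != 0 ->
  (forall l, M l -> a * (cos (xi1 * l.1) * cos (xi2 * l.2)) +
     b * (cos (xi1 * l.1) * sin (xi2 * l.2)) + c * (sin (xi1 * l.1) * cos (xi2 * l.2)) +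
     d * (sin (xi1 * l.1) * sin (xi2 * l.2)) = 0) ->
  exists t xi r : R * R, [/\ r.1 ^+ 2 + r.2 ^+ 2 = 1,
    curvilinear_lattice t xi r <> setT & M `<=` curvilinear_lattice t xi r].
Proof.
move=> a0 HM.
have [rho1 [t1 h1]] := amplitude_phase ((a - d) / 2) ((b + c) / 2).
have [rho2 [t2 h2]] := amplitude_phase ((a + d) / 2) ((b - c) / 2).
have uE (x y : R) : a * (cos (xi1 * x) * cos (xi2 * y)) +
     b * (cos (xi1 * x) * sin (xi2 * y)) + c * (sin (xi1 * x) * cos (xi2 * y)) +
     d * (sin (xi1 * x) * sin (xi2 * y)) =
     rho1 * cos (x * xi1 + y * xi2 + t1) + rho2 * cos (- (x * xi1) + y * xi2 + t2).
  rewrite -h1 -h2 (mulrC x) (mulrC y) !cosD !sinD cosN sinN; by field.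
have u0 := uE 0 0; rewrite !(mulr0, mul0r, cos0, sin0, addr0, mulr1) in u0.
have n0 : 0 < rho1 ^+ 2 + rho2 ^+ 2.
  rewrite lt_neqAle addr_ge0 ?sqr_ge0// andbT eq_sym paddr_eq0 ?sqr_ge0//.
  rewrite !sqrf_eq0; apply: contraNN a0 => /andP[/eqP r1 /eqP r2].
  by rewrite u0 r1 r2 !mul0r addr0.
pose n := Num.sqrt (rho1 ^+ 2 + rho2 ^+ 2).
have npos : 0 < n by rewrite sqrtr_gt0.
have nn : n ^+ 2 = rho1 ^+ 2 + rho2 ^+ 2 by rewrite sqr_sqrtr// ltW.
have mem (l : R * R) : curvilinear_lattice (t1, t2) (xi1, xi2) (rho1 / n, - rho2 / n) l <->
    rho1 * cos (l.1 * xi1 + l.2 * xi2 + t1) + rho2 * cos (- (l.1 * xi1) + l.2 * xi2 + t2) = 0.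
  rewrite /curvilinear_lattice /=; split => h.
    apply: (mulIf (_ : n^-1 != 0)); first by rewrite invr_eq0 gt_eqF.
    by move: h; rewrite mul0r; set X := cos _; set Y := cos _; lra.
  apply: (mulIf (_ : n != 0)); first by rewrite gt_eqF.
  rewrite mulrAC divfK ?gt_eqF// [RHS]mulrAC divfK ?gt_eqF//; lra.
exists (t1, t2), (xi1, xi2), (rho1 / n, - rho2 / n); split.
- by rewrite /= !exprMn sqrrN exprVn -mulrDl -nn divff// expf_neq0// gt_eqF.
- move=> T; have : curvilinear_lattice (t1, t2) (xi1, xi2) (rho1 / n, - rho2 / n) (0, 0) by rewrite T.
  move=> /mem /=; rewrite !mul0r !addr0 -u0 => /eqP; exact/negP.
- by move=> l Ml; apply/mem; rewrite -uE; exact: HM.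
Qed.

End LatticeFromEigenfunction.

(** * Joint eigenfunctions contradict condition (A) *)

Section JointEigenfunction.
Context {R : realType}.
Local Notation C := (R[i]).
Implicit Types (g h : R * R -> C) (M : set (R * R)).
Variable s : R.
Hypothesis s0 : 0 <= s.
Local Notation planar := (planar s).
Local Notation dx := (dx s).

Lemma swap_argsK g : swap_args (swap_args g) = g.
Proof. by apply/funext => -[x y]. Qed.

Definition x_eigen (z : C) g := exists g', [/\ planar g', dx g g' & dx g' (fun p => z * g p)].

(** The y-derivative commutes with both x-derivatives in turn: [m] is the mixed derivative,
    identified by two uses of [dx_mixed]. *)
Lemma x_eigen_dy z g h : planar g -> x_eigen z g -> dx (swap_args g) (swap_args h) ->
  x_eigen z h.
Proof.
move=> pg [g' [pg' d1 d2]] dh.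
have [m pm dm] := dx_exists s0 (planar_swap pg').
have dh1 : dx h (swap_args m) by apply: (dx_mixed s0 pg d1 dh); rewrite swap_argsK.
exists (swap_args m); split => //; first exact: planar_swap.
apply: (dx_mixed s0 pg' d2); first by rewrite swap_argsK.
exact: (dxZ z dh).
Qed.

Lemma no_annihilator (L : set (R * R)) g M p0 : uniformly_discrete L -> condition_A L ->
  planar g -> translation_limit L M -> reflection_null g M -> g p0 != 0 -> False.
Proof.
move=> dL cA pg LM gM gp0.
have [U [UF Ucof]] := exists_free_ultrafilter.
pose Q1 g M := [/\ planar g, translation_limit L M & reflection_null g M].
have [z [h [h' [M1 [[ph LM1 hM1] h0 dh dh']]]]] :
    exists z h h' M', [/\ Q1 h M', h 0 != 0, dx h h' & dx h' (fun p => z * h p)].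
  apply: (@spectral_step _ s (set (R * R)) s0 U UF Ucof Q1) _ gp0 => //.
  - by move=> ? ? [].
  - move=> c u v N [pu LN uN] [pv _ vN]; split => //.
      by apply: planarD => //; exact: planarZ.
    exact: reflection_null_lin.
  - move=> u u' u'' N [pu LN uN] d1 pu' d2 pu''; split => //.
    exact: reflection_null_dxx uN d1 d2.
  - move=> v u N [pu LN uN]; exists (translate N v); split.
    + exact: planar_shift.
    + exact: translation_limit_shift.
    + exact: reflection_null_shift.
  - move=> f N u HQ fb fu; exists (ultralimit_set U N); split.
    + by apply: (planar_limit s0 (UF := UF) (f := f)) fb fu => n; case: (HQ n).
    + by apply: translation_limit_ultralimit => n; case: (HQ n).
    + by apply: (reflection_null_limit s0 (UF := UF) (f := f)) fb _ fu => n; case: (HQ n).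
  - by split; [exact: pg|exact: LM|exact: gM].
have [h1 ph1 dh1] := dx_exists s0 ph; have eh1 := dx_unique dh dh1.
(* Functions are stored with exchanged arguments, so that [spectral_step], which differentiates in
   the first variable, acts on y. The eigenvalue relation in x becomes part of the invariant. *)
pose Q2 k M := Q1 (swap_args k) M /\ x_eigen z (swap_args k).
have [w [k [k' [M2 [[[pk LM2 kM2] ek] k0 dk dk']]]]] :
    exists w h h' M', [/\ Q2 h M', h 0 != 0, dx h h' & dx h' (fun p => w * h p)].
  apply: (@spectral_step _ s (set (R * R)) s0 U UF Ucof Q2 _ _ _ _ _ (swap_args h) M1 0) => //.
  - by move=> u N [[pu _ _] _]; rewrite -(swap_argsK u); exact: planar_swap.
  - move=> c u v N [[pu LN uN] [u' [pu' du du']]] [[pv _ vN] [v' [pv' dv dv']]]; split.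
      split => //; first by apply: planarD => //; exact: (planarZ c pv).
      exact: (reflection_null_lin c uN vN).
    exists (fun p => u' p + c * v' p); split.
    + by apply: planarD => //; exact: planarZ.
    + exact: (dxD du (dxZ c dv)).
    + have := dxD du' (dxZ c dv'); congr dx; apply/funext => p.
      by rewrite /swap_args; ring.
  - move=> u u' u'' N [[pu LN uN] eu] d1 pu' d2 pu''.
    split; first split => //; first exact: planar_swap.
      exact: reflection_null_dyy uN d1 d2.
    apply: (x_eigen_dy (planar_swap pu')); last by rewrite !swap_argsK.
    by apply: (x_eigen_dy pu) => //; rewrite !swap_argsK.
  - move=> v u N [[pu LN uN] [u' [pu' du du']]]; exists (translate N (v.2, v.1)).
    split; first split.
    + exact: (planar_shift (v.2, v.1) pu).
    + exact: translation_limit_shift.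
    + exact: (reflection_null_shift (v := (v.2, v.1)) uN).
    + exists (fun p => u' (p + (v.2, v.1))); split.
      * exact: planar_shift.
      * exact: (dx_shift (v.2, v.1) du).
      * exact: (dx_shift (v.2, v.1) du').
  (* The x-derivatives are bounded by Bernstein's inequality, so they converge along [U] too, and
     the eigenvalue relation passes to the limit. *)
  - move=> f N u HQ fb fu.
    have /choice[f' Hf'] : forall n, exists g', [/\ planar g', dx (swap_args (f n)) g' &
        dx g' (fun p => z * swap_args (f n) p)].
      by move=> n; case: (HQ n).
    have sb n p : nm (swap_args (f n) p) <= 1 by exact: fb.
    have sl p : ulims U (fun n => swap_args (f n) p) (swap_args u p) by exact: fu.
    have f'b n p : nm (f' n p) <= bernstein_const s * 1.
      by case: (Hf' n) => _ d1 _; apply: (dx_bound s0 d1).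
    have /choice[u' hu'] : forall p, exists l, ulims U (fun n => f' n p) l.
      by move=> p; apply: (ulims_exists (K := bernstein_const s * 1)).
    exists (ultralimit_set U N); split; first split.
    + by apply: (planar_limit s0 (UF := UF)) sb sl => n; case: (HQ n) => -[].
    + by apply: translation_limit_ultralimit => n; case: (HQ n) => -[].
    + by apply: (reflection_null_limit s0 (UF := UF)) sb _ sl => n; case: (HQ n) => -[].
    + exists u'; split.
      * by apply: (planar_limit s0 (UF := UF)) f'b hu' => n; case: (Hf' n).
      * by apply: (dx_limit s0 (UF := UF)) sb sl hu' => n; case: (Hf' n).
      * apply: (dx_limit s0 (UF := UF) (f' := fun n p => z * swap_args (f n) p)) f'b hu' _.
          by move=> n; case: (Hf' n).
        by move=> p; apply: ulimsZ.
  - split; first by rewrite swap_argsK; split.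
    by rewrite swap_argsK; exists h'; split => //; rewrite eh1.
pose u := swap_args k; have u0 : u (0, 0) != 0 by [].
have [u' [_ du du']] := ek.
have [[m um] _ _] := pk.
have [nox|[xi1 [y1 hx]]] := bounded_eigenfunction s0 z.
  have := nox _ _ m (du 0) (du' 0) (fun x => um (x, 0)) 0.
  by move=> e; rewrite /u e eqxx in u0.
have km p : nm (k p) <= m by have := um (p.2, p.1); rewrite /swap_args /= -surjective_pairing.
have [noy|[xi2 [y2 hy]]] := bounded_eigenfunction s0 w.
  have := noy _ _ m (dk 0) (dk' 0) (fun x => km (x, 0)) 0.
  by move=> e; rewrite e eqxx in k0.
(* Expansion along the row through y, then along the columns through 0 and [y1]; the frequencies and
   nodes are common to all rows and to all columns. *)
have uxy (x y : R) : u (x, y) =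
    (cos (xi1 * x))%:C%C * ((cos (xi2 * y))%:C%C * u (0, 0) + (sin (xi2 * y))%:C%C * u (0, y2)) +
    (sin (xi1 * x))%:C%C * ((cos (xi2 * y))%:C%C * u (y1, 0) + (sin (xi2 * y))%:C%C * u (y1, y2)).
  rewrite [LHS](hx _ _ m (du y) (du' y) (fun x => um (x, y)) x).
  congr (_ * _ + _ * _).
    exact: (hy _ _ m (dk 0) (dk' 0) (fun x => km (x, 0)) y).
  exact: (hy _ _ m (dk y1) (dk' y1) (fun x => km (x, y1)) y).
have uM l : M2 l -> u l = 0.
  move=> Ml; have := kM2 l (0, 0) Ml; rewrite /reflection_sum /= !addr0 !subr0 -surjective_pairing.
  rewrite -/u => e4; have : 4 * u l = 0 by rewrite -e4; ring.
  by move/eqP; rewrite mulf_eq0 pnatr_eq0 => /eqP.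
have wl := translation_limit_weak dL LM2; have [_ nolat] := cA _ wl.
(* The lattice equation has real coefficients while those of [u] are complex. [re] will be the real
   or the imaginary part, whichever is nonzero at u (0, 0). *)
have fin (re : C -> R) (reD : forall a b, re (a + b) = re a + re b)
    (reZ : forall (r : R) a, re (r%:C%C * a) = r * re a) : re (u (0, 0)) != 0 -> False.
  move=> a0.
  have [|t [xi [r [r1 nT sub]]]] := @trig_zero_set_curvilinear R xi1 xi2 (re (u (0, 0)))
      (re (u (0, y2))) (re (u (y1, 0))) (re (u (y1, y2))) M2 a0; last exact: nolat r1 nT sub.
  move=> [x y] Ml; have := congr1 re (uM _ Ml).
  have re0 : re 0 = 0 by have := reZ 0 0; rewrite !mul0r.
  by rewrite re0 uxy !(reD, reZ) /= => e; rewrite -[RHS]e; ring.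
have [r0|] := eqVneq (Re (u (0, 0))) 0; last first.
  by apply: fin => [a b|r a]; rewrite ?ReD// ReM /= mul0r subr0.
have [i0|] := eqVneq (Im (u (0, 0))) 0; last first.
  by apply: fin => [a b|r a]; rewrite ?ImD// ImM /= mul0r addr0.
by move/eqP: u0; apply; apply: eq_ReIm.
Qed.

End JointEigenfunction.

(** * Uniqueness for Gaussian integrals *)

Section MeasureTools.
Context {R : realType}.
Local Notation mu := (@lebesgue_measure R).

Lemma integrable_dominated d (T : measurableType d) (nu : {measure set T -> \bar R})
    (f w : T -> R) (K : R) : measurable_fun setT f ->
  nu.-integrable setT (EFin \o w) -> (forall x, `|f x| <= K * w x) ->
  nu.-integrable setT (EFin \o f).
Proof.
move=> mf iw fw; have K0 : nu.-integrable setT (fun x => K%:E * (EFin \o w) x)%E.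
  exact: integrableZl.
apply: le_integrable K0 => //; first exact/measurable_EFinP.
by move=> x _ /=; rewrite lee_fin (le_trans (fw x))// ler_norm.
Qed.

Lemma norm_Rintegral_le d (T : measurableType d) (nu : {measure set T -> \bar R})
    (f g : T -> R) : nu.-integrable setT (EFin \o f) ->
  nu.-integrable setT (EFin \o g) -> (forall x, `|f x| <= g x) ->
  `|\int[nu]_x f x| <= \int[nu]_x g x.
Proof.
move=> hf hg fg; rewrite (le_trans (le_normr_Rintegral _ hf))//.
apply: le_Rintegral => //; first exact: (integrable_norm hf).
Qed.

(** An open set is the union of the boxes with rational centre and radius 1 / (n + 1) that it
    contains, and there are countably many of them. *)
Lemma open_measurable_prod (O : set (R * R)) : open O -> measurable O.
Proof.
move=> oO.
pose box (k : rat * rat * nat) : set (R * R) :=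
  ball (ratr k.1.1 : R) (k.2.+1%:R^-1) `*` ball (ratr k.1.2 : R) (k.2.+1%:R^-1).
rewrite (_ : O = \bigcup_k (if pselect (box k `<=` O) then box k else set0)).
  apply: countable_bigcupT_measurable; first exact: countableP.
  move=> k; case: (pselect (box k `<=` O)) => ksub; last exact: measurable0.
  by apply: measurableX; apply: open_measurable; apply: ball_open; rewrite invr_gt0.
apply/seteqP; split => [p Op|p [k _]]; last first.
  by case: (pselect (box k `<=` O)) => // sub; exact: sub.
have [e /= e0 He] := (nbhs_ballP p O).1 (oO p Op).
pose n := Num.truncn (2 / e).
have n0 : 0 < n.+1%:R^-1 :> R by rewrite invr_gt0.
have ne : 2 * n.+1%:R^-1 <= e.
  rewrite ler_pdivrMr// mulrC -ler_pdivrMr// ltW//; exact: truncnS_gt.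
have dens (x : R) : exists q : rat, `|ratr q - x| < n.+1%:R^-1.
  have : x - n.+1%:R^-1 < x + n.+1%:R^-1 by rewrite ltrD2l gtrN.
  by move=> /rat_in_itvoo[q]; rewrite in_itv/= => hq; exists q; move: hq; rewrite ltr_norml; set t := _^-1; lra.
have [q1 h1] := dens p.1; have [q2 h2] := dens p.2.
exists (q1, q2, n) => //; case: (pselect (box (q1, q2, n) `<=` O)) => [ksub|nsub].
  by split; rewrite /= /ball/=.
exfalso; apply: nsub => -[x y] [/=]; rewrite /ball/= => hx hy; apply: He.
split => /=; rewrite /ball/=.
  have := ler_distD (ratr q1) p.1 x; rewrite (distrC p.1 (ratr q1)).
  by move: hx h1 ne; rewrite /=; set t := _^-1; lra.
have := ler_distD (ratr q2) p.2 y; rewrite (distrC p.2 (ratr q2)).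
by move: hy h2 ne; rewrite /=; set t := _^-1; lra.
Qed.

Lemma continuous_measurable_prod (f : R * R -> R) : continuous f -> measurable_fun setT f.
Proof.
move=> cf; apply: (measurability _ (RGenOInfty.measurableE R)) => //.
move=> _ [_ [a ->] <-]; rewrite setTI; apply: open_measurable_prod.
by apply: open_comp => //; exact: interval_open.
Qed.

Lemma Rintegral_reflect (f : R -> R) : mu.-integrable setT (EFin \o f) ->
  \int[mu]_x f (- x) = \int[mu]_x f x.
Proof.
move=> intf; rewrite /Rintegral; congr fine.
have mN : measurable_fun [set: measurableTypeR R] (-%R : measurableTypeR R -> measurableTypeR R).
  exact: oppr_measurable.
have mf : measurable_fun [set: R] (EFin \o f) by case/integrableP: intf.
have iN : mu.-integrable ((-%R : measurableTypeR R -> measurableTypeR R) @^-1` setT)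
    ((EFin \o f) \o -%R).
  rewrite preimage_setT; apply/integrableP; split; first exact: measurableT_comp.
  have /integrableP[_] := intf; congr (_ < _)%E.
  transitivity (\int[pushforward mu (-%R : measurableTypeR R -> measurableTypeR R)]_x `|(EFin \o f) x|)%E.
    by apply: eq_measure_integral => A mA _; exact/esym/lebesgue_measureN.
  rewrite (ge0_integral_pushforward mN)//.
  by apply: measurableT_comp => //; exact: mf.
rewrite -(integral_pushforward mN mf iN)//.
by apply: eq_measure_integral => A mA _; exact: lebesgue_measureN.
Qed.

(** Comparison with the normal density of variance 1 / (2 a). *)
Lemma integrable_gaussian (a : R) : 0 < a ->
  mu.-integrable setT (EFin \o (fun x => expR (- a * x ^+ 2))).
Proof.
move=> a0; pose s := (Num.sqrt (2 * a))^-1.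
have s0 : s != 0 by rewrite invr_eq0 sqrtr_eq0 -ltNge mulr_gt0.
apply: (@integrable_dominated _ (measurableTypeR R) mu _ (normal_pdf 0 s) (normal_peak s)^-1).
- apply: continuous_measurable_fun => x.
  apply: (@continuous_comp _ _ _ (fun x : R => - a * x ^+ 2) expR); last exact: continuous_expR.
  by apply: cvgM; [exact: cvg_cst|exact: exprn_continuous].
- exact: integrable_normal_pdf.
move=> x; have -> : normal_pdf 0 s x = normal_peak s * normal_fun 0 s x by rewrite normal_pdfE.
rewrite mulKf; last by rewrite gt_eqF// normal_peak_gt0.
rewrite /normal_fun ger0_norm ?expR_ge0// ler_expR subr0.
have -> : s ^+ 2 *+ 2 = a^-1.
  rewrite exprVn sqr_sqrtr ?mulr_ge0 ?ltW// -mulr_natr invfM; field; rewrite gt_eqF//.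
by rewrite invrK mulNr mulrC mulNr.
Qed.

End MeasureTools.

(** * Elementary inequalities for the exponential *)

Section ExponentialEstimates.
Context {R : realType}.
Implicit Types (x y t : R).

Lemma expr_le_fact_expR n y : 0 <= y -> y ^+ n <= n`!%:R * expR y.
Proof.
move=> y0; case: n => [|n]; first by rewrite expr0 fact0 mul1r -expR0 ler_expR.
have f0 : 0 < (n.+1)`!%:R :> R by rewrite ltr0n fact_gt0.
have := expR_ge1Dxn n y0; rewrite -ler_pdivrMl// mulrC => h.
by rewrite (le_trans _ h)// lerDr.
Qed.

Lemma expR_second_order t : 0 <= t -> 0 <= expR t - 1 - t <= t ^+ 2 * expR t.
Proof.
move=> t0; have e1 := expR_ge1Dx t; have e2 := expR_ge1Dx (- t).
have h : expR t - 1 <= t * expR t.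
  have := ler_wpM2r (expR_ge0 t) e2; rewrite -expRD addNr expR0; lra.
apply/andP; split; first by lra.
have := ler_wpM2l t0 h; rewrite expr2; lra.
Qed.

Lemma exprn_distance_le n (u v M : R) : `|u| <= M -> `|v| <= M -> 1 <= M ->
  `|u ^+ n - v ^+ n| <= n%:R * `|u - v| * M ^+ n.
Proof.
move=> uM vM M1; elim: n => [|n IH]; first by rewrite !expr0 subrr normr0 !mul0r.
have M0 : 0 <= M by lra.
rewrite !exprS (_ : _ - _ = u * (u ^+ n - v ^+ n) + (u - v) * v ^+ n); last by ring.
rewrite (le_trans (ler_normD _ _))// !normrM.
have h1 : `|u| * `|u ^+ n - v ^+ n| <= M * (n%:R * `|u - v| * M ^+ n) by rewrite ler_pM.
have h2 : `|u - v| * `|v ^+ n| <= `|u - v| * (M * M ^+ n).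
  rewrite ler_wpM2l// normrX -exprS (@le_trans _ _ (M ^+ n))//.
    by rewrite lerXn2r ?nnegrE.
  by rewrite exprS ler_peMl// exprn_ge0.
by rewrite -natr1; lra.
Qed.

(** With k = n + 1 and s = t / k, the k-th powers of exp (- s) and 1 - s are compared: the bases
    differ by at most s^2 and are bounded by exp s in absolute value. *)
Lemma expRN_limit_rate n t : 0 <= t ->
  `|expR (- t) - (1 - t / n.+1%:R) ^+ n.+1| <= t ^+ 2 * expR t / n.+1%:R.
Proof.
move=> t0; pose k : R := n.+1%:R; pose s := t / k.
have k0 : 0 < k by rewrite ltr0n.
have s0 : 0 <= s by rewrite divr_ge0// ltW.
have sk : t = k * s by rewrite /s mulrCA divff ?mulr1// gt_eqF.
have es : expR (- t) = expR (- s) ^+ n.+1 by rewrite -expRM_natl mulrN -/k -sk.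
have es' : expR t = expR s ^+ n.+1 by rewrite -expRM_natl -/k -sk.
have e1 := expR_ge1Dx s; have e2 := expR_ge1Dx (- s).
have e3 : expR (- s) - (1 - s) <= s ^+ 2.
  have : expR (- s) * (1 + s) <= 1.
    by rewrite (le_trans (ler_wpM2l (expR_ge0 _) e1))// -expRD addNr expR0.
  have := expR_gt0 (- s); nra.
rewrite es es' -/k -/s; apply: le_trans (exprn_distance_le n.+1 (M := expR s) _ _ _) _.
- by rewrite ger0_norm ?expR_ge0// ler_expR; lra.
- by rewrite ler_norml; apply/andP; split; lra.
- by lra.
rewrite ger0_norm; last by lra.
rewrite -/k; have E0 : 0 <= expR s ^+ n.+1 by rewrite exprn_ge0// expR_ge0.
rewrite [leRHS]mulrAC ler_wpM2r// sk.
have -> : (k * s) ^+ 2 / k = k * s ^+ 2 by field; rewrite gt_eqF.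
by rewrite ler_wpM2l// ltW.
Qed.

End ExponentialEstimates.

(** * Even moments against Gaussian weights *)

Section GaussianMoments.
Context {R : realType}.
Local Notation mu := (@lebesgue_measure R).
Local Notation gw a := (fun x : R => expR (- a * x ^+ 2)).
Implicit Types (e f : R -> R) (a b : R).

Lemma continuous_gw a : continuous (gw a).
Proof.
move=> x; apply: (@continuous_comp _ _ _ (fun x : R => - a * x ^+ 2) expR).
  by apply: cvgM; [exact: cvg_cst|exact: exprn_continuous].
exact: continuous_expR.
Qed.

Lemma integrable_cont_dominated f K a : continuous f -> 0 < a ->
  (forall x, `|f x| <= K * expR (- a * x ^+ 2)) -> mu.-integrable setT (EFin \o f).
Proof.
move=> cf a0 fK.
apply: (@integrable_dominated _ _ (measurableTypeR R) mu f (gw a) K) => //.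
  exact: continuous_measurable_fun.
exact: integrable_gaussian.
Qed.

(** Half of the Gaussian absorbs the power, by y^n <= n! exp y at y = a x^2 / 2. *)
Lemma gaussian_moment_le n a x : 0 < a ->
  (x ^+ 2) ^+ n * expR (- a * x ^+ 2) <= n`!%:R * (2 / a) ^+ n * expR (- (a / 2) * x ^+ 2).
Proof.
move=> a0; have x2 : 0 <= x ^+ 2 by exact: sqr_ge0.
have y0 : 0 <= a / 2 * x ^+ 2 by rewrite mulr_ge0// divr_ge0// ltW.
have := expr_le_fact_expR n y0; rewrite exprMn => h.
have -> : expR (- a * x ^+ 2) = expR (- (a / 2 * x ^+ 2)) * expR (- (a / 2) * x ^+ 2).
  by rewrite -expRD; congr expR; field.
rewrite mulrA ler_wpM2r ?expR_ge0//.
have p0 : 0 < (2 / a) ^+ n by rewrite exprn_gt0// divr_gt0.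
have e1 : (2 / a) ^+ n * (a / 2) ^+ n = 1.
  by rewrite -exprMn (_ : 2 / a * (a / 2) = 1) ?expr1n//; field; rewrite gt_eqF.
have := ler_wpM2l (ltW p0) h; rewrite mulrA e1 mul1r => h2.
have := ler_wpM2r (expR_ge0 (- (a / 2 * x ^+ 2))) h2 => /le_trans; apply.
by rewrite mulrA -mulrA -expRD subrr expR0 mulr1 mulrC.
Qed.

Lemma continuous_moment e n a : continuous e ->
  continuous (fun x => e x * (x ^+ 2) ^+ n * expR (- a * x ^+ 2)).
Proof.
move=> ce x; apply: cvgM; last exact: continuous_gw.
apply: cvgM; first exact: ce.
apply: (@continuous_comp _ _ _ (fun x : R => x ^+ 2) (fun y : R => y ^+ n)); exact: exprn_continuous.
Qed.

Lemma integrable_moment e K n a : continuous e -> (forall x, `|e x| <= K) -> 0 < a ->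
  mu.-integrable setT (EFin \o (fun x => e x * (x ^+ 2) ^+ n * expR (- a * x ^+ 2))).
Proof.
move=> ce eK a0; have a2 : 0 < a / 2 by rewrite divr_gt0.
apply: (integrable_cont_dominated (K := K * (n`!%:R * (2 / a) ^+ n)) _ a2).
  exact: continuous_moment.
move=> x; have q0 : 0 <= (x ^+ 2) ^+ n by rewrite exprn_ge0// sqr_ge0.
rewrite !normrM (ger0_norm (expR_ge0 _)) (ger0_norm q0).
have h := gaussian_moment_le n x a0.
have p0 : 0 <= (x ^+ 2) ^+ n * expR (- a * x ^+ 2).
  by rewrite mulr_ge0 ?expR_ge0.
have := ler_pM (normr_ge0 (e x)) p0 (eK x) h.
by rewrite [leLHS]mulrA [leRHS]mulrA.
Qed.

Variables (e : R -> R) (K : R).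
Hypotheses (ce : continuous e) (eK : forall x, `|e x| <= K).

Local Notation mom n a := (\int[mu]_x (e x * (x ^+ 2) ^+ n * expR (- a * x ^+ 2))).

Let K0 : 0 <= K. Proof. exact: le_trans (normr_ge0 _) (eK 0). Qed.

Let sqX_ge0 (x : R) n : 0 <= (x ^+ 2) ^+ n.
Proof. by rewrite exprn_ge0// sqr_ge0. Qed.

Let ccst (c : R) : continuous (fun _ : R => c). Proof. by move=> x; exact: cvg_cst. Qed.

(** Differentiation under the integral in the parameter c, done by hand: the n-th moments at c - h
    and c both vanish, while their difference is h times the next moment up to h^2 D. The midpoint
    a' of a and c leaves room for the factor exp (h x^2) in the remainder. *)
Lemma moment_succ n a b : 0 < a ->
  (forall c, a < c < b -> mom n c = 0) -> forall c, a < c < b -> mom n.+1 c = 0.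
Proof.
move=> a0 H c /andP[ac cb].
pose a' := (a + c) / 2; have a'0 : 0 < a' by rewrite /a'; lra.
have c0 : 0 < c by lra.
have intK : mu.-integrable setT (EFin \o (fun x => K * (x ^+ 2) ^+ n.+2 * expR (- a' * x ^+ 2))).
  by apply: integrable_moment => // x; rewrite ger0_norm.
pose D := \int[mu]_x (K * (x ^+ 2) ^+ n.+2 * expR (- a' * x ^+ 2)).
have D0 : 0 <= D.
  by apply: Rintegral_ge0 => x _; exact: mulr_ge0 (mulr_ge0 K0 (sqX_ge0 _ _)) (expR_ge0 _).
have main h : 0 < h -> h < c - a' -> `|mom n.+1 c| <= h * D.
  move=> h0 hc; have ch0 : 0 < c - h by lra.
  have i1 := integrable_moment n ce eK ch0.
  have i2 := integrable_moment n ce eK c0.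
  have i3 := integrable_moment n.+1 ce eK c0.
  have z1 : mom n (c - h) = 0 by apply: H; rewrite /a' in hc; lra.
  have z2 : mom n c = 0 by apply: H; rewrite ac.
  pose r x := e x * (x ^+ 2) ^+ n * expR (- (c - h) * x ^+ 2) -
    e x * (x ^+ 2) ^+ n * expR (- c * x ^+ 2) -
    h * (e x * (x ^+ 2) ^+ n.+1 * expR (- c * x ^+ 2)).
  have i4 : mu.-integrable setT (EFin \o (fun x => h * (e x * (x ^+ 2) ^+ n.+1 * expR (- c * x ^+ 2)))).
    by have := integrableZl (measurableT : measurable [set: measurableTypeR R]) h i3.
  have i5 : mu.-integrable setT (EFin \o (fun x => e x * (x ^+ 2) ^+ n * expR (- (c - h) * x ^+ 2) -
    e x * (x ^+ 2) ^+ n * expR (- c * x ^+ 2))).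
    by have := integrableB (measurableT : measurable [set: measurableTypeR R]) i1 i2.
  have ir : mu.-integrable setT (EFin \o r).
    by have := integrableB (measurableT : measurable [set: measurableTypeR R]) i5 i4.
  have er : \int[mu]_x r x = - (h * mom n.+1 c).
    rewrite /r RintegralB// RintegralB// RintegralZl// z1 z2; ring.
  have i6 : mu.-integrable setT (EFin \o (fun x => h ^+ 2 * (K * (x ^+ 2) ^+ n.+2 * expR (- a' * x ^+ 2)))).
    by have := integrableZl (measurableT : measurable [set: measurableTypeR R]) (h ^+ 2) intK.
  have : `|\int[mu]_x r x| <= \int[mu]_x (h ^+ 2 * (K * (x ^+ 2) ^+ n.+2 * expR (- a' * x ^+ 2))).
    apply: norm_Rintegral_le => // x.
    have x2 := sqr_ge0 x.
    have t0 : 0 <= h * x ^+ 2 by rewrite mulr_ge0// ltW.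
    have /andP[l1 l2] := expR_second_order t0.
    have -> : r x = e x * (x ^+ 2) ^+ n * ((expR (h * x ^+ 2) - 1 - h * x ^+ 2) * expR (- c * x ^+ 2)).
      rewrite /r [_ ^+ n.+1]exprS (_ : - (c - h) * x ^+ 2 = h * x ^+ 2 + - c * x ^+ 2); last by ring.
      by rewrite expRD; ring.
    have A0 := mulr_ge0 l1 (expR_ge0 (- c * x ^+ 2)).
    rewrite normrM (ger0_norm A0) normrM (ger0_norm (sqX_ge0 x n)).
    have k1 : (expR (h * x ^+ 2) - 1 - h * x ^+ 2) * expR (- c * x ^+ 2) <=
        (h * x ^+ 2) ^+ 2 * expR (- a' * x ^+ 2).
      rewrite (le_trans (ler_wpM2r (expR_ge0 _) l2))// -mulrA -expRD.
      rewrite ler_wpM2l ?exprn_ge0// ler_expR -mulrDl ler_wpM2r//; lra.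
    have k2 := ler_pM (mulr_ge0 (normr_ge0 (e x)) (sqX_ge0 x n)) A0
      (ler_wpM2r (sqX_ge0 x n) (eK x)) k1.
    rewrite (le_trans k2)//.
    rewrite le_eqVlt; apply/orP; left; apply/eqP.
    rewrite [_ ^+ n.+2]exprS [_ ^+ n.+1]exprS; ring.
  rewrite er normrN normrM (gtr0_norm h0) RintegralZl// -/D expr2 -mulrA ler_pM2l//.
apply/eqP; rewrite -normr_eq0 eq_le normr_ge0 andbT; apply/ler_addgt0Pr => d d0; rewrite add0r.
have D1 : 0 < D + 1 by lra.
pose h := Num.min ((c - a') / 2) (d / (D + 1)).
have h0 : 0 < h by rewrite lt_min !divr_gt0//; rewrite /a'; lra.
have hc : h < c - a'.
  rewrite gt_min; apply/orP; left; rewrite /a'; lra.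
rewrite (le_trans (main h h0 hc))// (@le_trans _ _ (h * (D + 1)))//.
  by rewrite ler_wpM2l ?(ltW h0)//; lra.
by rewrite -ler_pdivlMr// ge_min lexx orbT.
Qed.

(* (1 - b0 x^2 / n)^n tends to exp (- b0 x^2), and only involves moments at a0. *)
Lemma moment_extend (a0 b0 : R) : 0 < a0 -> (forall n, mom n a0 = 0) -> 0 <= b0 < a0 ->
  mom 0 (a0 + b0) = 0.
Proof.
move=> a00 H /andP[b00 ba].
have mR : measurable [set: measurableTypeR R] by [].
pose f c m n x := e x * (x ^+ 2) ^+ m * expR (- a0 * x ^+ 2) * (1 - c * x ^+ 2) ^+ n.
have fS c m n x : f c m n.+1 x = f c m n x - c * f c m.+1 n x.
  by rewrite /f [_ ^+ n.+1]exprS [_ ^+ m.+1]exprS; ring.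
have fP c n m : mu.-integrable setT (EFin \o f c m n) /\ \int[mu]_x f c m n x = 0.
  elim: n m => [|n IH] m.
    have -> : f c m 0%N = fun x => e x * (x ^+ 2) ^+ m * expR (- a0 * x ^+ 2).
      by apply/funext => x; rewrite /f expr0 mulr1.
    by split; [exact: integrable_moment eK a00|exact: H].
  have -> : f c m n.+1 = fun x => f c m n x - c * f c m.+1 n x.
    by apply/funext => x; rewrite fS.
  have [i1 z1] := IH m; have [i2 z2] := IH m.+1.
  have i3 : mu.-integrable setT (EFin \o (fun x => c * f c m.+1 n x)).
    by have := integrableZl mR c i2.
  split; first by have := integrableB mR i1 i3.
  by rewrite RintegralB// RintegralZl// z1 z2 mulr0 subr0.
have ab0 : 0 < a0 - b0 by lra.
have ab1 : 0 < a0 + b0 by lra.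
have intK : mu.-integrable setT (EFin \o (fun x => K * (x ^+ 2) ^+ 2 * expR (- (a0 - b0) * x ^+ 2))).
  by apply: integrable_moment => // x; rewrite ger0_norm.
pose D := \int[mu]_x (K * (x ^+ 2) ^+ 2 * expR (- (a0 - b0) * x ^+ 2)).
have D0 : 0 <= D.
  by apply: Rintegral_ge0 => x _; exact: mulr_ge0 (mulr_ge0 K0 (sqX_ge0 _ _)) (expR_ge0 _).
have main n : `|mom 0 (a0 + b0)| <= b0 ^+ 2 * D / n.+1%:R.
  pose c := b0 / n.+1%:R; have [i1 z1] := fP c n.+1 0%N.
  have i2 := integrable_moment 0 ce eK ab1.
  have -> : mom 0 (a0 + b0) = \int[mu]_x (e x * (x ^+ 2) ^+ 0 * expR (- (a0 + b0) * x ^+ 2) - f c 0%N n.+1 x).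
    by rewrite RintegralB// z1 subr0.
  have iD : mu.-integrable setT (EFin \o (fun x => e x * (x ^+ 2) ^+ 0 * expR (- (a0 + b0) * x ^+ 2) - f c 0%N n.+1 x)).
    by have := integrableB mR i2 i1.
  have iK : mu.-integrable setT (EFin \o (fun x => b0 ^+ 2 / n.+1%:R * (K * (x ^+ 2) ^+ 2 * expR (- (a0 - b0) * x ^+ 2)))).
    by have := integrableZl mR (b0 ^+ 2 / n.+1%:R) intK.
  rewrite mulrAC -RintegralZl//; apply: norm_Rintegral_le => // x.
  have x2 := sqr_ge0 x; have t0 : 0 <= b0 * x ^+ 2 by rewrite mulr_ge0.
  have -> : e x * (x ^+ 2) ^+ 0 * expR (- (a0 + b0) * x ^+ 2) - f c 0%N n.+1 x =
      e x * expR (- a0 * x ^+ 2) * (expR (- (b0 * x ^+ 2)) - (1 - b0 * x ^+ 2 / n.+1%:R) ^+ n.+1).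
    rewrite /f expr0 !mulr1 (_ : - (a0 + b0) * x ^+ 2 = - a0 * x ^+ 2 + - (b0 * x ^+ 2)); last by ring.
    have -> : b0 * x ^+ 2 / n.+1%:R = c * x ^+ 2 by rewrite /c mulrAC.
    by rewrite expRD; set P := _ ^+ n.+1; ring.
  rewrite normrM normrM (ger0_norm (expR_ge0 _)).
  have h := expRN_limit_rate n t0.
  have h2 := ler_pM (mulr_ge0 (normr_ge0 (e x)) (expR_ge0 (- a0 * x ^+ 2))) (normr_ge0 _)
    (ler_wpM2r (expR_ge0 (- a0 * x ^+ 2)) (eK x)) h.
  rewrite (le_trans h2)// le_eqVlt; apply/orP; left; apply/eqP.
  have -> : - (a0 - b0) * x ^+ 2 = - a0 * x ^+ 2 + b0 * x ^+ 2 by ring.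
  rewrite expRD exprMn; ring.
apply/eqP; rewrite -normr_eq0 eq_le normr_ge0 andbT; apply/ler_addgt0Pr => d d0; rewrite add0r.
pose B := b0 ^+ 2 * D; have B0 : 0 <= B by rewrite mulr_ge0// sqr_ge0.
rewrite (le_trans (main (Num.truncn (B / d))))// ler_pdivrMr// (mulrC d) -ler_pdivrMr// ltW//.
exact: truncnS_gt.
Qed.

(** [moment_succ] supplies all moments at a point a1 of the interval, and from these [moment_extend]
    reaches every parameter below 2 a1. Alternating, the right end of the interval grows by the
    factor 3/2 until it passes c. *)
Lemma moments_vanish a b : 0 < a -> a < b -> (forall c, a < c < b -> mom 0 c = 0) ->
  forall n c, a < c -> mom n c = 0.
Proof.
move=> a0 ab H.
have allm b' : (forall c, a < c < b' -> mom 0 c = 0) -> forall n c, a < c < b' -> mom n c = 0.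
  by move=> H' n; elim: n => [//|n IH]; apply: moment_succ a0 IH.
have ext k : forall c, a < c < b * (3 / 2) ^+ k -> mom 0 c = 0.
  elim: k => [|k IH] c /andP[ac cb]; first by apply: H; rewrite ac; move: cb; rewrite expr0 mulr1.
  set b' := b * (3 / 2) ^+ k in IH.
  have cb' : c < b' * (3 / 2) by rewrite /b' -mulrA -exprSr.
  have ab' : a < b'.
    rewrite /b' (lt_le_trans ab)// ler_peMr ?(ltW (lt_trans a0 ab))// exprn_ege1//; lra.
  have [cb2|b'c] := ltP c b'; first by apply: IH; rewrite ac.
  (* A point between a and b' that exceeds 3/4 b', so that 2 a1 exceeds the new right end 3/2 b'. *)
  pose a1 := (Num.max a (3 / 4 * b') + b') / 2.
  have m1 : a <= Num.max a (3 / 4 * b') by rewrite le_max lexx.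
  have m2 : 3 / 4 * b' <= Num.max a (3 / 4 * b') by rewrite le_max lexx orbT.
  have m3 : Num.max a (3 / 4 * b') < b' by rewrite gt_max ab' /=; lra.
  have h1 : 0 < a1 by rewrite /a1; lra.
  have h2 n : mom n a1 = 0 by apply: (allm _ IH); rewrite /a1; lra.
  have h3 : 0 <= c - a1 < a1 by rewrite /a1; lra.
  by have := moment_extend h1 h2 h3; rewrite [a1 + _]addrC subrK.
move=> n c ac.
pose k := Num.truncn (2 * c / b).
have b0 : 0 < b by lra.
have kb : c < b * (3 / 2) ^+ k.+1.
  have h : 1 + k.+1%:R / 2 <= (3 / 2) ^+ k.+1 :> R.
    elim: (k.+1) => [|j IH]; first by rewrite mul0r addr0 expr0.
    by rewrite exprSr -natr1; have := ler0n R j; nra.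
  have h2 : 2 * c / b < k.+1%:R by exact: truncnS_gt.
  rewrite ltr_pdivrMr// in h2.
  have := ler_wpM2l (ltW b0) h; nra.
by apply: (allm _ (ext k.+1)); rewrite ac.
Qed.

End GaussianMoments.

(** * Uniqueness on the line by Laplace's peak method *)

Section GaussianUniqueness.
Context {R : realType}.
Local Notation mu := (@lebesgue_measure R).
Implicit Types (e : R -> R).

(** Monotonicity of y exp (- y / v) on each side of its peak at v, obtained from 1 + x <= exp x
    instead of a derivative. *)
Lemma gamma_profile_le (v y1 y2 : R) : 0 < v -> 0 <= y1 ->
  (y1 <= y2 <= v) || (v <= y2 <= y1) ->
  y1 * expR (- (y1 / v)) <= y2 * expR (- (y2 / v)).
Proof.
move=> v0 y10 hy.
have y20 : 0 <= y2 by case/orP: hy => /andP[? ?]; lra.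
have h := expR_ge1Dx ((y1 - y2) / v).
have hm : y1 <= y2 * expR ((y1 - y2) / v).
  apply: le_trans (ler_wpM2l y20 h).
  have : y1 - y2 <= y2 * ((y1 - y2) / v).
    rewrite mulrA ler_pdivlMr//; case/orP: hy => /andP[? ?]; nra.
  lra.
apply: le_trans (ler_wpM2r (expR_ge0 _) hm) _.
by rewrite -mulrA -expRD ler_wpM2l// ler_expR mulrBl; lra.
Qed.

Lemma gamma_profile_lt (v y : R) : 0 < v -> y != v ->
  y * expR (- (y / v)) < v * expR (- 1).
Proof.
move=> v0 yv.
have h : 1 + (y - v) / v < expR ((y - v) / v).
  by apply: expR_gt1Dx; rewrite mulf_neq0 ?subr_eq0// invr_eq0 gt_eqF.
have -> : expR (- 1) = expR ((y - v) / v) * expR (- (y / v)) :> R.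
  by rewrite -expRD; congr expR; field; rewrite gt_eqF.
rewrite mulrA ltr_pM2r ?expR_gt0// -ltr_pdivrMl// (le_lt_trans _ h)//.
by rewrite le_eqVlt; apply/orP; left; apply/eqP; field; rewrite gt_eqF.
Qed.

(* x^2 exp (- x^2 / u^2) is maximal exactly at u and - u, so its powers, whose
   integrals against e vanish, isolate e u + e (- u). *)
Lemma gaussian_uniqueness_pos e K (a b u : R) : continuous e -> (forall x, `|e x| <= K) ->
  0 < a -> a < b ->
  (forall c, a < c < b -> \int[mu]_x (e x * expR (- c * x ^+ 2)) = 0) ->
  0 < u -> e u + e (- u) <= 0.
Proof.
move=> ce eK a0 ab H u0; rewrite leNgt; apply/negP => eta0.
pose E x := e x + e (- x); set eta := E u in eta0.
have mR : measurable [set: measurableTypeR R] by [].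
have K0 : 0 <= K by exact: le_trans (normr_ge0 _) (eK 0).
have cN : continuous (fun x : R => e (- x)).
  by move=> x; apply: (@continuous_comp _ _ _ (-%R) e); [exact: opp_continuous|exact: ce].
have cE : continuous E by move=> x; apply: cvgD; [exact: ce|exact: cN].
have EK x : `|E x| <= 2 * K by rewrite (le_trans (ler_normD _ _))// mulr_natl mulr2n lerD.
have H' n c : a < c -> \int[mu]_x (e x * (x ^+ 2) ^+ n * expR (- c * x ^+ 2)) = 0.
  apply: (moments_vanish ce eK a0 ab) => c' hc'; rewrite -(H c' hc').
  by apply: eq_Rintegral => x _; rewrite expr0 mulr1.
pose v := u ^+ 2; have v0 : 0 < v by rewrite exprn_gt0.
pose h x : R := x ^+ 2 * expR (- (x ^+ 2 / v)).
have h_ge0 x : 0 <= h x by rewrite mulr_ge0 ?sqr_ge0 ?expR_ge0.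
have hn n x : h x ^+ n = (x ^+ 2) ^+ n * expR (- (n%:R / v) * x ^+ 2).
  rewrite exprMn -expRM_natl; congr (_ * expR _); ring.
have iE n : (0 < n)%N -> mu.-integrable setT (EFin \o (fun x => E x * h x ^+ n)).
  move=> n0; have c0 : 0 < n%:R / v by rewrite divr_gt0 ?ltr0n.
  have -> : (fun x => E x * h x ^+ n) = fun x => E x * (x ^+ 2) ^+ n * expR (- (n%:R / v) * x ^+ 2).
    by apply/funext => x; rewrite hn mulrA.
  exact: integrable_moment cE EK c0.
have ih n : (0 < n)%N -> mu.-integrable setT (EFin \o (fun x => h x ^+ n)).
  move=> n0; have c0 : 0 < n%:R / v by rewrite divr_gt0 ?ltr0n.
  have -> : (fun x => h x ^+ n) = fun x => cst 1 x * (x ^+ 2) ^+ n * expR (- (n%:R / v) * x ^+ 2).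
    by apply/funext => x; rewrite hn mul1r.
  have c1 : continuous (cst (1 : R) : R -> R) by move=> x; exact: cvg_cst.
  by apply: (integrable_moment (K := 1)) => // x; rewrite normr1.
have zE n : a < n%:R / v -> \int[mu]_x (E x * h x ^+ n) = 0.
  move=> an; have c0 : 0 < n%:R / v by lra.
  pose f x := e x * (x ^+ 2) ^+ n * expR (- (n%:R / v) * x ^+ 2).
  have i1 : mu.-integrable setT (EFin \o f) by exact: integrable_moment ce eK c0.
  have i2 : mu.-integrable setT (EFin \o (fun x => f (- x))).
    have := integrable_moment n cN (fun x => eK (- x)) c0.
    by congr (_.-integrable _ (EFin \o _)); apply/funext => x; rewrite /f sqrrN.
  have -> : (fun x => E x * h x ^+ n) = fun x => f x + f (- x).
    by apply/funext => x; rewrite hn /f /E sqrrN; ring.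
  by rewrite RintegralD// Rintegral_reflect// H' ?addr0.
have [d d0 Hd] : exists2 d : R, 0 < d & forall x, `|u - x| < d -> eta / 2 <= E x.
  have e2 : 0 < eta / 2 by rewrite divr_gt0.
  have /cvgrPdist_le/(_ _ e2)[d /= d0 Hd] := cE u.
  by exists d => // x /Hd; rewrite ler_norml -/eta; lra.
pose del := Num.min (d / 2) (u / 2).
have del0 : 0 < del by rewrite lt_min !divr_gt0.
have del_d : del < d by rewrite gt_min; apply/orP; left; lra.
have del_u : del < u by rewrite gt_min; apply/orP; right; lra.
have EN x : E (- x) = E x by rewrite /E opprK addrC.
have near_E x : `|u - `|x| | <= del -> eta / 2 <= E x.
  have [x0|x0] := leP 0 x; first by rewrite (ger0_norm x0) => hx; apply/Hd/(le_lt_trans hx).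
  by rewrite (ltr0_norm x0) => hx; rewrite -EN; apply/Hd/(le_lt_trans hx).
pose Hf y : R := y * expR (- (y / v)).
(* [Hf] is [h] as a function of x^2. By monotonicity on both sides of the peak, [q] bounds [h]
   wherever |x| is farther than [del] from u, and it lies strictly below the peak value. *)
pose q := Num.max (Hf ((u - del) ^+ 2)) (Hf ((u + del) ^+ 2)).
have Hv : Hf v = v * expR (- 1) by rewrite /Hf divff// gt_eqF.
have qH : q < Hf v.
  rewrite Hv gt_max; apply/andP; split; apply: gamma_profile_lt => //; rewrite /v.
    by rewrite lt_eqF// ltr_sqr ?nnegrE; lra.
  by rewrite gt_eqF// ltr_sqr ?nnegrE; lra.
have q0 : 0 < q.
  by rewrite lt_max; apply/orP; right; rewrite mulr_gt0 ?expR_gt0// exprn_gt0//; lra.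
have far x : del < `|u - `|x| | -> h x <= q.
  have x0 := normr_ge0 x; rewrite /h -(real_normK (num_real x)) -/(Hf _) => hx.
  have [xu|xu] := leP `|x| u.
    rewrite le_max; apply/orP; left; apply: gamma_profile_le => //.
    apply/orP; left; rewrite ger0_norm in hx; last by lra.
    by apply/andP; split; rewrite ler_sqr ?nnegrE; lra.
  rewrite le_max; apply/orP; right; apply: gamma_profile_le => //.
  apply/orP; right; rewrite ltr0_norm in hx; last by lra.
  by apply/andP; split; rewrite ler_sqr ?nnegrE; lra.
pose q2 := (q + Hf v) / 2.
have ch : continuous h.
  move=> x; apply: cvgM; first exact: exprn_continuous.
  apply: (@continuous_comp _ _ _ (fun x : R => - (x ^+ 2 / v)) expR); last exact: continuous_expR.
  by apply: cvgN; apply: cvgM; [exact: exprn_continuous|exact: cvg_cst].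
have hu : h u = Hf v by [].
have [d' d'0 Hd'] : exists2 d' : R, 0 < d' & forall x, `|u - x| < d' -> q2 <= h x.
  have e2 : 0 < Hf v - q2 by rewrite /q2; lra.
  have /cvgrPdist_le/(_ _ e2)[d' /= d'0 Hd'] := ch u.
  by exists d' => // x /Hd'; rewrite ler_norml hu; lra.
pose s := Num.min (d' / 2) del; have s0 : 0 < s by rewrite lt_min divr_gt0.
have s_d' : s < d' by rewrite gt_min; apply/orP; left; lra.
have s_del : s <= del by rewrite ge_min lexx orbT.
pose J : set R := `[u - s, u + s]%classic.
have mJ : measurable J by exact: measurable_itv.
have iJ : mu.-integrable setT (EFin \o (\1_J : R -> R)) by exact: integrable_indic_itv.
have vJ : \int[mu]_x (\1_J x) = 2 * s.
  rewrite /Rintegral integral_indic// setIT.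
  have muJ : mu J = ((u + s) - (u - s))%:E.
    apply: etrans (lebesgue_measure_itv (Interval (BLeft (u - s)) (BRight (u + s)))) _.
    by rewrite /= lte_fin ltrD2l gtrN// -EFinD.
  by apply: etrans (congr1 fine muJ) _ => /=; ring.
(* For n >= n0 the parameter n / v exceeds a, so that the integral of E h^n is one of the vanishing
   moments. *)
pose n0 := (Num.truncn (a * v)).+1.
have an0 n : (n0 <= n)%N -> a < n%:R / v.
  by move=> nn; rewrite ltr_pdivlMr// (lt_le_trans (truncnS_gt _))// ler_nat.
pose A := \int[mu]_x (h x ^+ n0).
have A0 : 0 <= A by apply: Rintegral_ge0 => x _; rewrite exprn_ge0.
have q2q : q < q2 by rewrite /q2; lra.
have main m : eta * s * q2 ^+ (n0 + m) <= 2 * K * q ^+ m * A.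
  have np : (0 < n0 + m)%N by rewrite addn_gt0.
  have i1 : mu.-integrable setT (EFin \o (fun x => eta / 2 * q2 ^+ (n0 + m) * \1_J x)).
    by have := integrableZl mR (eta / 2 * q2 ^+ (n0 + m)) iJ.
  have i2 : mu.-integrable setT (EFin \o (fun x => 2 * K * q ^+ m * h x ^+ n0)).
    by have := integrableZl mR (2 * K * q ^+ m) (ih n0 isT).
  have i3 : mu.-integrable setT (EFin \o (fun x => eta / 2 * q2 ^+ (n0 + m) * \1_J x - 2 * K * q ^+ m * h x ^+ n0)).
    by have := integrableB mR i1 i2.
  have : \int[mu]_x (eta / 2 * q2 ^+ (n0 + m) * \1_J x - 2 * K * q ^+ m * h x ^+ n0) <=
         \int[mu]_x (E x * h x ^+ (n0 + m)).
    apply: le_Rintegral => //; first exact: iE.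
    move=> x _; have hm : 0 <= 2 * K * q ^+ m * h x ^+ n0.
      by rewrite !mulr_ge0 ?exprn_ge0// ltW.
    have hnm : 0 <= h x ^+ (n0 + m) by rewrite exprn_ge0.
    have [hx|hx] := leP (`|u - `|x| |) del.
      have Ex := near_E x hx.
      have e1 : eta / 2 * h x ^+ (n0 + m) <= E x * h x ^+ (n0 + m) by rewrite ler_wpM2r.
      rewrite indicE; have [xJ|xJ] := boolP (x \in J); last first.
        rewrite mulr0 sub0r (le_trans _ e1)// (@le_trans _ _ 0) ?oppr_le0//.
        by rewrite mulr_ge0// divr_ge0// ltW.
      rewrite mulr1; move: xJ; rewrite inE /J /= in_itv/= => /andP[x1 x2].
      have q2h : q2 <= h x by apply: Hd'; rewrite ltr_norml; lra.
      have q2n : q2 ^+ (n0 + m) <= h x ^+ (n0 + m) by rewrite lerXn2r ?nnegrE//; lra.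
      rewrite (le_trans _ e1)// (le_trans (y := eta / 2 * q2 ^+ (n0 + m))) ?gerBl//.
      by rewrite ler_wpM2l// divr_ge0// ltW.
    have xJ : x \in J = false.
      apply/negP; rewrite inE /J /= in_itv/= => /andP[x1 x2].
      move: hx; rewrite (@ger0_norm _ x); last by lra.
      by rewrite ltNge => /negP; apply; rewrite ler_norml; lra.
    rewrite indicE xJ mulr0 sub0r.
    have hq := far x hx.
    have e1 : h x ^+ (n0 + m) <= q ^+ m * h x ^+ n0.
      rewrite exprD mulrC ler_wpM2r ?exprn_ge0// lerXn2r ?nnegrE// ltW//.
    have := EK x; rewrite ler_norml => /andP[e2 _].
    apply: le_trans (ler_wpM2r hnm e2).
    rewrite mulNr lerN2 -!mulrA !ler_wpM2l// -?mulrA//.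
  have l1 : \int[mu]_x (eta / 2 * q2 ^+ (n0 + m) * \1_J x) = eta / 2 * q2 ^+ (n0 + m) * (2 * s).
    by rewrite -vJ; exact: RintegralZl.
  have l2 : \int[mu]_x (2 * K * q ^+ m * h x ^+ n0) = 2 * K * q ^+ m * A.
    by apply: RintegralZl => //; exact: ih.
  rewrite zE ?an0 ?leq_addr// RintegralB// l1 l2 subr_le0.
  by apply: le_trans; rewrite le_eqVlt; apply/orP; left; apply/eqP; field.
have q2p : 0 < q2 by lra.
pose rho := q2 / q - 1.
have rho0 : 0 < rho by rewrite /rho subr_gt0 ltr_pdivlMr// mul1r.
have W0 : 0 < eta * s * q2 ^+ n0 by rewrite !mulr_gt0 ?exprn_gt0.
have bern m : eta * s * q2 ^+ n0 * (m%:R * rho) <= 2 * K * A.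
  have h1 := main m; rewrite exprD in h1.
  have h2 : 1 + m%:R * rho <= (1 + rho) ^+ m.
    elim: m {h1} => [|j IH]; first by rewrite mul0r addr0 expr0.
    by rewrite exprSr -natr1; have := mulr_ge0 (ler0n R j) (ltW rho0); nra.
  have e1 : q2 = q * (1 + rho) by rewrite /rho addrC subrK mulrCA divff ?mulr1// gt_eqF.
  have h3 : eta * s * q2 ^+ n0 * (1 + rho) ^+ m <= 2 * K * A.
    have qm : 0 < q ^+ m by rewrite exprn_gt0.
    rewrite -(ler_pM2r qm) -(mulrA _ (_ ^+ m)) -exprMn (mulrC (1 + rho)) -e1.
    by rewrite -(mulrA _ _ (q2 ^+ m)) (mulrAC (2 * K)).
  apply: le_trans h3; rewrite ler_pM2l//; lra.
pose m := (Num.truncn (2 * K * A / (eta * s * q2 ^+ n0 * rho))).+1.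
have : 2 * K * A / (eta * s * q2 ^+ n0 * rho) < m%:R by exact: truncnS_gt.
rewrite ltr_pdivrMr ?(mulr_gt0 W0 rho0)// ltNge => /negP; apply.
by rewrite mulrCA bern.
Qed.

(** The one-sided bound applied to e and - e gives equality for u > 0; symmetry in u and continuity
    at 0 do the rest. *)
Theorem gaussian_uniqueness e K (a b : R) : continuous e -> (forall x, `|e x| <= K) ->
  0 < a -> a < b ->
  (forall c, a < c < b -> \int[mu]_x (e x * expR (- c * x ^+ 2)) = 0) ->
  forall u, e u + e (- u) = 0.
Proof.
move=> ce eK a0 ab H.
have pos u : 0 < u -> e u + e (- u) = 0.
  move=> u0; apply/eqP; rewrite eq_le (gaussian_uniqueness_pos ce eK a0 ab H u0) /=.
  have cN : continuous (fun x => - e x) by move=> x; apply: cvgN; exact: ce.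
  have eKN x : `|- e x| <= K by rewrite normrN.
  have HN c : a < c < b -> \int[mu]_x (- e x * expR (- c * x ^+ 2)) = 0.
    move=> hc; have c0 : 0 < c by move/andP: hc => [? ?]; lra.
    have i1 := integrable_moment 0 ce eK c0.
    have -> : (fun x => - e x * expR (- c * x ^+ 2)) =
        fun x => -1 * (e x * (x ^+ 2) ^+ 0 * expR (- c * x ^+ 2)).
      by apply/funext => x; rewrite expr0 mulr1 mulN1r mulNr.
    rewrite RintegralZl// (_ : (\int[_]_x _) = 0) ?mulr0// -(H c hc).
    by apply: eq_Rintegral => x _; rewrite expr0 mulr1.
  by have := gaussian_uniqueness_pos cN eKN a0 ab HN u0; lra.
move=> u; have [u0|u0|<-] := ltgtP 0 u; first exact: pos.
  by have := pos (- u); rewrite oppr_gt0 opprK addrC; apply.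
rewrite oppr0; apply/eqP; rewrite -normr_eq0 eq_le normr_ge0 andbT.
apply/ler_addgt0Pr => r r0; rewrite add0r.
have r2 : 0 < r / 2 by rewrite divr_gt0.
have /cvgrPdist_le/(_ _ r2)[d /= d0 Hd] := ce 0.
have d2 : 0 < d / 2 by rewrite divr_gt0.
have dd : d / 2 < d by lra.
have := Hd (d / 2); have := Hd (- (d / 2)); have := pos _ d2.
rewrite /ball_/= !sub0r !normrN (gtr0_norm d2) => h0 /(_ dd) h1 /(_ dd) h2.
have -> : e 0 + e 0 = (e 0 - e (d / 2)) + (e 0 - e (- (d / 2))) by lra.
by rewrite (le_trans (ler_normD _ _))// (splitr r) lerD.
Qed.

End GaussianUniqueness.

(** * Gaussian integrals over the plane *)

Section PlaneGaussian.
Context {R : realType}.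
Local Notation mu := (@lebesgue_measure R).
Local Notation plane := (@plane_measure R).
Implicit Types (f F : R * R -> R) (al s : R * R).

Lemma gaussianE al x y :
  gaussian al (x, y) = expR (- al.1 * x ^+ 2) * expR (- al.2 * y ^+ 2).
Proof. by rewrite /gaussian -expRD /= (mulNr al.2). Qed.

Lemma continuous_gaussian al : continuous (gaussian al).
Proof.
move=> s; apply: (@continuous_comp _ _ _
  (fun s : R * R => - al.1 * s.1 ^+ 2 - al.2 * s.2 ^+ 2) expR); last exact: continuous_expR.
apply: cvgB; apply: cvgM; try exact: cvg_cst.
  by apply: (@continuous_comp _ _ _ fst (fun x : R => x ^+ 2)); [exact: cvg_fst|exact: exprn_continuous].
by apply: (@continuous_comp _ _ _ snd (fun x : R => x ^+ 2)); [exact: cvg_snd|exact: exprn_continuous].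
Qed.

Lemma integrable_plane_gaussian al : 0 < al.1 -> 0 < al.2 ->
  plane.-integrable setT (EFin \o gaussian al).
Proof.
move=> a1 a2; apply/integrable12ltyP.
  by apply/measurable_EFinP; apply: continuous_measurable_prod; exact: continuous_gaussian.
have i1 := integrable_gaussian a1; have i2 := integrable_gaussian a2.
pose W := \int[mu]_y (expR (- al.2 * y ^+ 2)).
have e x : (\int[mu]_y `|(EFin \o gaussian al) (x, y)| = (expR (- al.1 * x ^+ 2) * W)%:E)%E.
  transitivity (\int[mu]_y ((expR (- al.1 * x ^+ 2))%:E * (EFin \o (fun y => expR (- al.2 * y ^+ 2))) y))%E.
    by apply: eq_integral => y _ /=; rewrite gaussianE ger0_norm ?mulr_ge0 ?expR_ge0.
  rewrite integralZl// EFinM /W /Rintegral fineK//.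
  exact: integrable_fin_num.
under eq_integral do rewrite e.
have /integrable_lty : mu.-integrable setT (EFin \o (fun x => expR (- al.1 * x ^+ 2) * W)).
  apply: (@integrable_cont_dominated _ _ `|W| al.1) => //.
    move=> x; apply: cvgM; last exact: cvg_cst.
    exact: continuous_gw.
  by move=> x; rewrite normrM ger0_norm ?expR_ge0// mulrC.
exact.
Qed.

Lemma Rintegral_plane f : plane.-integrable setT (EFin \o f) ->
  (forall x, mu.-integrable setT (EFin \o (fun y => f (x, y)))) ->
  \int[plane]_s f s = \int[mu]_x \int[mu]_y f (x, y).
Proof.
move=> fi fx; rewrite /Rintegral -integral12_prod_meas1//; congr fine.
apply: eq_integral => x _; rewrite fineK//.
by apply: integrable_fin_num => //; exact: fx.
Qed.

(** Closeness on a large square together with boundedness outside it, as well as a small Lipschitz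
    constant, amount to domination by a small multiple of this weight, which Gaussians still
    integrate. *)
Definition linear_weight s : R := 1 + (`|s.1| + `|s.2|).

Lemma linear_weight_gaussian (a t : R) : 0 < a ->
  1 + `|t| <= (2 + 2 / a) * expR (a / 2 * t ^+ 2).
Proof.
move=> a0; have h := expR_ge1Dx (a / 2 * t ^+ 2).
have a2 : 0 < 2 / a by rewrite divr_gt0.
have c0 : 0 < 2 + 2 / a by rewrite addr_gt0.
apply: le_trans (ler_wpM2l (ltW c0) h).
have e : 2 / a * (a / 2 * t ^+ 2) = t ^+ 2 by field; rewrite gt_eqF.
have : 0 <= a / 2 * t ^+ 2 by rewrite mulr_ge0 ?sqr_ge0// divr_ge0// ltW.
have := sqr_ge0 (`|t| - 1); rewrite -(real_normK (num_real t)) in e *; nra.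
Qed.

(** Half of each Gaussian factor absorbs the linear growth. The constant comes from the smallest
    parameters (a, c), hence it is uniform over all larger ones. *)
Lemma gaussian_integral_bound (a c : R) : 0 < a -> 0 < c -> exists2 C : R, 0 < C &
  forall f m al, continuous f -> (forall s, `|f s| <= m * linear_weight s) ->
    a <= al.1 -> c <= al.2 ->
    plane.-integrable setT (EFin \o (fun s => f s * gaussian al s)) /\
    `|\int[plane]_s (f s * gaussian al s)| <= m * C.
Proof.
move=> a0 c0; pose D := (2 + 2 / a) * (2 + 2 / c); pose h := (a / 2, c / 2).
have ih : plane.-integrable setT (EFin \o gaussian h).
  by apply: integrable_plane_gaussian; rewrite divr_gt0.
have Da : 0 < 2 + 2 / a by rewrite addr_gt0// divr_gt0.
have Dc : 0 < 2 + 2 / c by rewrite addr_gt0// divr_gt0.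
have D0 : 0 < D by rewrite mulr_gt0.
have dom al s : a <= al.1 -> c <= al.2 -> linear_weight s * gaussian al s <= D * gaussian h s.
  case: s => x y a1 c2; rewrite !gaussianE /linear_weight /=.
  have e1 (b b' t : R) : 0 < b -> b <= b' ->
      (1 + `|t|) * expR (- b' * t ^+ 2) <= (2 + 2 / b) * expR (- (b / 2) * t ^+ 2).
    move=> b0 bb; have -> : expR (- (b / 2) * t ^+ 2) = expR (b / 2 * t ^+ 2) * expR (- b * t ^+ 2).
      by rewrite -expRD; congr expR; field.
    rewrite [leRHS]mulrA; apply: ler_pM; rewrite ?expR_ge0 ?addr_ge0 ?linear_weight_gaussian//.
    by rewrite ler_expR !mulNr lerN2 ler_wpM2r ?sqr_ge0.
  apply: (@le_trans _ _ ((1 + `|x|) * expR (- al.1 * x ^+ 2) * ((1 + `|y|) * expR (- al.2 * y ^+ 2)))).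
    rewrite mulrACA ler_wpM2r ?mulr_ge0 ?expR_ge0//.
    by have := mulr_ge0 (normr_ge0 x) (normr_ge0 y); lra.
  by rewrite /D [leRHS]mulrACA; apply: ler_pM; rewrite ?mulr_ge0 ?addr_ge0 ?expR_ge0 ?e1.
pose W := \int[plane]_s gaussian h s.
have W0 : 0 <= W by apply: Rintegral_ge0 => s _; exact: expR_ge0.
exists (D * (W + 1)); first by rewrite mulr_gt0// ltr_wpDl.
move=> f m al cf fm a1 c2.
have m0 : 0 <= m by have := fm (0, 0); rewrite /linear_weight /= normr0 !addr0 mulr1; exact: le_trans.
have fb s : `|f s * gaussian al s| <= m * D * gaussian h s.
  rewrite normrM (ger0_norm (expR_ge0 _)) -mulrA.
  apply: (@le_trans _ _ (m * linear_weight s * gaussian al s)).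
    by rewrite ler_wpM2r ?expR_ge0.
  by rewrite -mulrA ler_wpM2l// dom.
have cfg : continuous (fun s => f s * gaussian al s).
  by move=> s; apply: cvgM; [exact: cf|exact: continuous_gaussian].
have ifg : plane.-integrable setT (EFin \o (fun s => f s * gaussian al s)).
  apply: integrable_dominated ih fb; exact: continuous_measurable_prod.
split => //.
have ig : plane.-integrable setT (EFin \o (fun s => m * D * gaussian h s)).
  apply: (@integrable_dominated _ _ _ plane _ (gaussian h) (m * D)) => //.
    by apply: continuous_measurable_prod => s; apply: cvgM; [exact: cvg_cst|exact: continuous_gaussian].
  by move=> s; rewrite ger0_norm// mulr_ge0 ?expR_ge0// mulr_ge0// ltW.
apply: le_trans (norm_Rintegral_le ifg ig fb) _.
rewrite RintegralZl// -/W [leRHS]mulrA ler_wpM2l ?lerDl//.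
by rewrite mulr_ge0// ltW.
Qed.

Lemma distance_bound_continuous (V : normedModType R) (f : V -> R) (B : R) :
  (forall x y, `|f y - f x| <= B * `|y - x|) -> continuous f.
Proof.
move=> fB p; apply/cvgrPdist_le => e e0.
have B0 : 0 < `|B| + 1 by rewrite ltr_wpDl.
have : nbhs p (ball p (e / (`|B| + 1))) by apply: nbhsx_ballx; rewrite divr_gt0.
apply: filterS => q; rewrite -ball_normE /ball_/= distrC ltr_pdivlMr// => hq.
rewrite distrC (le_trans (fB _ _))// (le_trans _ (ltW hq))// mulrC ler_wpM2l//.
by rewrite (le_trans (ler_norm _))// lerDl.
Qed.

Lemma lipschitz2_continuous F B : (forall p v, `|F (p + v) - F p| <= B * (`|v.1| + `|v.2|)) ->
  continuous F.
Proof.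
move=> FB; apply: (@distance_bound_continuous _ _ (`|B| * 2)) => p q.
rewrite {1}(_ : q = p + (q - p)); last by rewrite addrCA subrr addr0.
apply: le_trans (FB _ _) _; apply: (@le_trans _ _ (`|B| * (`|(q - p).1| + `|(q - p).2|))).
  by rewrite ler_wpM2r ?addr_ge0// ler_norm.
rewrite -mulrA ler_wpM2l// mulr_natl mulr2n lerD//.
  by rewrite prod_normE /= le_max lexx.
by rewrite prod_normE /= le_max lexx orbT.
Qed.

(** The one-dimensional theorem is applied twice. For a fixed second parameter the partial integral
    [H] over y is a bounded continuous function of x, and its even part vanishes; for fixed x this
    says that y -> F (x, y) + F (- x, y) has vanishing Gaussian integrals. *)
Lemma gaussian_uniqueness_plane F (K B a b c d : R) : (forall s, `|F s| <= K) ->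
  (forall p v, `|F (p + v) - F p| <= B * (`|v.1| + `|v.2|)) ->
  0 < a -> a < b -> 0 < c -> c < d ->
  (forall al, a < al.1 < b -> c < al.2 < d -> \int[plane]_s (F s * gaussian al s) = 0) ->
  forall x y, F (x, y) + F (- x, y) + (F (x, - y) + F (- x, - y)) = 0.
Proof.
move=> FK FB a0 ab c0 cd FG.
have Fx x x' y : `|F (x', y) - F (x, y)| <= B * `|x' - x|.
  have := FB (x, y) (x' - x, 0); rewrite /= normr0 addr0.
  by rewrite (_ : (x, y) + (x' - x, 0) = (x', y))//; congr pair; rewrite /= ?addr0// addrCA subrr addr0.
have Fy x y y' : `|F (x, y') - F (x, y)| <= B * `|y' - y|.
  have := FB (x, y) (0, y' - y); rewrite /= normr0 add0r.
  by rewrite (_ : (x, y) + (0, y' - y) = (x, y'))//; congr pair; rewrite /= ?addr0// addrCA subrr addr0.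
have cFy x : continuous (fun y => F (x, y)) by apply: distance_bound_continuous; exact: Fy.
have iF be2 x : 0 < be2 -> mu.-integrable setT (EFin \o (fun y => F (x, y) * expR (- be2 * y ^+ 2))).
  move=> al0; apply: (@integrable_cont_dominated _ _ K be2) => //.
    by move=> y; apply: cvgM; [exact: cFy|exact: continuous_gw].
  by move=> y; rewrite normrM (ger0_norm (expR_ge0 _)) ler_wpM2r ?expR_ge0.
pose H be2 x := \int[mu]_y (F (x, y) * expR (- be2 * y ^+ 2)).
have H_le be2 (D : R) (h : R -> R) : 0 < be2 -> continuous h -> (forall y, `|h y| <= D) ->
    `|\int[mu]_y (h y * expR (- be2 * y ^+ 2))| <= D * \int[mu]_y (expR (- be2 * y ^+ 2)).
  move=> al0 cf fD.
  have cfg : continuous (fun y => h y * expR (- be2 * y ^+ 2)).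
    by move=> y; apply: cvgM; [exact: cf|exact: continuous_gw].
  have fle y : `|h y * expR (- be2 * y ^+ 2)| <= D * expR (- be2 * y ^+ 2).
    by rewrite normrM (ger0_norm (expR_ge0 _)) ler_wpM2r ?expR_ge0.
  have ig := integrable_gaussian al0.
  have mR : measurable [set: measurableTypeR R] by [].
  rewrite -RintegralZl//; apply: norm_Rintegral_le => //.
    exact: integrable_cont_dominated cfg al0 fle.
  by have := integrableZl mR D ig.
have cH be2 : 0 < be2 -> continuous (H be2).
  move=> al0; pose W := \int[mu]_y (expR (- be2 * y ^+ 2)).
  apply: (@distance_bound_continuous _ _ (B * W)) => x x'.
  rewrite /H -RintegralB//; [|exact: iF|exact: iF].
  under eq_Rintegral do rewrite -mulrBl.
  rewrite [leRHS]mulrAC; apply: H_le => // y.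
  by apply: cvgB; exact: cFy.
have Hodd be2 x : c < be2 < d -> H be2 x + H be2 (- x) = 0.
  move=> /andP[h1 h2]; have al0 : 0 < be2 by exact: lt_trans h1.
  apply: (gaussian_uniqueness (cH be2 al0) (K := K * \int[mu]_y (expR (- be2 * y ^+ 2))) _ a0 ab).
    by move=> z; apply: H_le.
  move=> be1 hal1; rewrite -(FG (be1, be2)) ?h1//.
  have K0 : 0 <= K by exact: le_trans (FK (0, 0)).
  have [C C0 HC] := gaussian_integral_bound a0 c0.
  have := HC F K (be1, be2) (lipschitz2_continuous FB).
  move=> /(_ _ _ _)[|/=|/=|iFG _]; rewrite ?(ltW h1)//.
  - move=> s; apply: le_trans (FK s) _; rewrite ler_peMr//.
    by rewrite /linear_weight lerDl addr_ge0.
  - by apply: ltW; case/andP: hal1.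
  have mR : measurable [set: measurableTypeR R] by [].
  rewrite Rintegral_plane//; last first.
    move=> x'; have := integrableZl mR (expR (- be1 * x' ^+ 2)) (iF _ x' al0).
    by congr (_.-integrable _ (EFin \o _)); apply/funext => y; rewrite gaussianE mulrCA.
  apply: eq_Rintegral => x' _; rewrite /H -RintegralZr//; last exact: iF.
  by apply: eq_Rintegral => y _; rewrite gaussianE; ring.
move=> x y.
have cE : continuous (fun y => F (x, y) + F (- x, y)) by move=> y'; apply: cvgD; exact: cFy.
have EK y' : `|F (x, y') + F (- x, y')| <= K + K by rewrite (le_trans (ler_normD _ _))// lerD.
apply: (gaussian_uniqueness cE EK c0 cd) => be2 hbe2.
have al0 : 0 < be2 by case/andP: hbe2 => h1 _; exact: lt_trans h1.
rewrite -(Hodd be2 x hbe2) /H -RintegralD//; [|exact: iF|exact: iF].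
by apply: eq_Rintegral => y' _; rewrite mulrDl.
Qed.

End PlaneGaussian.

(** * Convolution with Gaussians *)

Section ComplexDifferentiability.
Context {R : realType}.
Implicit Types (F : R[i]^o -> R[i]^o) (z : R[i]^o).
Lemma derivable_cderiv F z : derivable F z 1 -> exists l, cderiv F z l.
Proof.
move=> /cvg_ex[l hl]; exists l => e e0; move: hl.
have ec : 0 < e%:C%C :> R[i] by rewrite ltcR.
move=> /cvgrPdist_le/(_ _ ec) [d /= d0 Hd].
exists (Re d).
  by move: d0; case: (d) => d1 d2 /=; rewrite ltcE/= => /andP[].
move=> h hd; have [->|h0] := eqVneq h 0; first by rewrite addr0 subrr mulr0 subr0 Normc.normc0 mulr0.
have dE : d = (Re d)%:C%C.
  by move: d0; case: (d) => d1 d2; rewrite ltcE /= => /andP[/eqP /= -> _].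
have hb : `|0 - h : R[i]| < d by rewrite sub0r normrN dE ltcR.
have := Hd h hb h0; rewrite lecR => hh.
have -> : F (z + h) - F z - l * h = - (h * (l - h^-1 * (F (z + h) - F z))).
  by field.
rewrite nmN nmM mulrC ler_wpM2r ?nm_ge0//.
move: hh; rewrite /GRing.scale /= mulr1 (addrC h).
exact.
Qed.
Lemma cderiv_derivable F z l : cderiv F z l -> differentiable F z.
Proof.
move=> dF; apply/derivable1_diffP; apply/cvg_ex; exists (l : R[i]^o).
apply/cvgrPdist_le => e e0.
have eE : e = (Re e)%:C%C by move: e0; case: (e) => e1 e2; rewrite ltcE /= => /andP[/eqP /= -> _].
have e1 : 0 < Re e by move: e0; rewrite {1}eE ltcR.
have [d d0 Hd] := dF _ e1.
exists d%:C%C => /=; first by rewrite ltcR.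
move=> h; have -> : ball_ [eta Num.Def.normr] 0 d%:C%C h = (`|0 - h : R[i]| < d%:C%C) by [].
rewrite sub0r normrN ltcR => hd h0.
rewrite eE [leLHS](_ : _ = (nm (l - h^-1 * (F (z + h) - F z)))%:C%C) ?lecR; last first.
  by rewrite /GRing.scale /= mulr1 (addrC h).
have := Hd h hd.
have -> : F (z + h) - F z - l * h = - (h * (l - h^-1 * (F (z + h) - F z))).
  by field.
by rewrite nmN nmM mulrC ler_pM2r// nm_gt0.
Qed.

Lemma bernstein_planar (s : R) (f : R[i]^o * R[i]^o -> R[i]^o) :
  bernstein s f -> planar s (real_restriction f).
Proof.
move=> [df [K fK]].
have idd z : differentiable (id : R[i]^o -> R[i]^o) z by exact: ex_diff.
have slice1 (y : R) : exp_type s (fun w => f (w, y%:C%C)).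
  split.
    move=> z; apply: derivable_cderiv; apply: diff_derivable.
    apply: (@differentiable_comp _ _ _ _ (fun w : R[i]^o => (w, y%:C%C : R[i]^o)) f); last exact: df.
    by apply: differentiable_pair; [exact: idd|exact: differentiable_cst].
  by exists K => z; have := fK (z, y%:C%C); rewrite /= normr0 addr0.
have slice2 (x : R) : exp_type s (fun w => f (x%:C%C, w)).
  split.
    move=> z; apply: derivable_cderiv; apply: diff_derivable.
    apply: (@differentiable_comp _ _ _ _ (fun w : R[i]^o => (x%:C%C : R[i]^o, w)) f); last exact: df.
    by apply: differentiable_pair; [exact: differentiable_cst|exact: idd].
  by exists K => z; have := fK (x%:C%C, z); rewrite /= normr0 add0r.
split.
- exists K => x; have := fK (x.1%:C%C, x.2%:C%C).
  by rewrite /= normr0 addr0 mulr0 expR0 mulr1.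
- by move=> y; exists (fun w => f (w, y%:C%C)).
- by move=> x; exists (fun w => f (x%:C%C, w)).
Qed.

End ComplexDifferentiability.

(** * Estimates for convolutions with Gaussians *)

Section Convolution.
Context {R : realType}.
Local Notation plane := (@plane_measure R).
Implicit Types (g h : R * R -> R[i]) (al x y v : R * R).

Definition bounded_lipschitz g := exists m : R, (forall p, nm (g p) <= m) /\
  forall p v, nm (g (p + v) - g p) <= m * (`|v.1| + `|v.2|).

Lemma planar_bounded_lipschitz (s : R) g : 0 <= s -> planar s g -> bounded_lipschitz g.
Proof.
move=> s0 pg; have [[m gm] _ _] := pg; have B0 := bernstein_const_gt0 s.
have m0 : 0 <= m by exact: le_trans (nm_ge0 _) (gm 0).
exists ((bernstein_const s + 1) * m); split => [p|p v].
  by rewrite (le_trans (gm p))// ler_peMl// lerDr ltW.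
apply: le_trans (planar_lipschitz s0 _ _ pg gm) _.
by rewrite ler_wpM2r ?addr_ge0// ler_wpM2r// lerDl.
Qed.

Lemma continuous_reflected g x : bounded_lipschitz g ->
  continuous (fun s : R * R => Re (g (x - s))) /\ continuous (fun s : R * R => Im (g (x - s))).
Proof.
move=> [m [_ gm]].
have H p v : nm (g (x - (p + v)) - g (x - p)) <= m * (`|v.1| + `|v.2|).
  by have := gm (x - p) (- v); rewrite /= !normrN opprD addrA.
split; apply: (@lipschitz2_continuous _ _ m) => p v.
  by apply: le_trans (H p v); rewrite -ReN -ReD; exact: Re_le_nm.
by apply: le_trans (H p v); rewrite -ImN -ImD; exact: Im_le_nm.
Qed.

Lemma gauss_convE g al x : gauss_conv g al x =
  ((\int[plane]_s (Re (g (x - s)) * gaussian al s)) +i*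
   (\int[plane]_s (Im (g (x - s)) * gaussian al s)))%C.
Proof.
rewrite /gauss_conv /complex_integral; congr (_ +i* _)%C; apply: eq_Rintegral => s _.
  by rewrite ReM /= mulr0 subr0.
by rewrite ImM /= mulr0 add0r.
Qed.

Lemma gauss_convZ g (c : R) al x : bounded_lipschitz g -> 0 < al.1 -> 0 < al.2 ->
  gauss_conv (fun p => c%:C%C * g p) al x = c%:C%C * gauss_conv g al x.
Proof.
move=> gbl a1 a2; have [cR cI] := continuous_reflected x gbl; have [m [gm _]] := gbl.
have m0 : 0 <= m by exact: le_trans (nm_ge0 _) (gm 0).
have [K K0 HK] := gaussian_integral_bound a1 a2.
have wl (z : R) p : z <= m -> z <= m * linear_weight p.
  by move=> zm; rewrite (le_trans zm)// ler_peMr// /linear_weight lerDl addr_ge0.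
have [iR _] := HK _ m al cR (fun s => wl _ s (le_trans (Re_le_nm _) (gm _))) (lexx _) (lexx _).
have [iI _] := HK _ m al cI (fun s => wl _ s (le_trans (Im_le_nm _) (gm _))) (lexx _) (lexx _).
rewrite !gauss_convE; apply: eq_ReIm; rewrite ?ReM ?ImM /= mul0r ?subr0 ?addr0 -RintegralZl//;
  by apply: eq_Rintegral => s _; rewrite ?ReM ?ImM /= mul0r ?subr0 ?addr0 mulrA.
Qed.

Lemma gauss_conv_shift g v al x :
  gauss_conv (fun p => g (p + v)) al x = gauss_conv g al (x + v).
Proof. by rewrite /gauss_conv; congr complex_integral; apply/funext => s; rewrite addrAC. Qed.

(** Two functions are compared at two different points because in the limit arguments both the
    functions and the sampling points move. [K] depends only on a and c. *)
Lemma gauss_conv_distance (a c : R) : 0 < a -> 0 < c -> exists2 K : R, 0 < K &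
  forall g h x y m al, bounded_lipschitz g -> bounded_lipschitz h ->
    (forall s, nm (g (x - s) - h (y - s)) <= m * linear_weight s) ->
    a <= al.1 -> c <= al.2 -> nm (gauss_conv g al x - gauss_conv h al y) <= m * K.
Proof.
move=> a0 c0; have [K K0 HK] := gaussian_integral_bound a0 c0.
exists (2 * K) => [|g h x y m al gbl hbl gh a1 c2]; first by rewrite mulr_gt0.
have [gR gI] := continuous_reflected x gbl; have [hR hI] := continuous_reflected y hbl.
have int k z : bounded_lipschitz k ->
    plane.-integrable setT (EFin \o (fun s => Re (k (z - s)) * gaussian al s)) /\
    plane.-integrable setT (EFin \o (fun s => Im (k (z - s)) * gaussian al s)).
  move=> kbl; have [cR cI] := continuous_reflected z kbl; have [n [kn _]] := kbl.
  have n0 : 0 <= n by exact: le_trans (nm_ge0 _) (kn 0).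
  have wl (t : R) p : t <= n -> t <= n * linear_weight p.
    by move=> tn; rewrite (le_trans tn)// ler_peMr// /linear_weight lerDl addr_ge0.
  split.
    by have [] := HK _ n al cR (fun s => wl _ s (le_trans (Re_le_nm _) (kn _))) a1 c2.
  by have [] := HK _ n al cI (fun s => wl _ s (le_trans (Im_le_nm _) (kn _))) a1 c2.
have [igR igI] := int g x gbl; have [ihR ihI] := int h y hbl.
rewrite !gauss_convE; apply: le_trans (nm_le_ReIm _) _.
rewrite /= mulrCA mulr_natl mulr2n; apply: lerD.
  rewrite -RintegralB//; under eq_Rintegral do rewrite -mulrBl.
  have [] // := HK (fun s => Re (g (x - s)) - Re (h (y - s))) m al.
    by move=> s; apply: cvgB; [exact: gR|exact: hR].
  by move=> s; apply: le_trans (gh s); rewrite -ReN -ReD; exact: Re_le_nm.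
rewrite -RintegralB//; under eq_Rintegral do rewrite -mulrBl.
have [] // := HK (fun s => Im (g (x - s)) - Im (h (y - s))) m al.
  by move=> s; apply: cvgB; [exact: gI|exact: hI].
by move=> s; apply: le_trans (gh s); rewrite -ImN -ImD; exact: Im_le_nm.
Qed.

Lemma gauss_conv0 al x : gauss_conv (fun=> 0 : R[i]) al x = 0.
Proof.
rewrite gauss_convE; apply: eq_ReIm => /=; rewrite /Rintegral integral0_eq// => s _;
  by rewrite mul0r.
Qed.

Lemma gauss_conv_bound (a c : R) : 0 < a -> 0 < c -> exists2 K : R, 0 < K &
  forall g x m al, bounded_lipschitz g -> (forall p, nm (g p) <= m) ->
    a <= al.1 -> c <= al.2 -> nm (gauss_conv g al x) <= m * K.
Proof.
move=> a0 c0; have [K K0 HK] := gauss_conv_distance a0 c0; exists K => // g x m al gbl gm a1 c2.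
have m0 : 0 <= m by exact: le_trans (nm_ge0 _) (gm 0).
have zbl : bounded_lipschitz (fun=> 0 : R[i]).
  by exists 0; split => [p|p v]; rewrite ?subr0 ?mul0r (_ : nm 0 = 0)// Normc.normc0.
have := HK g (fun=> 0) x x m al gbl zbl; rewrite gauss_conv0 subr0; apply => // s.
by rewrite subr0 (le_trans (gm _))// ler_peMr// /linear_weight lerDl addr_ge0.
Qed.

End Convolution.

(** * Condition (A) implies sampling *)

Section SampleNorm.
Context {R : realType}.
Variables (a b c d : R) (L : set (R * R)).
Hypotheses (a0 : 0 < a) (c0 : 0 < c).
Local Notation I := (`]a, b[%classic `*` `]c, d[%classic).
Implicit Types (g : R * R -> R[i]) (al l : R * R).

(** A real supremum dominates its elements only when the set is bounded; [gauss_conv_bound] gives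
    one bound for both nested suprema. *)
Lemma le_sample_norm g al l : bounded_lipschitz g -> I al -> L l ->
  nm (gauss_conv g al l) <= sample_norm I L g.
Proof.
move=> gbl Ial Ll; have [K K0 HK] := gauss_conv_bound a0 c0.
have [m [gm _]] := gbl.
have bnd al' l' : I al' -> nm (gauss_conv g al' l') <= m * K.
  by move=> [/=]; rewrite !in_itv/= => /andP[h1 _] /andP[h2 _]; apply: HK => //; exact: ltW.
apply: (@le_trans _ _ (sup [set nm (gauss_conv g al l) | l in L])).
  by apply: ub_le_sup; [exists (m * K) => _ [l' _ <-]; exact: bnd|exists l].
apply: ub_le_sup; last by exists al.
exists (m * K) => _ [al' Ial' <-]; apply: ge_sup; first by exists (nm (gauss_conv g al' l)), l.
by move=> _ [l' _ <-]; exact: bnd.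
Qed.

Lemma sup_nonneg (S : set R) : (forall x, S x -> 0 <= x) -> 0 <= sup S.
Proof.
(* [sup] is 0 by default on a set without supremum, in particular on the empty set. *)
move=> S0; have [hs|hs] := pselect (has_sup S); last by rewrite sup_out.
by have [[x Sx] ub] := hs; apply: le_trans (S0 x Sx) _; exact: ub_le_sup.
Qed.

Lemma sup_le_nonneg (S : set R) (e : R) : 0 <= e -> (forall x, S x -> x <= e) -> sup S <= e.
Proof.
move=> e0 Se; have [->|/set0P S0] := eqVneq S set0; first by rewrite sup0.
exact: ge_sup.
Qed.

Lemma sample_norm_ge0 g : 0 <= sample_norm I L g.
Proof.
apply: sup_nonneg => _ [al _ <-]; apply: sup_nonneg => _ [l _ <-]; exact: nm_ge0.
Qed.

Lemma sample_norm_le g (e : R) : 0 <= e ->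
  (forall al l, I al -> L l -> nm (gauss_conv g al l) <= e) -> sample_norm I L g <= e.
Proof.
move=> e0 H; apply: sup_le_nonneg => // _ [al Ial <-].
by apply: sup_le_nonneg => // _ [l Ll <-]; exact: H.
Qed.

End SampleNorm.

(** * The compactness argument for sampling *)

Section Sampling.
Context {R : realType}.
Variables (s a b c d : R) (L : set (R * R)).
Hypotheses (s0 : 0 <= s) (a0 : 0 < a) (ab : a < b) (c0 : 0 < c) (cd : c < d).
Local Notation I := (`]a, b[%classic `*` `]c, d[%classic).
Implicit Types (g : R * R -> R[i]) (M : set (R * R)) (al l u v p : R * R).

(** The functions share a Lipschitz constant, so pointwise limits are uniform on squares: offending
    points would have a limit [v] along [U], and comparison with the values at l - v costs two
    fifths of [e] for [f n], two for [g] and one for the convergence there. *)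
Lemma ultralimit_uniform (U : set_system nat) (UF : UltraFilter U)
    (f : nat -> R * R -> R[i]) g l (r e : R) :
  (forall n, planar s (f n)) -> (forall n p, nm (f n p) <= 1) ->
  (forall p, ulims U (fun n => f n p) (g p)) -> 0 < e ->
  U [set n | forall u, `|u.1| < r -> `|u.2| < r -> nm (f n (l - u) - g (l - u)) <= e].
Proof.
move=> pf fm fg e0; have pg : planar s g by exact: (planar_limit s0 (UF := UF) pf fm fg).
have gm p : nm (g p) <= 1 by by apply: (ulims_leT (fg p)) => n; exact: fm.
have [//|UC] := in_ultra_setVsetC [set n | forall u, `|u.1| < r -> `|u.2| < r ->
  nm (f n (l - u) - g (l - u)) <= e] UF.
have [|u [v [UP Uv]]] := ultralimit_point (UF := UF)
    (P := fun n u => e < nm (f n (l - u) - g (l - u))) (r := r).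
  apply: filterS UC => n /= nC; apply: contrapT => H; apply: nC => u u1 u2.
  by rewrite leNgt; apply/negP => h; apply: H; exists u.
have B0 := bernstein_const_gt0 s; set B := bernstein_const s in B0.
have e' : 0 < e / (5 * B) by rewrite divr_gt0// mulr_gt0.
have e5 : 0 < e / 5 by rewrite divr_gt0.
have [n [[/= h1 [h2 h3]] h4]] := filter_ex (filterI (filterI UP (Uv _ e')) (fg (l - v) _ e5)).
have lip k : planar s k -> (forall p, nm (k p) <= 1) ->
    nm (k (l - u n) - k (l - v)) <= 2 * (e / 5).
  move=> pk km; have := planar_lipschitz s0 (l - v) (v - u n) pk km.
  rewrite addrA subrK mulr1 => /le_trans; apply.
  have -> : 2 * (e / 5) = B * (e / (5 * B) + e / (5 * B)) by field; rewrite gt_eqF.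
  by rewrite ler_wpM2l ?(ltW B0)// lerD// distrC ltW.
move: h1; rewrite ltNge => /negP; case.
have -> : f n (l - u n) - g (l - u n) = (f n (l - u n) - f n (l - v)) +
    (f n (l - v) - g (l - v)) - (g (l - u n) - g (l - v)) by ring.
have := lip _ (pf n) (fm n); have := lip _ pg gm; move: h4 => /=.
have := nmB (f n (l - u n) - f n (l - v) + (f n (l - v) - g (l - v))) (g (l - u n) - g (l - v)).
have := nmD (f n (l - u n) - f n (l - v)) (f n (l - v) - g (l - v)).
lra.
Qed.

Lemma gauss_conv_ultralimit (U : set_system nat) (UF : UltraFilter U)
    (f : nat -> R * R -> R[i]) g (M : nat -> set (R * R)) al l :
  (forall N, U [set n | (N <= n)%N]) ->
  (forall n, planar s (f n)) -> (forall n p, nm (f n p) <= 1) ->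
  (forall p, ulims U (fun n => f n p) (g p)) -> I al ->
  (forall n u, M n u -> nm (gauss_conv (f n) al u) <= n.+1%:R^-1) ->
  ultralimit_set U M l -> gauss_conv g al l = 0.
Proof.
move=> Ucof pf fm fg Ial HM Ml; have pg : planar s g by exact: (planar_limit s0 (UF := UF) pf fm fg).
have gm p : nm (g p) <= 1 by by apply: (ulims_leT (fg p)) => n; exact: fm.
have [K K0 HK] := gauss_conv_distance a0 c0.
have [a1 c2] : a <= al.1 /\ c <= al.2.
  by move: Ial => [/=]; rewrite !in_itv/= => /andP[h1 _] /andP[h2 _]; split; exact: ltW.
have B0 := bernstein_const_gt0 s; set B := bernstein_const s in B0.
apply/nm0_eq0/eqP; rewrite eq_le nm_ge0 andbT; apply/ler_addgt0Pr => e e0; rewrite add0r.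
(* The convolutions at [l] and at the approximating point differ by at most 2 e1 K, and the latter
   is at most e1. *)
pose e1 := e / (2 * K + 1).
have e10 : 0 < e1 by rewrite divr_gt0// addr_gt0// mulr_gt0.
have e2 : 0 < e1 / (2 * B) by rewrite divr_gt0// mulr_gt0.
pose N := Num.truncn e1^-1.
have UN := ultralimit_uniform UF l (1 / e1) pf fm fg e10.
have [n [[/= h1 h2] [v [Mv v1 v2]]]] := filter_ex (filterI (filterI UN (Ucof N)) (Ml _ e2)).
have hn : n.+1%:R^-1 <= e1.
  rewrite -[leRHS]invrK lef_pV2 ?posrE ?invr_gt0// ltW// (lt_le_trans (truncnS_gt _))//.
  by rewrite ler_nat ltnS.
(* Inside the square of half-side 1 / e1 the convergence is uniform; outside it the weight is at
   least 1 / e1, so the trivial bound 2 suffices. *)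
have near t : nm (g (l - t) - f n (v - t)) <= 2 * e1 * linear_weight t.
  have [[t1 t2]|] := pselect (`|t.1| < 1 / e1 /\ `|t.2| < 1 / e1).
    have h3 := h1 t t1 t2.
    have h4 : nm (f n (v - t) - f n (l - t)) <= e1.
      have := planar_lipschitz s0 (l - t) (v - l) (pf n) (fm n).
      rewrite (_ : l - t + (v - l) = v - t); last first.
        by rewrite addrC addrA subrK.
      rewrite mulr1 => /le_trans; apply.
      have -> : e1 = B * (e1 / (2 * B) + e1 / (2 * B)) by field; rewrite gt_eqF.
      by rewrite ler_wpM2l ?(ltW B0)// lerD// distrC ltW.
    have h5 : nm (g (l - t) - f n (v - t)) <= e1 + e1.
      rewrite (_ : _ - _ = - (f n (l - t) - g (l - t)) - (f n (v - t) - f n (l - t))); last by ring.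
      by apply: le_trans (nmB _ _) _; rewrite nmN lerD.
    have lw1 : 1 <= linear_weight t by rewrite /linear_weight lerDl addr_ge0.
    by apply: le_trans h5 _; have := ler_wpM2l (ltW e10) lw1; lra.
  move=> ht; apply: (@le_trans _ _ (1 + 1)); first by apply: le_trans (nmB _ _) _; rewrite lerD.
  have : 1 / e1 <= linear_weight t.
    rewrite /linear_weight; have h3 := normr_ge0 t.1; have h4 := normr_ge0 t.2.
    have [h|h] := ltP `|t.1| (1 / e1); last by lra.
    have [h'|h'] := ltP `|t.2| (1 / e1); last by lra.
    by case: ht.
  rewrite ler_pdivrMr// mulrC => h; rewrite -mulrA; lra.
have := HK g (f n) l v (2 * e1) al (planar_bounded_lipschitz s0 pg)
  (planar_bounded_lipschitz s0 (pf n)) near a1 c2.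
move=> h3; have h4 := HM n v Mv.
have := nmD (gauss_conv g al l - gauss_conv (f n) al v) (gauss_conv (f n) al v).
rewrite subrK => /le_trans; apply; apply: (@le_trans _ _ (2 * e1 * K + e1)).
  by apply: lerD => //; exact: le_trans hn.
have -> : 2 * e1 * K + e1 = e1 * (2 * K + 1) by ring.
by rewrite divfK// gt_eqF// addr_gt0// mulr_gt0.
Qed.

(** Uniqueness is applied to the real and imaginary parts of u -> g (l - u), for which reflections
    about l become sign changes of the coordinates. *)
Lemma gauss_conv_null_reflection g M : planar s g ->
  (forall al l, I al -> M l -> gauss_conv g al l = 0) -> reflection_null g M.
Proof.
move=> pg H l t Ml; have gbl := planar_bounded_lipschitz s0 pg.
have [m [gm gl]] := gbl.
have lipn p v : nm (g (l - (p + v)) - g (l - p)) <= m * (`|v.1| + `|v.2|).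
  by have := gl (l - p) (- v); rewrite /= !normrN opprD addrA.
have zR al : a < al.1 < b -> c < al.2 < d ->
    \int[@plane_measure R]_u (Re (g (l - u)) * gaussian al u) = 0 /\
    \int[@plane_measure R]_u (Im (g (l - u)) * gaussian al u) = 0.
  move=> h1 h2; have Ial : I al by split; rewrite /= in_itv.
  by have := H al l Ial Ml; rewrite gauss_convE => -[-> ->].
have [R1 I1] : (forall p v, `|Re (g (l - (p + v))) - Re (g (l - p))| <= m * (`|v.1| + `|v.2|)) /\
    (forall p v, `|Im (g (l - (p + v))) - Im (g (l - p))| <= m * (`|v.1| + `|v.2|)).
  split=> p v; apply: le_trans (lipn p v).
    by rewrite -ReN -ReD; exact: Re_le_nm.
  by rewrite -ImN -ImD; exact: Im_le_nm.
have R0 := @gaussian_uniqueness_plane R (fun u => Re (g (l - u))) m m a b c d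
  (fun u => le_trans (Re_le_nm _) (gm _)) R1 a0 ab c0 cd (fun al h1 h2 => (zR al h1 h2).1) t.1 t.2.
have I0 := @gaussian_uniqueness_plane R (fun u => Im (g (l - u))) m m a b c d
  (fun u => le_trans (Im_le_nm _) (gm _)) I1 a0 ab c0 cd (fun al h1 h2 => (zR al h1 h2).2) t.1 t.2.
have e x y : l - (x, y) = (l.1 - x, l.2 - y) by [].
rewrite /reflection_sum; apply: eq_ReIm; rewrite ?ReD ?ImD /=.
  by rewrite -[RHS]R0 !e /= !opprK; ring.
by rewrite -[RHS]I0 !e /= !opprK; ring.
Qed.

(** Division by the sup norm turns the failed inequality into convolutions of size at most 1 / K,
    and translation puts a point exceeding half of the sup norm at the origin. *)
Lemma normalized_almost_null (n : nat) (K : R) (f : R[i]^o * R[i]^o -> R[i]^o) :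
  0 < K -> bernstein s f ->
  K * sample_norm I L (real_restriction f) < sup_norm (real_restriction f) ->
  exists g M, [/\ planar s g, translation_limit L M, forall p, nm (g p) <= 1, 1 / 2 <= nm (g 0) &
    forall al u, I al -> M u -> nm (gauss_conv g al u) <= K^-1].
Proof.
move=> K0 bf; have pf := bernstein_planar bf; set k := real_restriction f in pf *.
move=> hk; have sn0 := sample_norm_ge0 a b c d L k.
have [[m km] _ _] := pf; pose S := sup_norm k.
have S0 : 0 < S by apply: le_lt_trans hk; rewrite mulr_ge0// ltW.
have [x hx] : exists x, S / 2 < nm (k x) by apply: (sup_norm_near km); rewrite -/S; lra.
have Sn : nm S^-1%:C%C = S^-1 by rewrite nm_real gtr0_norm// invr_gt0.
have kbl := planar_bounded_lipschitz s0 pf.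
have pk' := planar_shift x pf.
exists (fun p => S^-1%:C%C * k (p + x)), (translate L x); split.
- exact: planarZ.
- exact: translation_limit_translate.
- move=> p; rewrite nmM Sn ler_pdivrMl// mulr1; exact: le_sup_norm km.
- rewrite nmM Sn add0r ler_pdivlMl//; lra.
move=> al _ Ial [u Lu <-].
have [a1 c2] : 0 < al.1 /\ 0 < al.2.
  move: Ial => [/=]; rewrite !in_itv/= => /andP[h1 _] /andP[h2 _].
  by split; [exact: lt_trans h1|exact: lt_trans h2].
rewrite gauss_convZ//; last exact: planar_bounded_lipschitz pk'.
rewrite nmM Sn gauss_conv_shift subrK ler_pdivrMl// [leRHS]mulrC ler_pdivlMl//.
rewrite (le_trans _ (ltW hk))// ler_wpM2l ?(ltW K0)//.
exact: le_sample_norm.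
Qed.

Lemma sampling_of_condition_A : uniformly_discrete L -> condition_A L ->
  sampling_inequality I L s.
Proof.
move=> dL cA; apply: contrapT => nS.
have /choice[f Hf] n : exists f, exists g M, [/\ planar s g, translation_limit L M,
    forall p, nm (g p) <= 1, 1 / 2 <= nm (g 0) &
    forall al u, I al -> M u -> nm (gauss_conv g al u) <= n.+1%:R^-1] /\ f = (g, M).
  apply: contrapT => H; apply: nS; exists n.+1%:R => f bf; rewrite leNgt; apply/negP => h.
  have [g [M HgM]] := normalized_almost_null n (ltr0Sn _ n) bf h.
  by apply: H; exists (g, M), g, M.
pose g n := (f n).1; pose M n := (f n).2.
have {}Hf n : [/\ planar s (g n), translation_limit L (M n),
    forall p, nm (g n p) <= 1, 1 / 2 <= nm (g n 0) &
    forall al u, I al -> M n u -> nm (gauss_conv (g n) al u) <= n.+1%:R^-1].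
  by have [g' [M' [H e]]] := Hf n; rewrite /g /M e.
have pg n : planar s (g n) by have [] := Hf n.
have LM n : translation_limit L (M n) by have [] := Hf n.
have g1 n p : nm (g n p) <= 1 by have [_ _ ->] := Hf n.
have [U [UF Ucof]] := exists_free_ultrafilter.
have /choice[G HG] p : exists z, ulims U (fun n => g n p) z by exact: ulims_exists.
apply: (@no_annihilator _ s s0 L G (ultralimit_set U M) 0 dL cA).
- exact: (planar_limit s0 (UF := UF) pg g1 HG).
- exact: translation_limit_ultralimit.
- apply: gauss_conv_null_reflection; first exact: (planar_limit s0 (UF := UF) pg g1 HG).
  move=> al l Ial; apply: (gauss_conv_ultralimit UF Ucof pg g1 HG Ial) => n u.
  by have [_ _ _ _ H] := Hf n; exact: H.
have G0 : 1 / 2 <= nm (G 0).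
  have e0 : 0 < 1 / 4 :> R by lra.
  rewrite leNgt; apply/negP => hG.
  have e1 : 0 < (1 / 2 - nm (G 0)) / 2 by lra.
  have [n /= hn] := filter_ex (HG 0 _ e1).
  have [_ _ _ h _] := Hf n; have := nmD (g n 0 - G 0) (G 0); rewrite subrK; lra.
by apply/eqP => h; move: G0; rewrite h Normc.normc0; lra.
Qed.

End Sampling.

(** * Sampling implies condition (A) *)

Section SpecialFunctions.
Context {R : realType}.
Local Notation C := (R[i]).
Local Notation I := ((0 +i* 1)%C : C).
Implicit Types (F G : C -> C) (z w : C).

Lemma exp_type_cexp (r : R) : `|r| <= 1 -> exp_type 1 (fun z => cexp (I * r%:C%C * z)).
Proof.
move=> r1; split.
  move=> z; exists (cexp (I * r%:C%C * z) * (I * r%:C%C)).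
  have d1 := cderiv_affine 0 (I * r%:C%C) z.
  have := cderiv_comp d1 (cderiv_cexp (0 + I * r%:C%C * z)).
  by rewrite add0r; congr (cderiv _ z _); apply/funext => w; rewrite add0r.
exists 1 => z; rewrite mul1r nm_cexp ler_expR mul1r.
have -> : Re (I * r%:C%C * z) = - (r * Im z) by rewrite !ReM !ImM /=; ring.
apply: le_trans (ler_norm _) _.
by rewrite normrN normrM ler_piMl.
Qed.

Lemma exp_type_sum (s : R) (n : nat) (F : nat -> C -> C) : (forall j, (j < n)%N -> exp_type s (F j)) ->
  exp_type s (fun z => \sum_(j < n) F j z).
Proof.
elim: n => [|n IH] tF.
  have -> : (fun z => \sum_(j < 0) F j z) = fun z => 0 * 1 :> C.
    by apply/funext => z; rewrite big_ord0 mul0r.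
  split=> [z|]; first by exists 0; rewrite mul0r; exact: cderiv_cst.
  by exists 0 => z; rewrite !mul0r Normc.normc0.
have -> : (fun z => \sum_(j < n.+1) F j z) = fun z => \sum_(j < n) F j z + F n z.
  by apply/funext => z; rewrite big_ord_recr.
by apply: exp_typeD; [apply: IH => j jn; apply: tF; exact: ltnW|exact: tF].
Qed.

Lemma cexpX z n : cexp z ^+ n = cexp (n%:R * z).
Proof.
elim: n => [|n IH]; first by rewrite expr0 mul0r cexp0.
by rewrite exprS IH -cexpD -natr1 mulrDl mul1r addrC.
Qed.

(* [S z] is the integral of [exp (i t z)] for [t] in [0, 1], constructed as a
   limit of Riemann sums because this makes it entire for free. *)
Lemma decaying_exp_type : exists S : C -> C, [/\ exp_type 1 S, S 0 = 1,
  forall x : R, nm (S x%:C%C) <= 1 & forall x : R, `|x| * nm (S x%:C%C) <= 2].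
Proof.
pose q (n : nat) : R := n.+1%:R^-1.
have q0 n : 0 < q n by rewrite invr_gt0.
pose F (n : nat) z := (q n)%:C%C * \sum_(j < n.+1) cexp (I * (j%:R * q n)%:C%C * z).
have tF n : exp_type 1 (F n).
  apply: exp_typeZ; apply: (exp_type_sum (F := fun j z => cexp (I * (j%:R * q n)%:C%C * z))) => j jn.
  apply: exp_type_cexp; rewrite ger0_norm ?mulr_ge0 ?(ltW (q0 n))//.
  by rewrite /q ler_pdivrMr// mul1r ler_nat ltnW.
have Fm n (x : R) : nm (F n x%:C%C) <= 1.
  rewrite /F nmM nm_real gtr0_norm//; apply: (@le_trans _ _ (q n * n.+1%:R)); last first.
    by rewrite /q mulVf// pnatr_eq0.
  rewrite ler_wpM2l ?(ltW (q0 n))//; apply: le_trans (nm_sum _ _ _) _.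
  have -> : n.+1%:R = \sum_(j < n.+1) (1 : R) by rewrite sumr_const card_ord.
  apply: ler_sum => j _; rewrite nm_cexp.
  by rewrite (_ : Re _ = 0) ?expR0// !ReM !ImM /=; ring.
have [U [UF Ucof]] := exists_free_ultrafilter.
have [S [tS FS _]] := exp_type_limit UF ler01 tF Fm.
exists S; split => //.
- apply: ulims_unique (FS 0) _; suff -> : (fun n => F n 0) = fun=> 1 by exact: ulims_cst.
  apply/funext => n; rewrite /F.
  under eq_bigr do rewrite mulr0 cexp0.
  rewrite sumr_const card_ord -(rmorph_nat (real_complex R)) -rmorphM /q mulVf ?pnatr_eq0//.
- by move=> x; apply: (ulims_leT (FS _)).
move=> x.
(* The Riemann sum is geometric. In the limit this reads i x S(x) = exp (i x) - 1, which gives the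
   decay without dividing by x. *)
have geo n : (n.+1%:R * (cexp (I * x%:C%C * (q n)%:C%C) - 1)) * F n x%:C%C = cexp (I * x%:C%C) - 1.
  have -> : cexp (I * x%:C%C) - 1 = (cexp (I * x%:C%C * (q n)%:C%C)) ^+ n.+1 - 1.
    rewrite cexpX; congr (cexp _ - 1).
    rewrite mulrCA -(rmorph_nat (real_complex R)) -rmorphM /q divff ?pnatr_eq0// rmorph1 mulr1//.
  have nq : n.+1%:R * (q n)%:C%C = 1 :> C.
    by rewrite -(rmorph_nat (real_complex R)) -rmorphM /q divff ?pnatr_eq0// rmorph1.
  rewrite subrX1 /F mulrACA nq mul1r; congr (_ * _); apply: eq_bigr => j _.
  by rewrite cexpX; congr cexp; rewrite rmorphM rmorph_nat; ring.
have lim : ulims U (fun n => n.+1%:R * (cexp (I * x%:C%C * (q n)%:C%C) - 1)) (I * x%:C%C).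
  move=> e e0; have x1 : 0 < `|x| + 1 by rewrite ltr_wpDl.
  have e1 : 0 < e / (`|x| + 1) by rewrite divr_gt0.
  have [d d0 Hd] := cderiv_cexp0 e1.
  apply: filterS (Ucof (Num.truncn ((`|x| + 1) / d))) => n /= hn.
  have nmI : nm I = 1 by rewrite /Normc.normc expr0n expr1n add0r sqrtr1.
  have nh : nm (I * x%:C%C * (q n)%:C%C) = `|x| * q n.
    by rewrite !nmM nmI mul1r !nm_real (gtr0_norm (q0 n)).
  have qd : `|x| * q n < d.
    rewrite /q ltr_pdivrMr// mulrC -ltr_pdivrMr//.
    apply: (@lt_trans _ _ ((`|x| + 1) / d)); first by rewrite ltr_pM2r ?invr_gt0// ltrDl.
    by rewrite (lt_le_trans (truncnS_gt _))// ler_nat ltnS.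
  have := Hd (I * x%:C%C * (q n)%:C%C); rewrite nh => /(_ qd).
  rewrite add0r cexp0 mul1r => h.
  have nq : n.+1%:R * (q n)%:C%C = 1 :> C.
    by rewrite -(rmorph_nat (real_complex R)) -rmorphM /q divff ?pnatr_eq0// rmorph1.
  have -> : n.+1%:R * (cexp (I * x%:C%C * (q n)%:C%C) - 1) - I * x%:C%C =
      n.+1%:R * (cexp (I * x%:C%C * (q n)%:C%C) - 1 - I * x%:C%C * (q n)%:C%C).
    by rewrite [RHS]mulrBr [X in _ = _ - X]mulrCA nq mulr1.
  rewrite nmM -(rmorph_nat (real_complex R)) nm_real ger0_norm//.
  rewrite -ler_pdivlMl// -/(q n); apply: le_trans h _.
  rewrite (mulrC (q n)) mulrA ler_wpM2r ?(ltW (q0 n))// mulrAC ler_pdivrMr//.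
  by rewrite ler_wpM2l ?ltW// ltrDl.
have e : I * x%:C%C * S x%:C%C = cexp (I * x%:C%C) - 1.
  apply: ulims_unique (ulimsM lim (FS x%:C%C)) _.
  have -> : (fun n => n.+1%:R * (cexp (I * x%:C%C * (q n)%:C%C) - 1) * F n x%:C%C) =
      fun=> cexp (I * x%:C%C) - 1 by apply/funext => n; exact: geo.
  exact: ulims_cst.
have := nmB (cexp (I * x%:C%C)) 1; rewrite -e !nmM nm_real nm_cexp Normc.normc1.
rewrite (_ : Re _ = 0); last by rewrite ReM /=; ring.
rewrite expR0 (_ : nm I = 1) ?mul1r; last by rewrite /Normc.normc expr0n expr1n add0r sqrtr1.
by move=> /le_trans; apply; lra.
Qed.

Definition ccos z : C := 2^-1%:C%C * (cexp (I * z) + cexp (- I * z)).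

Lemma ccos_real (x : R) : ccos x%:C%C = (cos x)%:C%C.
Proof.
by apply: eq_ReIm; rewrite /ccos ?ReM ?ImM /= !(mul0r, mul1r, mulr0, oppr0, subr0, add0r, addr0,
  mulN1r, expR0, cosN, sinN, subrr) //; field.
Qed.

Lemma exp_type_ccos : exp_type 1 ccos.
Proof.
apply: exp_typeZ; apply: exp_typeD.
  have := @exp_type_cexp 1; rewrite normr1 lexx rmorph1 => /(_ isT).
  by congr (exp_type 1 _); apply/funext => z; rewrite mulr1.
have := @exp_type_cexp (-1); rewrite normrN1 lexx rmorphN1 => /(_ isT).
by congr (exp_type 1 _); apply/funext => z; rewrite mulrN1.
Qed.

End SpecialFunctions.

(** * Operations on Bernstein spaces *)

Section BernsteinClosure.
Context {R : realType}.
Local Notation C2 := (R[i]^o * R[i]^o)%type.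
Implicit Types (f g : R[i]^o * R[i]^o -> R[i]^o) (s : R).

Lemma bernsteinD s f g : bernstein s f -> bernstein s g -> bernstein s (fun z => f z + g z).
Proof.
move=> [df [K fK]] [dg [K' gK]]; split; first by move=> z; exact: differentiableD.
by exists (K + K') => z; rewrite (le_trans (nmD _ _))// mulrDl lerD.
Qed.

Lemma bernsteinZ s (c : R[i]) f : bernstein s f -> bernstein s (fun z => c * f z).
Proof.
move=> [df [K fK]]; split; first by move=> z; exact: (@differentiableZ _ _ _ f c).
by exists (nm c * K) => z; rewrite nmM -mulrA ler_wpM2l// nm_ge0.
Qed.

Lemma bernsteinM s s' f g : bernstein s f -> bernstein s' g ->
  bernstein (s + s') (fun z => f z * g z).
Proof.
move=> [df [K fK]] [dg [K' gK]]; split; first by move=> z; exact: (@differentiableM R[i] _ f g z).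
exists (K * K') => z; rewrite nmM mulrDl expRD mulrACA.
by apply: ler_pM; rewrite ?nm_ge0.
Qed.

Lemma bernstein_ridge s (F : R[i] -> R[i]) (a b c : R) : exp_type 1 F -> `|a| <= s -> `|b| <= s ->
  bernstein s (fun z : R[i]^o * R[i]^o => F (a%:C%C * z.1 + b%:C%C * z.2 + c%:C%C)).
Proof.
move=> [eF [K FK]] sa sb.
have K0 : 0 <= K.
  by have := le_trans (nm_ge0 _) (FK 0); rewrite /= normr0 mulr0 expR0 mulr1.
split.
  move=> z.
  apply: (@differentiable_comp _ _ _ _
    (fun z : C2 => (a%:C%C * z.1 + b%:C%C * z.2 + c%:C%C : R[i]^o))
    (F : R[i]^o -> R[i]^o)).
    apply: differentiableD; last exact: differentiable_cst.
    have d1 : differentiable (fst : C2 -> R[i]^o) z.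
      by apply: linear_differentiable => y; exact: cvg_fst.
    have d2 : differentiable (snd : C2 -> R[i]^o) z.
      by apply: linear_differentiable => y; exact: cvg_snd.
    apply: differentiableD.
      exact: (@differentiableZ _ _ _ (fst : C2 -> R[i]^o) a%:C%C).
    exact: (@differentiableZ _ _ _ (snd : C2 -> R[i]^o) b%:C%C).
  by have [l] := eF (a%:C%C * z.1 + b%:C%C * z.2 + c%:C%C); exact: cderiv_derivable.
exists K => z; apply: le_trans (FK _) _; rewrite ler_wpM2l// ler_expR mul1r.
rewrite !ImD !ImM /= !mul0r !addr0.
apply: le_trans (ler_normD _ _) _; rewrite !normrM mulrDr.
by apply: lerD; rewrite ler_wpM2r.
Qed.

Lemma bernstein_shift s f (v : R * R) : bernstein s f ->
  bernstein s (fun z : R[i]^o * R[i]^o => f (z.1 + v.1%:C%C, z.2 + v.2%:C%C)).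
Proof.
move=> [df [K fK]]; split; last first.
  by exists K => z; have := fK (z.1 + v.1%:C%C, z.2 + v.2%:C%C); rewrite /= !ImD /= !addr0.
move=> z; apply: (@differentiable_comp _ _ _ _
    (fun z : C2 => ((z.1 + v.1%:C%C : R[i]^o), (z.2 + v.2%:C%C : R[i]^o))) f); last exact: df.
apply: differentiable_pair.
  apply: differentiableD; last exact: differentiable_cst.
  by apply: linear_differentiable => y; exact: cvg_fst.
apply: differentiableD; last exact: differentiable_cst.
by apply: linear_differentiable => y; exact: cvg_snd.
Qed.

End BernsteinClosure.

(** * Reflection symmetry of Gaussian integrals *)

Section Symmetrization.
Context {R : realType}.
Local Notation mu := (@lebesgue_measure R).
Local Notation plane := (@plane_measure R).
Implicit Types (f h : R * R -> R) (g : R * R -> R[i]) (al l : R * R).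

Lemma continuous_pair (T : topologicalType) (u v : T -> R) : continuous u -> continuous v ->
  continuous (fun t => (u t, v t)).
Proof.
move=> cu cv t; exact: (@cvg_pair _ _ _ (nbhs t) (nbhs (u t)) (nbhs (v t)) _ _ _ u v (cu t) (cv t)).
Qed.

(** The Gaussian is invariant under both coordinate reflections, so the four reflected copies of f
    have the same integral [X]; their sum is 0, whence 4 X = 0. *)
Lemma gaussian_integral_symmetric f al (m : R) : continuous f -> (forall s, `|f s| <= m) ->
  0 < al.1 -> 0 < al.2 ->
  (forall x y, f (x, y) + f (- x, y) + (f (x, - y) + f (- x, - y)) = 0) ->
  \int[plane]_s (f s * gaussian al s) = 0.
Proof.
move=> cf fm a1 a2 f0; have [K K0 HK] := gaussian_integral_bound a1 a2.
have int h : continuous h -> (forall s, `|h s| <= m) ->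
    plane.-integrable setT (EFin \o (fun s => h s * gaussian al s)).
  move=> ch hm; have m0 : 0 <= m by exact: le_trans (normr_ge0 _) (hm 0).
  have [|] // := HK h m al ch _ (lexx _) (lexx _).
  by move=> s; rewrite (le_trans (hm s))// ler_peMr// /linear_weight lerDl addr_ge0.
have cpair h x : continuous h -> continuous (fun y : R => h (x, y) : R).
  move=> ch y; apply: (@continuous_comp _ _ _ (fun y : R => (x, y)) h); last exact: ch.
  by apply: continuous_pair => z; [exact: cvg_cst|exact: cvg_id].
have slice h x : continuous h -> (forall s, `|h s| <= m) ->
    mu.-integrable setT (EFin \o (fun y => h (x, y) * gaussian al (x, y))).
  move=> ch hm; apply: (@integrable_cont_dominated _ _ m al.2) => //.
    by move=> y; apply: cvgM; [exact: cpair|apply: cpair; exact: continuous_gaussian].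
  move=> y; rewrite normrM ler_pM// gaussianE ger0_norm ?mulr_ge0 ?expR_ge0//.
  by rewrite ler_piMl ?expR_ge0// -[leRHS]expR0 ler_expR mulNr oppr_le0 mulr_ge0 ?sqr_ge0// ltW.
pose f1 (s : R * R) := f (- s.1, s.2); pose f2 (s : R * R) := f (s.1, - s.2).
have c1 h : continuous h -> continuous (fun s : R * R => h (- s.1, s.2) : R).
  move=> ch s; apply: (@continuous_comp _ _ _ (fun s : R * R => (- s.1, s.2)) h); last exact: ch.
  by apply: continuous_pair => z; [apply: cvgN; exact: cvg_fst|exact: cvg_snd].
have c2 h : continuous h -> continuous (fun s : R * R => h (s.1, - s.2) : R).
  move=> ch s; apply: (@continuous_comp _ _ _ (fun s : R * R => (s.1, - s.2)) h); last exact: ch.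
  by apply: continuous_pair => z; [exact: cvg_fst|apply: cvgN; exact: cvg_snd].
have r2 h : continuous h -> (forall s, `|h s| <= m) ->
    \int[plane]_s (h (s.1, - s.2) * gaussian al s) = \int[plane]_s (h s * gaussian al s).
  move=> ch hm; rewrite !Rintegral_plane.
  - apply: eq_Rintegral => x _; rewrite -[RHS]Rintegral_reflect; last exact: slice.
    by apply: eq_Rintegral => y _; rewrite !gaussianE sqrrN.
  - exact: int.
  - by move=> x; exact: slice.
  - by apply: int; [exact: c2|].
  - by move=> x; apply: (slice (fun s => h (s.1, - s.2))); [exact: c2|].
have r1 h : continuous h -> (forall s, `|h s| <= m) ->
    \int[plane]_s (h (- s.1, s.2) * gaussian al s) = \int[plane]_s (h s * gaussian al s).
  move=> ch hm; rewrite !Rintegral_plane.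
  - rewrite -[RHS]Rintegral_reflect.
      apply: eq_Rintegral => x _; apply: eq_Rintegral => y _; rewrite !gaussianE sqrrN//.
    have := integrable_fubini_F (int h ch hm).
    apply: eq_integrable => // x _; rewrite /fubini_F /= /Rintegral fineK//.
    by apply: integrable_fin_num => //; exact: slice.
  - exact: int.
  - by move=> x; exact: slice.
  - by apply: int; [exact: c1|].
  - by move=> x; apply: (slice (fun s => h (- s.1, s.2))); [exact: c1|].
set X := LHS.
have e0 : \int[plane]_s (f s * gaussian al s) = X by [].
have e1 : \int[plane]_s (f1 s * gaussian al s) = X by exact: r1.
have e2 : \int[plane]_s (f2 s * gaussian al s) = X by exact: r2.
have e12 : \int[plane]_s (f2 (- s.1, s.2) * gaussian al s) = X.
  by rewrite r1 ?e2//; [exact: c2|move=> s; exact: fm].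
have i0 := int f cf fm.
have i1 := int f1 (c1 f cf) (fun s => fm _).
have i2 := int f2 (c2 f cf) (fun s => fm _).
have i12 := int (fun s => f2 (- s.1, s.2)) (c1 f2 (c2 f cf)) (fun s => fm _).
have mT : measurable [set: measurableTypeR R * measurableTypeR R] by [].
have i01 : plane.-integrable setT (EFin \o (fun s => f s * gaussian al s + f1 s * gaussian al s)).
  by have := integrableD mT i0 i1.
have i23 : plane.-integrable setT (EFin \o (fun s => f2 s * gaussian al s + f2 (- s.1, s.2) * gaussian al s)).
  by have := integrableD mT i2 i12.
have : \int[plane]_s ((f s * gaussian al s + f1 s * gaussian al s) +
    (f2 s * gaussian al s + f2 (- s.1, s.2) * gaussian al s)) = 0.
  rewrite (_ : (fun s => _) = fun=> 0); first by rewrite /Rintegral integral0.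
  apply/funext => -[x y]; rewrite /f1 /f2 /= -!mulrDl f0 mul0r//.
rewrite RintegralD// RintegralD// RintegralD// e0 e1 e2 e12; lra.
Qed.

Lemma gauss_conv_of_reflection g al l : bounded_lipschitz g -> 0 < al.1 -> 0 < al.2 ->
  (forall t, reflection_sum g l t = 0) -> gauss_conv g al l = 0.
Proof.
move=> gbl a1 a2 g0; have [cR cI] := continuous_reflected l gbl; have [m [gm _]] := gbl.
have e x y : l - (x, y) = (l.1 - x, l.2 - y) by [].
rewrite gauss_convE; apply: eq_ReIm => /=.
  apply: (gaussian_integral_symmetric (m := m) cR) => // [s|x y].
    exact: le_trans (Re_le_nm _) (gm _).
  have := congr1 Re (g0 (x, y)); rewrite /reflection_sum !ReD /= !e !opprK => <-; ring.
apply: (gaussian_integral_symmetric (m := m) cI) => // [s|x y].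
  exact: le_trans (Im_le_nm _) (gm _).
have := congr1 Im (g0 (x, y)); rewrite /reflection_sum !ImD /= !e !opprK => <-; ring.
Qed.

End Symmetrization.

(** * Waves vanishing on a curvilinear lattice *)

Section TestFunctions.
Context {R : realType}.
Local Notation C2 := (R[i]^o * R[i]^o)%type.
Implicit Types (p v l x : R * R).

Definition wave (t xi r : R * R) (z : R[i]^o * R[i]^o) : R[i]^o :=
  r.1%:C%C * ccos (xi.1%:C%C * z.1 + xi.2%:C%C * z.2 + t.1%:C%C) +
  (- r.2)%:C%C * ccos ((- xi.1)%:C%C * z.1 + xi.2%:C%C * z.2 + t.2%:C%C).

Lemma bernstein_wave t xi r : bernstein (`|xi.1| + `|xi.2|) (wave t xi r).
Proof.
by apply: bernsteinD; apply: bernsteinZ; apply: bernstein_ridge; rewrite ?normrN;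
  rewrite ?lerDl ?lerDr//; exact: exp_type_ccos.
Qed.

Lemma wave_real t xi r p : real_restriction (wave t xi r) p =
  (r.1 * cos (p.1 * xi.1 + p.2 * xi.2 + t.1) -
   r.2 * cos (- (p.1 * xi.1) + p.2 * xi.2 + t.2))%:C%C.
Proof.
rewrite /real_restriction /wave /= -!(rmorphM (real_complex R)) -!(rmorphD (real_complex R)) !ccos_real.
rewrite -!(rmorphM (real_complex R)) -!(rmorphD (real_complex R)).
by rewrite mulNr mulNr (mulrC xi.1) (mulrC xi.2).
Qed.

Lemma wave_le2 t xi r p : r.1 ^+ 2 + r.2 ^+ 2 = 1 ->
  nm (real_restriction (wave t xi r) p) <= 2.
Proof.
move=> r1; rewrite wave_real nm_real.
have ub (y z : R) : y ^+ 2 + z ^+ 2 = 1 -> `|y| <= 1.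
  move=> yz; rewrite -(@ler_pXn2r _ 2) ?nnegrE// real_normK ?num_real// expr1n -yz.
  by rewrite lerDl sqr_ge0.
have cb (y : R) : `|cos y| <= 1 by apply: (ub _ (sin y)); exact: cos2Dsin2.
rewrite (le_trans (ler_normB _ _))// !normrM (natrD _ 1 1) lerD//.
  by rewrite -[leRHS]mulr1 ler_pM//; exact: ub r1.
by rewrite -[leRHS]mulr1 ler_pM//; apply: (ub _ r.1); rewrite addrC.
Qed.

(** Summing a cosine over the four sign choices factors as 4 cos A cos y cos z. Both waves produce
    the same last two factors, so what remains is the lattice equation at l. *)
Lemma wave_reflection t xi r l s : curvilinear_lattice t xi r l ->
  reflection_sum (real_restriction (wave t xi r)) l s = 0.
Proof.
rewrite /curvilinear_lattice /= => hl; rewrite /reflection_sum !wave_real -!(rmorphD (real_complex R)).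
apply: (@congr1 _ _ (real_complex R) _ 0); rewrite /=.
have cosS (A y z : R) : cos (A + y + z) + cos (A - y + z) + (cos (A + y - z) + cos (A - y - z)) =
    4 * cos A * cos y * cos z.
  by rewrite !(cosD, sinD, cosN, sinN); ring.
have e1 := cosS (l.1 * xi.1 + l.2 * xi.2 + t.1) (s.1 * xi.1) (s.2 * xi.2).
have e2 := cosS (- (l.1 * xi.1) + l.2 * xi.2 + t.2) (- (s.1 * xi.1)) (s.2 * xi.2).
have E1 (y z : R) : (l.1 + y) * xi.1 + (l.2 + z) * xi.2 + t.1 =
  l.1 * xi.1 + l.2 * xi.2 + t.1 + y * xi.1 + z * xi.2 by ring.
have E2 (y z : R) : - ((l.1 + y) * xi.1) + (l.2 + z) * xi.2 + t.2 =
  - (l.1 * xi.1) + l.2 * xi.2 + t.2 + - (y * xi.1) + z * xi.2 by ring.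
rewrite !E1 !E2 !mulNr cosN in e1 e2 *.
have e3 := congr1 (fun y => 4 * y * cos (s.1 * xi.1) * cos (s.2 * xi.2)) hl.
rewrite /= in e3; move: e1 e2 e3; rewrite !opprK.
move=> /(congr1 (fun y => r.1 * y)) h1 /(congr1 (fun y => r.2 * y)) h2 h3.
rewrite /= in h1 h2; lra.
Qed.

End TestFunctions.

(** * Damped waves violate the sampling inequality *)

Section Necessity.
Context {R : realType}.
Variables (a b c d : R) (L : set (R * R)).
Hypotheses (a0 : 0 < a) (c0 : 0 < c).
Local Notation I := (`]a, b[%classic `*` `]c, d[%classic).
Implicit Types (M : set (R * R)) (p v l t xi r : R * R).

(** [S] is chosen before the scale [e]: for e <= 1 the factors S (e z) have type at most 1, so the
    test functions for all such scales lie in one Bernstein space. *)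
Lemma decaying_product : exists S : R[i] -> R[i], exp_type 1 S /\
  forall e : R, 0 < e -> forall w, w = (fun p => S (e * p.1)%:C%C * S (e * p.2)%:C%C) ->
  [/\ w 0 = 1, forall p, nm (w p) <= 1,
    forall p v, nm (w (p + v) - w p) <= bernstein_const 1 * e * (`|v.1| + `|v.2|) &
    forall p, `|p.1| * e * nm (w p) <= 2 /\ `|p.2| * e * nm (w p) <= 2].
Proof.
have [S [tS S0 S1 S2]] := @decaying_exp_type R; exists S; split => // e e0 w ->.
have lip (x h : R) : nm (S (e * (x + h))%:C%C - S (e * x)%:C%C) <= bernstein_const 1 * e * `|h|.
  have := exp_type_lipschitz_real ler01 tS S1 (e * x) (e * h).
  by rewrite -mulrDr mulr1 normrM (gtr0_norm e0) mulrA.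
split.
- by rewrite /= mulr0 (_ : 0%:C%C = 0)// S0 mulr1.
- by move=> p; rewrite nmM mulr_ile1 ?nm_ge0.
- move=> p v /=; set x1 := S _; set x2 := S _; set y1 := S _; set y2 := S _.
  have -> : x1 * x2 - y1 * y2 = (x1 - y1) * x2 + y1 * (x2 - y2) by ring.
  apply: le_trans (nmD _ _) _; rewrite !nmM mulrDr; apply: lerD.
    by rewrite -[leRHS]mulr1; apply: ler_pM; [exact: nm_ge0|exact: nm_ge0|exact: lip|exact: S1].
  by rewrite -[leRHS]mul1r; apply: ler_pM; [exact: nm_ge0|exact: nm_ge0|exact: S1|exact: lip].
move=> p; have e1 (x : R) : `|x| * e = `|e * x| by rewrite normrM (gtr0_norm e0) mulrC.
rewrite !e1 nmM; split.
  by rewrite mulrA -[leRHS]mulr1 ler_pM ?mulr_ge0 ?nm_ge0.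
by rewrite mulrCA -[leRHS]mul1r ler_pM ?mulr_ge0 ?nm_ge0.
Qed.

(** The wave damped at scale [e] has convolutions of size O(e) on a translate of L: near a point of
    M the damping is almost constant and the wave contributes 0, and far out the damping itself is
    O(e). Its sup norm stays at least half of |u p0|, which contradicts sampling for small [e]. *)
Lemma sampling_forces_nonlattice M t xi r (x : nat -> R * R) :
  (forall s, 0 < s -> sampling_inequality I L s) ->
  weakly_converges (fun k => translate L (x k)) M ->
  r.1 ^+ 2 + r.2 ^+ 2 = 1 -> curvilinear_lattice t xi r <> setT ->
  M `<=` curvilinear_lattice t xi r -> False.
Proof.
move=> HS [_ _ HM] r1 nT Ml.
pose u := real_restriction (wave t xi r).
have [p0 up0] : exists p0, u p0 != 0.
  apply: contrapT => H; apply: nT; rewrite -subTset => p _.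
  apply: contrapT => Hp; apply: H; exists p; apply/eqP => h; apply: Hp.
  by move: h; rewrite /u wave_real => -[] /eqP; rewrite subr_eq0 => /eqP.
have u2 p : nm (u p) <= 2 by exact: wave_le2.
set s := `|xi.1| + `|xi.2|; have s0 : 0 <= s by rewrite addr_ge0.
have bu : bernstein s (wave t xi r) by exact: bernstein_wave.
have pu : planar s u := bernstein_planar bu.
have [S [tS HSe]] := decaying_product.
have [Ks HK] := HS (s + 1 + 1) ltac:(lra).
have [Kc Kc0 HKc] := gauss_conv_distance a0 c0.
have B0 := @bernstein_const_gt0 R 1; set B := bernstein_const 1 in B0 HSe.
have Lu0 := bernstein_const_gt0 s; set Lu := bernstein_const s in Lu0.
(* The terms in [Lu] and [B] pay for moving the wave and the damping factor to a nearby point of M;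
   the last 4 is the bound 2 on the wave times the bound 2 e on the damping far out. *)
pose C := 4 * Lu + 4 * B + 4.
have C0 : 0 < C by rewrite /C; lra.
pose nu := nm (u p0); have nu0 : 0 < nu by exact: nm_gt0.
pose P := `|p0.1| + `|p0.2|; have P0 : 0 <= P by rewrite addr_ge0.
pose Kt := (`|Ks| + 1) * (C * Kc).
have Kt0 : 0 < Kt by rewrite mulr_gt0 ?ltr_wpDl// mulr_gt0.
(* The second entry keeps the damping at least 1/2 at p0, and the third makes the right-hand side of
   the sampling inequality at most nu / 4, against a sup norm of at least nu / 2. *)
pose e := Num.min 1 (Num.min ((2 * B * (P + 1))^-1) (nu / (4 * Kt))).
have BP : 0 < 2 * B * (P + 1) by rewrite !mulr_gt0// ltr_wpDl.
have e0 : 0 < e by rewrite !lt_min ltr01 invr_gt0 BP divr_gt0// mulr_gt0.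
have e1 : e <= 1 by rewrite ge_min lexx.
have e2 : B * e * P <= 1 / 2.
  have : e <= (2 * B * (P + 1))^-1 by rewrite ge_min; apply/orP; right; rewrite ge_min lexx.
  rewrite -(ler_pM2r BP) mulVf ?gt_eqF// => h.
  by have := mulr_gt0 B0 e0; nra.
have e3 : e * Kt <= nu / 4.
  have : e <= nu / (4 * Kt) by rewrite ge_min; apply/orP; right; rewrite ge_min lexx orbT.
  by rewrite ler_pdivlMr ?mulr_gt0//; lra.
pose w p := S (e * p.1)%:C%C * S (e * p.2)%:C%C.
have [w0 w1 wl wd] := HSe e e0 w erefl.
pose T (z : R[i]^o * R[i]^o) : R[i]^o := wave t xi r z *
  S (e%:C%C * z.1 + 0%:C%C * z.2 + 0%:C%C) * S (0%:C%C * z.1 + e%:C%C * z.2 + 0%:C%C).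
have bT : bernstein (s + 1 + 1) T.
  apply: bernsteinM; first apply: bernsteinM => //.
    by apply: bernstein_ridge; rewrite ?normr0 ?gtr0_norm.
  by apply: bernstein_ridge; rewrite ?normr0 ?gtr0_norm.
pose g := real_restriction T.
have gE p : g p = u p * w p.
  rewrite /g /real_restriction /T /w -mulrA; congr (_ * (S _ * S _)) => /=.
    by rewrite -[in RHS](addr0 (e * _)) !rmorphD !rmorphM /=; apply: eq_ReIm => /=; ring.
  by apply: eq_ReIm => /=; ring.
have pg : planar (s + 1 + 1) g := bernstein_planar bT.
have s2 : 0 <= s + 1 + 1 by lra.
have gbl := planar_bounded_lipschitz s2 pg.
(* Beyond the radius 1 / e^2 the decay bound |y| e |w| <= 2 yields |w| <= 2 e. *)
have [N HN] := HM (1 / e ^+ 2) e (divr_gt0 ltr01 (exprn_gt0 2 e0)) e0.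
have {HN}[HN _] := HN N (leqnn N).
have small al l : I al -> translate L (x N) l -> nm (gauss_conv g al l) <= C * e * Kc.
  move=> Ial Ll.
  have [a1 c2] : a <= al.1 /\ c <= al.2.
    by move: Ial => [/=]; rewrite !in_itv/= => /andP[h1 _] /andP[h2 _]; split; exact: ltW.
  have [a1' c2'] : 0 < al.1 /\ 0 < al.2 by split; [exact: lt_le_trans a1|exact: lt_le_trans c2].
  have [lsq|lsq] := pselect (open_square (1 / e ^+ 2) l).
    have [q Mq [v [v1 v2] lE]] := HN l (conj Ll lsq).
    have pwu : planar s (fun p => w q * u p) by exact: planarZ.
    have wbl := planar_bounded_lipschitz s0 pwu.
    (* The damping factor is frozen at its value at [q], so the comparison function is a multiple of
       the wave, whose reflection sums about [q] vanish. *)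
    have z0 : gauss_conv (fun p => w q * u p) al q = 0.
      apply: gauss_conv_of_reflection => // t'.
      have := wave_reflection t' (Ml q Mq); rewrite /reflection_sum -/u => h.
      by rewrite -!mulrDr h mulr0.
    rewrite -[gauss_conv g al l]subr0 -z0; apply: HKc => // s'.
    move: v1 v2; rewrite /= !in_itv/= -!ltr_norml => v1 v2.
    rewrite gE -lE (_ : q + v - s' = q - s' + v); last by rewrite addrAC.
    have h1 := planar_lipschitz s0 (q - s') v pu u2.
    have h2 := wl q (v - s'); rewrite (_ : q + (v - s') = q - s' + v) in h2; last first.
      by rewrite addrCA addrC.
    have -> : u (q - s' + v) * w (q - s' + v) - w q * u (q - s') =
        (u (q - s' + v) - u (q - s')) * w (q - s' + v) + u (q - s') * (w (q - s' + v) - w q) by ring.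
    apply: le_trans (nmD _ _) _; rewrite (nmM _ (w _)) (nmM _ (w _ - _)).
    have h3 : nm (u (q - s' + v) - u (q - s')) * nm (w (q - s' + v)) <= Lu * 2 * (e + e) * 1.
      apply: ler_pM; rewrite ?nm_ge0//; apply: le_trans h1 _; rewrite -/Lu.
      by rewrite ler_wpM2l ?mulr_ge0 ?(ltW Lu0)// lerD// ltW.
    have h4 : nm (u (q - s')) * nm (w (q - s' + v) - w q) <=
        2 * (B * e * ((e + e) + (`|s'.1| + `|s'.2|))).
      apply: ler_pM; rewrite ?nm_ge0//; apply: le_trans h2 _; rewrite -/B.
      rewrite ler_wpM2l ?mulr_ge0 ?(ltW B0) ?(ltW e0)//= addrACA.
      by rewrite lerD// (le_trans (ler_normB _ _))// lerD2r ltW.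
    apply: le_trans (lerD h3 h4) _; rewrite /linear_weight /C.
    set y := `|s'.1| + `|s'.2|; have y0 : 0 <= y by rewrite addr_ge0.
    have := mulr_ge0 (ltW e0) y0; have := mulr_gt0 B0 e0; have := mulr_gt0 Lu0 e0.
    move=> t1 t2 t3; have t4 : e * e <= e by rewrite ler_piMl// ltW.
    have t5 := ler_wpM2l (ltW B0) t4.
    have t6 := mulr_ge0 (ltW Lu0) t3; have t7 := mulr_ge0 (ltW B0) t3.
    lra.
  have wle : nm (w l) <= 2 * e.
    have [wd1 wd2] := wd l.
    have key (y : R) : 1 / e ^+ 2 <= y -> y * e * nm (w l) <= 2 -> nm (w l) <= 2 * e.
      rewrite ler_pdivrMr ?exprn_gt0// => h1 h2.
      have h3 := ler_wpM2l (ltW e0) h2; have h4 := ler_wpM2r (nm_ge0 (w l)) h1.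
      rewrite mul1r in h4; lra.
    have [h|h] := ltP `|l.1| (1 / e ^+ 2); last exact: key h wd1.
    have [h'|h'] := ltP `|l.2| (1 / e ^+ 2); last exact: key h' wd2.
    by exfalso; apply: lsq; split; rewrite /= in_itv/= -ltr_norml.
  have zbl : bounded_lipschitz (fun=> 0 : R[i]).
    by exists 0; split => [p|p v]; rewrite ?subr0 ?mul0r Normc.normc0.
  rewrite -[gauss_conv g al l]subr0 -(gauss_conv0 al l); apply: HKc => // s'.
  rewrite subr0 gE (nmM _ (w _)).
  have h2 := wl l (- s'); rewrite /= !normrN in h2.
  have h3 : nm (w (l - s')) <= 2 * e + B * e * (`|s'.1| + `|s'.2|).
    by rewrite -[w (l - s')](subrK (w l)) (le_trans (nmD _ _))// addrC lerD.
  apply: (@le_trans _ _ (2 * (2 * e + B * e * (`|s'.1| + `|s'.2|)))).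
    by apply: ler_pM; rewrite ?nm_ge0.
  rewrite /linear_weight /C.
  set y := `|s'.1| + `|s'.2|; have y0 : 0 <= y by rewrite addr_ge0.
  have t3 := mulr_ge0 (ltW e0) y0; have t2 := mulr_gt0 B0 e0; have t1 := mulr_gt0 Lu0 e0.
  have t6 := mulr_ge0 (ltW Lu0) t3; have t7 := mulr_ge0 (ltW B0) t3.
  lra.
have := HK _ (bernstein_shift (- x N) bT); set f := real_restriction _ => hK.
have fE : f = fun p => g (p + - x N).
  by apply/funext => p; rewrite /f /g /real_restriction /= !rmorphD.
have sf : sample_norm I L f <= C * e * Kc.
  apply: sample_norm_le; first by rewrite !mulr_ge0 ?(ltW C0) ?(ltW e0) ?(ltW Kc0).
  move=> al l Ial Ll; rewrite fE gauss_conv_shift; apply: small => //.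
  by exists l.
have sf0 := sample_norm_ge0 a b c d L f.
have hw : 1 / 2 <= nm (w p0).
  have := wl 0 p0; rewrite add0r w0 -/P -/B => h.
  have := nmB (w p0) (w p0 - 1); rewrite (_ : w p0 - (w p0 - 1) = 1); last by ring.
  rewrite Normc.normc1; lra.
have fs : nu / 2 <= sup_norm f.
  have [m [gm _]] := gbl.
  have fm y : nm (f y) <= m by rewrite fE.
  apply: le_trans (le_sup_norm (p0 + x N) fm); rewrite fE addrK gE (nmM _ (w _)) -/nu.
  by rewrite ler_wpM2l ?(ltW nu0)// -[leLHS]mul1r.
have h1 : Ks * sample_norm I L f <= (`|Ks| + 1) * (C * e * Kc).
  apply: le_trans (ler_norm _) _; rewrite normrM (ger0_norm sf0).
  by apply: ler_pM; rewrite // lerDl.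
have h2 : (`|Ks| + 1) * (C * e * Kc) = e * Kt by rewrite /Kt; ring.
lra.
Qed.

Lemma condition_A_of_sampling : (forall s, 0 < s -> sampling_inequality I L s) -> condition_A L.
Proof.
move=> HS M [x HM]; split; last first.
  by move=> t xi r r1 nT Ml; exact: sampling_forces_nonlattice HS HM r1 nT Ml.
apply: contrapT => M0.
(* With these parameters the lattice is empty. *)
apply: (@sampling_forces_nonlattice M (0, 0) (0, 0) (1, 0) x HS HM).
- by rewrite /= expr1n expr0n addr0.
- have e l : curvilinear_lattice (0, 0) (0, 0) (1, 0) l -> False :> Prop.
    rewrite /curvilinear_lattice /= !mulr0 !addr0 cos0 mulr1 mul0r.
    by move/eqP; rewrite oner_eq0.
  by move=> h; apply: (e 0); rewrite h.
by move=> l Ml; case: M0; exists l.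
Qed.

End Necessity.

Unset Implicit Arguments.

Theorem theorem2 (R : realType) (L : set (R * R)) (a b c d : R)
    (hL : uniformly_discrete L)
    (ha : 0 < a) (hab : a < b) (hc : 0 < c) (hcd : c < d) :
  (forall sigma : R, 0 < sigma ->
     sampling_inequality (`]a, b[%classic `*` `]c, d[%classic) L sigma)
  <-> condition_A L.
Proof.
split; first exact: condition_A_of_sampling.
by move=> cA s s0; apply: sampling_of_condition_A => //; exact: ltW.
Qed.
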